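(* Let $\mathcal{M}$ be a topological surface with triangular and rectangular faces and rational gluing data, satisfying the two compatibility conditions at vertices recalled in the context, and such that every crossing vertex of $\mathcal M$ has exactly $4$ edges. Let $\mathfrak{s}^{*}=\max\{\mathfrak{s}(\tau)\mid \tau\in\mathcal{M}_1\}$ be the maximal separability of its edges. Then for every $k\ge \mathfrak{s}^{*}$, $$\dim \mathcal{S}^1_k(\mathcal{M}) = (k-3)^2F_{\Box}+\tfrac12(k-5)(k-4)F_{\Delta}+\sum_{\tau\in\mathcal{M}_1}d_\tau(k)+4F_{\Box}+3F_{\Delta}-9F_1+3F_0+F_{+},$$ where $F_\Box$ is the number of rectangular faces, $F_\Delta$ the number of triangular faces, $F_1$ the number of edges, $F_0$ the number of vertices and $F_+$ the number of crossing vertices of $\mathcal{M}$, and $d_\tau(k)$ is the dimension of the space of syzygies of the gluing data along $\tau$ in degree $\le k$ defined in the context.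
   Context: **Topological surface.** $\mathcal{M}$ is given by a finite collection $\mathcal{M}_2$ of polygons (faces) in $\mathbb{R}^2$, each a triangle or a rectangle, together with identifications (homeomorphisms) of certain pairs of polygon edges; each polygon edge is paired with at most one other edge and never with itself. $\mathcal{M}_1$ is the set of edges of $\mathcal{M}$ (classes of identified polygon edges); an edge is interior if it comes from an identified pair, otherwise it is a boundary edge. $\mathcal{M}_0$ is the set of vertices (classes of identified polygon vertices); a vertex is interior if the faces around it close up cyclically. For a face $\sigma$, $F_\Delta(\sigma)=1$ if $\sigma$ is a triangle and $0$ if it is a rectangle; $\mathcal{R}_k(\sigma)$ is the space of real polynomials on $\sigma$ of total degree $\le k$ if $\sigma$ is a triangle and of bidegree $\le (k,k)$ (in coordinates along the sides) if $\sigma$ is a rectangle. **Adapted coordinates.** For a vertex $\gamma$ of a face $\sigma$ with edges $\tau,\tau'$ at $\gamma$, adapted coordinates $(u,v)$ are affine coordinates with $\gamma=(0,0)$, $\tau=\{(t,0):t\in[0,1]\}$, $\tau'=\{(0,t):t\in[0,1]\}$ (so $\sigma$ is the standard triangle or the unit square). **Gluing data.** Let $\tau=(\gamma,\gamma')$ be an interior edge shared by $\sigma_1,\sigma_2$. Use coordinates adapted to $\gamma$ with $\tau=\{(t,0)\}$ in $\sigma_1$ and $\tau=\{(0,t)\}$ in $\sigma_2$ (points with the same $t$ are identified). The gluing data is $\mathfrak a=a/c$, $\mathfrak b=b/c$ with $a,b,c\in\mathbb{R}[t]$, $b$ and $c$ nowhere zero on $[0,1]$. The $G^1$ condition along $\tau$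 for $(f_1,f_2)$ is, for $t\in[0,1]$, $$f_1(t,0)=f_2(0,t),\qquad \partial_{v_1}f_1(t,0)=\mathfrak b(t)\,\partial_{u_2}f_2(0,t)+\mathfrak a(t)\,\partial_{v_2}f_2(0,t).$$ Written in coordinates adapted to the other end point $\gamma'$ (again with $\tau=\{(t,0)\}$ in $\sigma_1$, $\{(0,t)\}$ in $\sigma_2$), the same condition has gluing data $\mathfrak a_{\gamma'}(t)=F_\Delta(\sigma_1)-F_\Delta(\sigma_2)\mathfrak b(1-t)-\mathfrak a(1-t)$, $\mathfrak b_{\gamma'}(t)=\mathfrak b(1-t)$; exchanging the roles of $\sigma_1,\sigma_2$ replaces $[\mathfrak a,\mathfrak b]$ by $[-\mathfrak a/\mathfrak b,1/\mathfrak b]$. The edge $\tau$ is a crossing edge at an end point if the gluing data at that end point satisfies $\mathfrak a(0)=0$; boundary edges are never crossing. A crossing vertex is an interior vertex all of whose edges are crossing edges at it. **Spline space.** $\mathcal{S}^1_k(\mathcal{M})$ is the real vector space of families $(f_\sigma)_{\sigma\in\mathcal{M}_2}$, $f_\sigma\in\mathcal{R}_k(\sigma)$, satisfying the $G^1$ condition along every interior edge. For an interior edge $\tau$ shared by $\sigma_1,\sigma_2$, $\mathcal{N}_\tau$ denotes the surface made only of $\sigma_1,\sigma_2$ glued along $\tau$ with the same gluing data. **Compatibility conditions.** At an interior vertex $\gamma$ with faces $\sigma_1,\dots,\sigma_F$ in cyclic order (indices mod $F$), let $\tau_i=\sigma_i\cap\sigma_{i+1}$, with adapted coordinates such that $\tau_i=\{v_i=0\}$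 in $\sigma_i$ and $\tau_i=\{u_{i+1}=0\}$ in $\sigma_{i+1}$, and let $[\mathfrak a_i,\mathfrak b_i]$ be the gluing data at $\gamma$ along $\tau_i$, i.e. $\partial_{v_i}f_i(t,0)=\mathfrak b_i(t)\partial_{u_{i+1}}f_{i+1}(0,t)+\mathfrak a_i(t)\partial_{v_{i+1}}f_{i+1}(0,t)$. (1) At every interior vertex, $M_1M_2\cdots M_F=I_2$ where $M_i=\begin{pmatrix}0&1\\ \mathfrak b_i(0)&\mathfrak a_i(0)\end{pmatrix}$. (2) At every crossing vertex with $4$ edges, $\mathfrak a_1'(0)+\frac{\mathfrak b_4'(0)}{\mathfrak b_4(0)}=-\mathfrak b_1(0)\Big(\mathfrak a_3'(0)+\frac{\mathfrak b_2'(0)}{\mathfrak b_2(0)}\Big)$ and $\mathfrak a_2'(0)+\frac{\mathfrak b_1'(0)}{\mathfrak b_1(0)}=-\mathfrak b_2(0)\Big(\mathfrak a_4'(0)+\frac{\mathfrak b_3'(0)}{\mathfrak b_3(0)}\Big)$. **$d_\tau(k)$.** For an interior edge $\tau=(\gamma,\gamma')$ shared by $\sigma_1,\sigma_2$, with gluing data $\mathfrak a=a/c$, $\mathfrak b=b/c$ ($a,b,c\in\mathbb{R}[t]$) in coordinates adapted to $\gamma$ such that $\tau=\{(t,0)\}$ in $\sigma_1$ and $\tau=\{(0,t)\}$ in $\sigma_2$, $d_\tau(k)=\dim_{\mathbb{R}}Z_k$, where $Z_k$ is the space of $(A,B,C)\in\mathbb{R}[t]^3$ with $aA+bB+cC=0$,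 $\deg A\le k-1$, $\deg B\le k-F_\Delta(\sigma_2)$, $\deg C\le k-F_\Delta(\sigma_1)$. For a boundary edge of a face $\sigma$, by convention $d_\tau(k)=2k+3-F_\Delta(\sigma)$. **Separability.** For a polynomial $f$ on a face $\sigma$ with vertex $\gamma$, $T^\sigma_\gamma(f)=[f,\partial_uf,\partial_vf,\partial_u\partial_vf](\gamma)$ in adapted coordinates. For an interior edge $\tau=(\gamma,\gamma')$ shared by $\sigma_1,\sigma_2$, $T_\gamma(f_1,f_2)=(T_\gamma^{\sigma_1}(f_1),T_\gamma^{\sigma_2}(f_2))$, likewise $T_{\gamma'}$, and $T_{\gamma,\gamma'}(f)=(T_\gamma(f),T_{\gamma'}(f))$. The separability $\mathfrak{s}(\tau)$ is the minimal $k$ such that $T_{\gamma,\gamma'}(\mathcal{S}^1_k(\mathcal{N}_\tau))=T_\gamma(\mathcal{S}^1_k(\mathcal{N}_\tau))\times T_{\gamma'}(\mathcal{S}^1_k(\mathcal{N}_\tau))$. For a boundary edge of a face $\sigma$, $\mathfrak{s}(\tau)=3+F_\Delta(\sigma)$.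
   Formalization: The separability of an interior edge is taken as the least k such that the product equality holds in every degree ≥ k, not just in degree k; with the single-degree reading the formula fails (four squares around a vertex, a=0, b=-1-t^4, c=1, k=3: dimension 25, formula 20). *)

(* Defs.v *)
From HB Require Import structures.
From mathcomp Require Import all_boot all_order all_algebra.
From mathcomp Require Import boolp classical_sets reals.
From mathcomp Require Import mpoly.

Set Implicit Arguments.
Unset Strict Implicit.
Unset Printing Implicit Defensive.
Import Order.TTheory GRing.Theory Num.Theory.
Local Open Scope ring_scope.

(** * Dimension of a linear subspace given as a set of vectors *)

Definition is_dim (K : fieldType) (V : lmodType K) (S : set V) (n : nat) : Prop :=
  exists e : 'I_n -> V,
    (forall c : 'I_n -> K, \sum_(i < n) c i *: e i = 0 -> forall i, c i = 0) /\
    (forall x, S x <-> exists c : 'I_n -> K, x = \sum_(i < n) c i *: e i).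

Definition dimS (K : fieldType) (V : lmodType K) (S : set V) : nat :=
  xget 0%N [set n | is_dim S n]%classic.

(** * Polygons *)

Definition nsides (tri : bool) : nat := if tri then 3 else 4.

(* A corner is a polygon vertex (before identification): the corners of a
   face are numbered cyclically around it. *)
Definition corner_of (F : finType) (tri : pred F) : finType :=
  {s : F & 'I_(nsides (tri s))}.

Definition next_corner (F : finType) (tri : pred F) (c : corner_of tri) :
  corner_of tri := Tagged (fun s => 'I_(nsides (tri s))) (ordS (tagged c)).

Definition prev_corner (F : finType) (tri : pred F) (c : corner_of tri) :
  corner_of tri := Tagged (fun s => 'I_(nsides (tri s))) (ord_pred (tagged c)).

Definition det2 (K : pzRingType) (p q : K * K) : K := p.1 * q.2 - p.2 * q.1.
Definition dot2 (K : pzRingType) (p q : K * K) : K := p.1 * q.1 + p.2 * q.2.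

(* A closed quadrilateral with nondegenerate right angles at its four corners
   is a rectangle. *)
Record polygons (R : realType) := Polygons {
  face : finType;
  is_tri : pred face;
  pos : corner_of is_tri -> R * R;
  pos_nondegenerate : forall c,
    det2 (pos (next_corner c) - pos c) (pos (prev_corner c) - pos c) != 0;
  pos_right_angle : forall c, ~~ is_tri (tag c) ->
    dot2 (pos (next_corner c) - pos c) (pos (prev_corner c) - pos c) = 0
}.

Notation corner P := (corner_of (@is_tri _ P)).

(* A flag is a corner together with one of the two polygon edges at it:
   (c, true) is the edge from c to [next_corner c], and (c, false) the edge from
   c to [prev_corner c]. A flag also stands for the coordinates (u, v) adapted
   to the corner in which the chosen edge is {v = 0}. *)
Definition flag (R : realType) (P : polygons R) : finType := (corner P * bool)%type.

Section Flags.
Variables (R : realType) (P : polygons R).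
Implicit Types (x : flag P).

Definition fface x : face P := tag x.1.

(* F_Delta of the face of x, as a natural number *)
Definition FD x : nat := is_tri (fface x).

(* same corner, other edge: exchanges u and v *)
Definition swap x : flag P := (x.1, ~~ x.2).

(* same polygon edge, other end point *)
Definition far x : flag P :=
  (if x.2 then next_corner x.1 else prev_corner x.1, ~~ x.2).

End Flags.

(** * Topological surfaces *)

(* [mate x = Some y] means that the polygon edge of x is identified with that of
   y, the corner of x with the corner of y, and the points with the same
   coordinate t measured from these corners. *)
Record surface (R : realType) := Surface {
  polys :> polygons R;
  mate : flag polys -> option (flag polys);
  mate_sym : forall x y, mate x = Some y -> mate y = Some x;
  mate_far : forall x y, mate x = Some y -> mate (far x) = Some (far y);
  mate_not_self : forall x y, mate x = Some y -> y <> x /\ y <> far x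
}.

Section Surface.
Variables (R : realType) (M : surface R).
Implicit Types (x y : flag M) (c : corner M) (s : seq (flag M)).

Definition edge_rel : rel (flag M) :=
  fun x y => (y == far x) || (mate x == Some y).

Definition vertex_rel : rel (corner M) :=
  fun c c' => [exists b, exists b', mate (c, b) == Some (c', b')].

(* The edges and vertices are the equivalence classes generated by these two
   symmetric relations; each class is given by its canonical representative. *)
Definition edges : {set flag M} := [set x | roots edge_rel x].
Definition vertices : {set corner M} := [set c | roots vertex_rel c].

(* If x has the edge tau_i = {v_i = 0} in sigma_i, then [turn x] is the flag of
   sigma_(i+1) with tau_i = {u_(i+1) = 0} and tau_(i+1) = {v_(i+1) = 0}. *)
Definition turn x : option (flag M) := omap (@swap _ M) (mate x).

(* s = [:: x_1; ...; x_F] lists the faces sigma_i around an interior vertex in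
   cyclic order, x_i carrying the edge tau_i between sigma_i and sigma_(i+1). *)
Definition interior_cycle s : bool :=
  [&& s != [::], uniq s & cycle (fun x y => turn x == Some y) s].

(** * Polynomials on faces and adapted coordinates *)

(* the polynomial p on the face of x, in the coordinates adapted to x *)
Definition adapted x (p : {mpoly R[2]}) : {mpoly R[2]} :=
  let O := pos x.1 in
  let U := pos (far x).1 - O in
  let V := pos (far (swap x)).1 - O in
  p \mPo [tuple O.1%:MP + U.1 *: 'X_(@ord0 1) + V.1 *: 'X_(@ord_max 1);
                O.2%:MP + U.2 *: 'X_(@ord0 1) + V.2 *: 'X_(@ord_max 1)].

Definition pt (u v : R) : 'I_2 -> R := fun i => if i == ord0 then u else v.
Definition du (p : {mpoly R[2]}) : {mpoly R[2]} := p^`M(@ord0 1).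
Definition dv (p : {mpoly R[2]}) : {mpoly R[2]} := p^`M(@ord_max 1).

Definition Rk (k : nat) (sigma : face M) (p : {mpoly R[2]}) : Prop :=
  if is_tri sigma then is_true (msize p <= k.+1)%N
  else forall x, fface x = sigma ->
         forall (m : 'X_{1..2}) (i : 'I_2), m \in msupp (adapted x p) -> (m i <= k)%N.

(** * Gluing data *)

(* The value p/q at t, and its derivative there (for q.[t] != 0) *)
Definition rval (p q : {poly R}) (t : R) : R := p.[t] / q.[t].
Definition rderiv (p q : {poly R}) (t : R) : R :=
  (p^`().[t] * q.[t] - p.[t] * q^`().[t]) / q.[t] ^+ 2.

(* The data at a glued flag x are those of its edge, in the coordinates adapted
   to the corner of x with sigma_1 the face of x. The last two fields relate the
   four flags of an interior edge. *)
Record gluing := Gluing {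
  na : flag M -> {poly R};
  nb : flag M -> {poly R};
  dc : flag M -> {poly R};
  gluing_nonzero : forall x y, mate x = Some y ->
    forall t : R, 0 <= t <= 1 -> (nb x).[t] != 0 /\ (dc x).[t] != 0;
  gluing_far : forall x y, mate x = Some y -> forall t : R, 0 <= t <= 1 ->
    rval (na (far x)) (dc (far x)) t =
      (FD x)%:R - (FD y)%:R * rval (nb x) (dc x) (1 - t)
      - rval (na x) (dc x) (1 - t) /\
    rval (nb (far x)) (dc (far x)) t = rval (nb x) (dc x) (1 - t);
  gluing_mate : forall x y, mate x = Some y -> forall t : R, 0 <= t <= 1 ->
    rval (na y) (dc y) t = - rval (na x) (dc x) t / rval (nb x) (dc x) t /\
    rval (nb y) (dc y) t = (rval (nb x) (dc x) t)^-1
}.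

Variable G : gluing.

Definition ga x (t : R) : R := rval (na G x) (dc G x) t.
Definition gb x (t : R) : R := rval (nb G x) (dc G x) t.
Definition ga' x (t : R) : R := rderiv (na G x) (dc G x) t.
Definition gb' x (t : R) : R := rderiv (nb G x) (dc G x) t.

(* p1 on the face of x, p2 on the face of y, where mate x = Some y *)
Definition G1 x y (p1 p2 : {mpoly R[2]}) : Prop :=
  let f1 := adapted x p1 in
  let f2 := adapted (swap y) p2 in
  forall t : R, 0 <= t <= 1 ->
    f1.@[pt t 0] = f2.@[pt 0 t] /\
    (dv f1).@[pt t 0] = gb x t * (du f2).@[pt 0 t] + ga x t * (dv f2).@[pt 0 t].

Definition splines (k : nat) : set {ffun face M -> {mpoly R[2]}} :=
  [set f | (forall sigma, Rk k sigma (f sigma)) /\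
           (forall x y, mate x = Some y -> G1 x y (f (fface x)) (f (fface y)))]%classic.

(** * Crossing vertices and compatibility conditions *)

(* the edge of x is a crossing edge at the corner of x *)
Definition crossing x : bool := (mate x != None) && (ga x 0 == 0).

Definition crossing_cycle s : bool := interior_cycle s && all crossing s.

Definition crossing_vertex c : Prop :=
  exists s, crossing_cycle s /\ c \in [seq x.1 | x <- s].

Definition crossing_vertices : {set corner M} :=
  [set c in vertices | `[< crossing_vertex c >]].

Definition transition x : 'M[R]_2 :=
  \matrix_(i < 2, j < 2)
    if i == ord0 then (if j == ord0 then 0 else 1)
    else (if j == ord0 then gb x 0 else ga x 0).

Definition compatibility1 : Prop :=
  forall s, interior_cycle s -> \prod_(x <- s) transition x = 1.

Definition compatibility2 : Prop :=
  forall x1 x2 x3 x4, crossing_cycle [:: x1; x2; x3; x4] ->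
    ga' x1 0 + gb' x4 0 / gb x4 0
      = - gb x1 0 * (ga' x3 0 + gb' x2 0 / gb x2 0) /\
    ga' x2 0 + gb' x1 0 / gb x1 0
      = - gb x2 0 * (ga' x4 0 + gb' x3 0 / gb x3 0).

Definition crossing_vertices_have_4_edges : Prop :=
  forall s, crossing_cycle s -> size s = 4%N.

(** * Syzygies of the gluing data *)

(* [size p <= n] means deg p <= n - 1. *)
Definition syzygies x y (k : nat) : set ({poly R} * {poly R} * {poly R}) :=
  [set Z | let: (A, B, C) := Z in
     na G x * A + nb G x * B + dc G x * C = 0 /\
     [/\ (size A <= k)%N, (size B <= k.+1 - FD y)%N
       & (size C <= k.+1 - FD x)%N]]%classic.

Definition d_ x (k : nat) : nat :=
  if mate x is Some y then dimS (syzygies x y k) else (2 * k + 3 - FD x)%N.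

(** * Separability *)

(* The edge of x (with mate x = Some y) has the faces sigma_1 of x and sigma_2
   of y; a spline on N_tau is a pair, even if both are the same face of M. *)
Definition edge_splines x y (k : nat) : set ({mpoly R[2]} * {mpoly R[2]}) :=
  [set f | [/\ Rk k (fface x) f.1, Rk k (fface y) f.2 & G1 x y f.1 f.2]]%classic.

Definition taylor x (p : {mpoly R[2]}) : R * R * R * R :=
  let f := adapted x p in
  (f.@[pt 0 0], (du f).@[pt 0 0], (dv f).@[pt 0 0], (du (dv f)).@[pt 0 0]).

Definition taylor2 x y (f : {mpoly R[2]} * {mpoly R[2]}) :=
  (taylor x f.1, taylor (swap y) f.2).

Definition separated x y (k : nat) : Prop :=
  let S := edge_splines x y k in
  ((fun f => (taylor2 x y f, taylor2 (far x) (far y) f)) @` S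
   = (taylor2 x y @` S) `*` (taylor2 (far x) (far y) @` S))%classic.

(* The separability is the smallest degree from which on the end points are
   separated. Equality in a single degree is not enough: when the low degree
   syzygies are all multiples of one of them, the equality can hold in degree k
   and fail again later. For two squares with a = 0, b = -1 - t^4, c = 1, it
   holds for k = 3 and fails for k = 6; with four squares glued in this way
   around a vertex, the dimension formula is false for k = 3. *)
Definition separated_from x y (k : nat) : Prop :=
  forall k', (k <= k')%N -> separated x y k'.

Definition separability x : nat :=
  if mate x is Some y then
    xget 0%N [set k | separated_from x y k /\
                      forall j, separated_from x y j -> (k <= j)%N]%classic
  else (3 + FD x)%N.

Definition max_separability : nat := (\max_(x in edges) separability x)%N.

End Surface.

(* Main.v *)
(* In coordinates (u, v) adapted to an edge {v = 0}, the edge data of p are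
   e0 = p(u, 0) and e1 = (dp/dv)(u, 0). The G1 condition says that both sides have
   the same e0 = h and that (h', B, -C), with B and C the two e1, is a syzygy of
   the gluing data. Three layers are peeled off a spline.
   - The Taylor data at the corners. Values and gradients are transported around
     the vertices without holonomy by condition (1): 3 F_0 parameters. Mixed
     derivatives are linked only across crossing edges, without holonomy by
     condition (2): one parameter for each piece into which the non-crossing edges
     cut a vertex. A piece that does not close up has two ends, so counting flags
     relates the number of pieces to F_+ and to the crossing edges.
   - The edge data with zero Taylor data at both ends. By separability their space
     has dimension d_tau - 9 plus the number of ends at which tau is crossing.
   - The polynomials on a face with zero edge data: the multiples of the squared
     product of the equations of its edges.
   Conversely, compatible data on the edges of a face come from a polynomial of
   degree k as soon as k >= 3 + F_Delta. *)
From HB Require Import structures.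
Require Import Defs.
From mathcomp Require Import all_boot all_order all_algebra.
From mathcomp Require Import boolp classical_sets reals.
From mathcomp Require Import mpoly polyXY ring lra zify.

Set Implicit Arguments.
Unset Strict Implicit.
Unset Printing Implicit Defensive.
Import Order.TTheory GRing.Theory Num.Theory.
Local Open Scope ring_scope.

(** * Dimension of subspaces *)

Lemma choice_dep (I : Type) (T : I -> Type) (P : forall i, T i -> Prop) :
  (forall i, exists x, P i x) -> exists f : forall i, T i, forall i, P i (f i).
Proof.
by move=> h; exists (fun i => projT1 (cid (h i))) => i; apply: (projT2 (cid (h i))).
Qed.

Section Dimension.
Variable K : fieldType.
Implicit Types V W : lmodType K.

Definition subspace V (S : set V) :=
  S 0 /\ forall (a : K) u v, S u -> S v -> S (a *: u + v).

Definition linmap V W (f : V -> W) :=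
  forall (a : K) u v, f (a *: u + v) = a *: f u + f v.

Lemma subspaceD V (S : set V) u v : subspace S -> S u -> S v -> S (u + v).
Proof. by case=> _ h su sv; rewrite -[u]scale1r; apply: h. Qed.

Lemma subspaceZ V (S : set V) a u : subspace S -> S u -> S (a *: u).
Proof. by case=> s0 h su; rewrite -[_ *: _]addr0; apply: h. Qed.

Lemma subspaceB V (S : set V) u v : subspace S -> S u -> S v -> S (u - v).
Proof. by move=> hS su sv; rewrite addrC -scaleN1r; apply: hS.2. Qed.

Lemma subspace_sum V (S : set V) (I : Type) (r : seq I) (P : pred I) (F : I -> V) :
  subspace S -> (forall i, P i -> S (F i)) -> S (\sum_(i <- r | P i) F i).
Proof.
move=> hS hF; elim/big_ind: _ => //; first exact: hS.1.
by move=> u v; apply: subspaceD.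
Qed.

Lemma linmap0 V W (f : V -> W) : linmap f -> f 0 = 0.
Proof.
move=> hf; have := hf (-1) 0 0.
by rewrite scaler0 addr0 scaleN1r addNr.
Qed.

Lemma linmapZ V W (f : V -> W) a u : linmap f -> f (a *: u) = a *: f u.
Proof. by move=> hf; rewrite -[a *: u]addr0 hf (linmap0 hf) addr0. Qed.

Lemma linmapD V W (f : V -> W) u v : linmap f -> f (u + v) = f u + f v.
Proof. by move=> hf; rewrite -[u]scale1r hf !scale1r. Qed.

Lemma linmapB V W (f : V -> W) u v : linmap f -> f (u - v) = f u - f v.
Proof. by move=> hf; rewrite linmapD // -scaleN1r linmapZ // scaleN1r. Qed.

Lemma linmap_sum V W (f : V -> W) (I : Type) (r : seq I) (P : pred I) (F : I -> V) :
  linmap f -> f (\sum_(i <- r | P i) F i) = \sum_(i <- r | P i) f (F i).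
Proof.
move=> hf; apply: (big_morph f); first by move=> u v; apply: linmapD.
exact: linmap0.
Qed.

Lemma is_dim_fin V (S : set V) (I : finType) (e : I -> V) :
  (forall c : I -> K, \sum_i c i *: e i = 0 -> forall i, c i = 0) ->
  (forall x, S x <-> exists c : I -> K, x = \sum_i c i *: e i) ->
  is_dim S #|I|.
Proof.
have re (c : 'I_#|I| -> K) :
    \sum_(i < #|I|) c i *: e (enum_val i) = \sum_i c (enum_rank i) *: e i.
  rewrite (reindex enum_rank) /=; last by apply: onW_bij; apply: enum_rank_bij.
  by apply: eq_bigr => i _; rewrite enum_rankK.
move=> fr sp; exists (fun i => e (enum_val i)); split.
  by move=> c; rewrite re => /fr h i; rewrite -(enum_valK i).
move=> x; rewrite sp; split=> -[c ->]; last by exists (fun i => c (enum_rank i)).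
exists (fun i => c (enum_val i)); rewrite re.
by apply: eq_bigr => i _; rewrite enum_rankK.
Qed.

Lemma is_dim_subspace V (S : set V) n : is_dim S n -> subspace S.
Proof.
case=> e [_ sp]; split.
  by apply/sp; exists (fun=> 0); rewrite big1 // => i _; rewrite scale0r.
move=> a u v /sp[c ->] /sp[d ->]; apply/sp; exists (fun i => a * c i + d i).
rewrite scaler_sumr -big_split; apply: eq_bigr => i _ /=.
by rewrite scalerDl scalerA.
Qed.

Lemma free_le_dim V (T : set V) m n (e : 'I_n -> V) : is_dim T m ->
  (forall c : 'I_n -> K, \sum_(i < n) c i *: e i = 0 -> forall i, c i = 0) ->
  (forall i, T (e i)) -> (n <= m)%N.
Proof.
case=> f [_ sp] fr inT; have /choice [P hP] : forall i, exists c : 'I_m -> K,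
  e i = \sum_(j < m) c j *: f j by move=> i; apply/sp.
rewrite leqNgt; apply/negP => ltmn.
pose A : 'M[K]_(n, m) := \matrix_(i, j) P i j.
have : kermx A != 0.
  by rewrite kermx_eq0 /row_free neq_ltn (leq_ltn_trans (rank_leq_col A) ltmn).
case/rowV0Pn => v /sub_kermxP vA /eqP []; apply/rowP => i; rewrite mxE.
apply: (fr (fun i => v ord0 i)).
rewrite (eq_bigr (fun i => \sum_(j < m) (v ord0 i * A i j) *: f j)); last first.
  move=> k _; rewrite [in LHS]hP scaler_sumr; apply: eq_bigr => j _.
  by rewrite scalerA mxE.
rewrite exchange_big big1 // => j _ /=; rewrite -scaler_suml.
by have /rowP/(_ j) := vA; rewrite !mxE => ->; rewrite scale0r.
Qed.

Lemma basis_mem V (S : set V) n (e : 'I_n -> V) :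
  (forall x, S x <-> exists c : 'I_n -> K, x = \sum_(i < n) c i *: e i) -> forall i, S (e i).
Proof.
move=> sp i; apply/sp; exists (fun j => (j == i)%:R); rewrite (bigD1 i) //= eqxx scale1r.
by rewrite big1 ?addr0 // => j /negPf ->; rewrite scale0r.
Qed.

Lemma is_dim_unique V (S : set V) m n : is_dim S m -> is_dim S n -> m = n.
Proof.
have le k l : is_dim S k -> is_dim S l -> (k <= l)%N.
  by case=> e [fr sp] Sl; apply: (free_le_dim Sl fr); apply: basis_mem.
by move=> Sm Sn; apply/eqP; rewrite eqn_leq !le.
Qed.

Lemma dimSE V (S : set V) n : is_dim S n -> dimS S = n.
Proof.
move=> Sn; rewrite /dimS; case: xgetP => [m _ Sm|/(_ n)//].
exact: is_dim_unique Sm Sn.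
Qed.

Lemma is_dim0 V (S : set V) : (forall x, S x <-> x = 0) -> is_dim S 0.
Proof.
move=> hS; rewrite -[0%N](card_ord 0); apply: (is_dim_fin (e := fun=> 0)).
  by move=> c _ [].
by move=> x; rewrite hS; split=> [->|[c ->]]; [exists (fun=> 0)|]; rewrite big_ord0.
Qed.

Lemma eq_is_dim V (S T : set V) n : (forall x, S x <-> T x) -> is_dim S n -> is_dim T n.
Proof. by move=> h [e [fr sp]]; exists e; split=> // x; rewrite -h. Qed.

Lemma free_extend V (S : set V) r (e : 'I_r -> V) x :
  (forall c : 'I_r -> K, \sum_(i < r) c i *: e i = 0 -> forall i, c i = 0) ->
  ~ (exists c : 'I_r -> K, x = \sum_(i < r) c i *: e i) ->
  (forall i, S (e i)) -> S x ->
  exists f : 'I_r.+1 -> V, (forall i, S (f i)) /\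
    (forall c : 'I_r.+1 -> K, \sum_(i < r.+1) c i *: f i = 0 -> forall i, c i = 0).
Proof.
move=> fr nsp Se Sx; exists (fun i => oapp e x (unlift ord_max i)); split.
  by move=> i; case: unliftP => [j|] _ /=.
move=> c; rewrite big_ord_recr /= unlift_none /=.
rewrite (eq_bigr (fun i : 'I_r => c (lift ord_max i) *: e i)); last first.
  move=> i _; have -> : widen_ord (leqnSn r) i = lift ord_max i.
    by apply: val_inj; rewrite /= /bump leqNgt ltn_ord.
  by rewrite liftK.
have [c0|c0] := eqVneq (c ord_max) 0.
  rewrite c0 scale0r addr0 => /fr h i.
  by case: (unliftP ord_max i) => [j|] -> //; apply: h.
move=> h; case: nsp; exists (fun i => - (c ord_max)^-1 * c (lift ord_max i)).
move/eqP: h; rewrite addrC addr_eq0 => /eqP h.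
rewrite -[LHS]scale1r -(mulVf c0) -scalerA h scalerN -scaleNr scaler_sumr.
by apply: eq_bigr => i _; rewrite scalerA.
Qed.

Lemma is_dim_sub V (S T : set V) m : is_dim T m -> subspace S ->
  (forall x, S x -> T x) -> exists n, is_dim S n.
Proof.
move=> Tm sS ST.
pose Q r := `[< exists e : 'I_r -> V, (forall i, S (e i)) /\
  (forall c : 'I_r -> K, \sum_(i < r) c i *: e i = 0 -> forall i, c i = 0) >].
have Q0 : exists r, Q r by exists 0%N; apply/asboolP; exists (fun=> 0); split=> [[]|? _ []].
have Qm r : Q r -> (r <= m)%N.
  by case/asboolP=> e [Se fr]; apply: (free_le_dim Tm fr) => i; apply: ST.
case: (ex_maxnP Q0 Qm) => r /asboolP[e [Se fr]] rmax.
exists r, e; split=> // x; split=> [Sx|[c ->]]; last first.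
  by apply: subspace_sum => // i _; apply: subspaceZ.
apply: contrapT => nsp; have [f hf] := free_extend fr nsp Se Sx.
by have := rmax r.+1; rewrite ltnn => h; apply/notF/h/asboolP; exists f.
Qed.

Lemma is_dim_ker_im V W (f : V -> W) (S : set V) n1 n2 : linmap f -> subspace S ->
  is_dim [set x | S x /\ f x = 0]%classic n1 -> is_dim (f @` S)%classic n2 ->
  is_dim S (n1 + n2).
Proof.
move=> hf sS [e [efr esp]] [g [gfr gsp]].
have eS := basis_mem esp.
have /choice [d dP] : forall i, exists x, S x /\ f x = g i.
  by move=> i; have [x Sx <-] := basis_mem gsp i; exists x.
have -> : (n1 + n2 = #|{: 'I_n1 + 'I_n2}|)%N by rewrite card_sum !card_ord.
pose h i := match i with inl i => e i | inr i => d i end.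
have fS c : f (\sum_(i < n1) c i *: e i) = 0.
  rewrite linmap_sum // big1 // => i _; rewrite linmapZ //.
  by have [_ ->] := eS i; rewrite scaler0.
have fd (c : 'I_n2 -> K) : f (\sum_(i < n2) c i *: d i) = \sum_(i < n2) c i *: g i.
  rewrite linmap_sum //; apply: eq_bigr => i _; rewrite linmapZ //.
  by have [_ ->] := dP i.
apply: (is_dim_fin (e := h)).
  move=> c; rewrite big_sumType /= => c0.
  have c2 : forall i, c (inr i) = 0.
    apply: gfr; rewrite -fd; move/(congr1 f): c0.
    by rewrite linmapD // fS add0r linmap0.
  case=> // i; apply: (efr (fun i => c (inl i))).
  by move: c0; rewrite [X in _ + X]big1 ?addr0 // => j _; rewrite c2 scale0r.
move=> x; split=> [Sx|[c ->]]; last first.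
  apply: subspace_sum => // -[] i _; apply: subspaceZ => //.
    by have [] := eS i.
  by have [] := dP i.
have /gsp [c2 fx] : (f @` S)%classic (f x) by exists x.
have /esp [c1 hx] : [set x | S x /\ f x = 0]%classic (x - \sum_(i < n2) c2 i *: d i).
  split; last by rewrite linmapB // fd fx subrr.
  apply: subspaceB => //; apply: subspace_sum => // i _; apply: subspaceZ => //.
  by have [] := dP i.
exists (fun i => match i with inl i => c1 i | inr i => c2 i end).
by rewrite big_sumType /= -hx subrK.
Qed.

Lemma is_dim_prod V (I : finType) (S : I -> set V) (n : I -> nat) :
  (forall i, is_dim (S i) (n i)) ->
  is_dim [set f : {ffun I -> V} | forall i, S i (f i)]%classic (\sum_i n i).
Proof.
move=> h; have /choice_dep [e eP] := h.
have -> : (\sum_i n i = #|{: {i : I & 'I_(n i)}}|)%N.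
  rewrite card_tagged sumnE big_map big_enum; apply: eq_bigr => i _.
  by rewrite card_ord.
pose d (p : {i : I & 'I_(n i)}) : {ffun I -> V} :=
  [ffun j => if j == tag p then e (tag p) (tagged p) else 0].
have dE (c : {i : I & 'I_(n i)} -> K) j : (\sum_p c p *: d p) j =
    \sum_(k < n j) c (Tagged (fun i => 'I_(n i)) k) *: e j k.
  rewrite sum_ffunE.
  rewrite (eq_bigr (fun p => (fun i (k : 'I_(n i)) =>
      if j == i then c (Tagged (fun i => 'I_(n i)) k) *: e i k else 0)
      (tag p) (tagged p))); last first.
    by move=> [i k] _; rewrite !ffunE /=; case: eqP; rewrite ?scaler0.
  rewrite -(sig_big_dep xpredT (fun=> xpredT) (fun i (k : 'I_(n i)) =>
      if j == i then c (Tagged (fun i => 'I_(n i)) k) *: e i k else 0)) /=.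
  rewrite (bigD1 j) //= eqxx [X in _ + X]big1 ?addr0 // => i /negPf ij.
  by rewrite big1 // => k _; rewrite eq_sym ij.
apply: (is_dim_fin (e := d)).
  move=> c /ffunP c0 [i k]; have := (eP i).1 (fun k => c (Tagged _ k)).
  by apply; rewrite -dE c0 ffunE.
move=> f; split=> [Sf|[c ->] j]; last by rewrite dE; apply/(eP j).2; eexists.
have /choice_dep [c cP] : forall i, exists c : 'I_(n i) -> K,
  f i = \sum_(k < n i) c k *: e i k by move=> i; apply/(eP i).2/Sf.
exists (fun p => c (tag p) (tagged p)); apply/ffunP => j.
by rewrite dE /= cP.
Qed.

Section Coordinates.
Variables (V : lmodType K) (I : finType) (A : {set I}) (lam : I -> V -> K).
Hypothesis lamP : forall i a u v, lam i (a *: u + v) = a * lam i u + lam i v.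

Lemma lam_linmap i : linmap (lam i : V -> K^o).
Proof. by move=> a u v; apply: lamP. Qed.

Lemma lam_sum i (J : finType) (c : J -> K) (e : J -> V) :
  lam i (\sum_j c j *: e j) = \sum_j c j * lam i (e j).
Proof.
rewrite (linmap_sum _ _ _ (lam_linmap i)); apply: eq_bigr => j _.
exact: (linmapZ _ _ (lam_linmap i)).
Qed.

Lemma is_dim_coord (S : set V) : subspace S ->
  (forall x, S x -> (forall i, i \in A -> lam i x = 0) -> x = 0) ->
  (forall g : I -> K, exists2 x, S x & forall i, i \in A -> lam i x = g i) ->
  is_dim S #|A|.
Proof.
move=> sS inj sur; rewrite -card_sig.
have /choice [e eP] : forall j : {i | i \in A}, exists x, S x /\
    forall i, i \in A -> lam i x = (i == val j)%:R.
  by move=> j; have [x Sx xP] := sur (fun i => (i == val j)%:R); exists x.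
have lamE (c : {i | i \in A} -> K) (j : {i | i \in A}) :
    lam (val j) (\sum_j c j *: e j) = c j.
  rewrite lam_sum (bigD1 j) //= (eP _).2 ?(valP j) // eqxx mulr1.
  rewrite big1 ?addr0 // => k kj; rewrite (eP _).2 ?(valP j) //.
  by rewrite (inj_eq val_inj) eq_sym (negPf kj) mulr0.
apply: (is_dim_fin (e := e)).
  move=> c c0 j; rewrite -lamE c0.
  exact: (linmap0 (lam_linmap _)).
have Sc (c : {i | i \in A} -> K) : S (\sum_j c j *: e j).
  by apply: subspace_sum => // j _; apply: subspaceZ => //; have [] := eP j.
move=> x; split=> [Sx|[c ->] //]; exists (fun j => lam (val j) x).
apply/eqP; rewrite -subr_eq0; apply/eqP; apply: inj; first exact: subspaceB.
move=> i iA; rewrite (linmapB _ _ (lam_linmap i)); apply/eqP; rewrite subr_eq0; apply/eqP.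
exact: esym (lamE (fun j => lam (val j) x) (exist _ i iA)).
Qed.

Lemma is_dim_kernel (S : set V) n : is_dim S n ->
  (forall g : I -> K, exists2 x, S x & forall i, i \in A -> lam i x = g i) ->
  exists m, (m + #|A| = n)%N /\
    is_dim [set x | S x /\ forall i, i \in A -> lam i x = 0]%classic m.
Proof.
move=> Sn sur; have sS := is_dim_subspace Sn.
have sK : subspace [set x | S x /\ forall i, i \in A -> lam i x = 0]%classic.
  split; first split; first exact: sS.1.
    by move=> i _; apply: (linmap0 (lam_linmap i)).
  move=> a u v [Su u0] [Sv v0]; split; first exact: sS.2.
  by move=> i iA; rewrite lamP u0 // v0 // mulr0 addr0.
have [|m Km] := is_dim_sub Sn sK; first by move=> x [].
exists m; split=> //.
pose f x : {ffun I -> K^o} := [ffun i => if i \in A then lam i x : K^o else 0].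
have hf : linmap f.
  move=> a u v; apply/ffunP => i; rewrite !ffunE; case: ifP => _; first exact: lamP.
  by rewrite scaler0 addr0.
apply: is_dim_unique Sn; apply: (is_dim_ker_im hf sS).
  apply: eq_is_dim Km => x; split=> -[Sx x0]; split=> //.
    by apply/ffunP => i; rewrite !ffunE; case: ifP => // /x0.
  by move=> i iA; have /ffunP/(_ i) := x0; rewrite !ffunE iA.
have -> : (f @` S = [set g : {ffun I -> K^o} | forall i, i \notin A -> g i = 0])%classic.
  apply/seteqP; split=> g /=.
    by case=> x Sx <- i iA; rewrite ffunE (negPf iA).
  move=> g0; have [x Sx xP] := sur g; exists x => //; apply/ffunP => i.
  by rewrite ffunE; case: ifPn => [/xP|/g0].
have -> : #|A| = (\sum_i (i \in A))%N by rewrite -sum1_card big_mkcond.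
apply: eq_is_dim (is_dim_prod (S := fun i => [set y : K^o | i \notin A -> y = 0]%classic)
  (n := fun i => i \in A) _) => // i; case: (boolP (i \in A)) => iA /=.
  have -> : 1%N = #|'I_1| by rewrite card_ord.
  apply: (is_dim_fin (e := fun=> 1 : K^o)).
    by move=> c; rewrite big_ord1 => /eqP; rewrite scaler_eq0 oner_eq0 orbF => /eqP c0 j; rewrite ord1.
  move=> x; split=> // _; exists (fun=> x); rewrite big_ord1.
  by rewrite /GRing.scale /= mulr1.
by apply: is_dim0 => x; split=> [h|-> _ //]; apply: h.
Qed.

End Coordinates.
End Dimension.

Local Close Scope ring_scope.
(** * Turning around a vertex *)

Section Chains.
Variables (T : finType) (m : T * bool -> option (T * bool)).
Hypothesis m_sym : forall a b, m a = Some b -> m b = Some a.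
Hypothesis m_neq : forall a, m a <> Some a.
Implicit Types (a b x y : T * bool) (s : seq (T * bool)) (c : T).

Definition other a : T * bool := (a.1, ~~ a.2).
Definition turn_rel : rel (T * bool) := fun a b => omap other (m a) == Some b.
Definition corner_rel : rel T :=
  fun c c' => [exists b, exists b', m (c, b) == Some (c', b')].

Lemma otherK a : other (other a) = a.
Proof. by case: a => c b; rewrite /other negbK. Qed.

Lemma other1 a : (other a).1 = a.1. Proof. by []. Qed.

Lemma other_neq a : other a <> a.
Proof. by case: a => c []. Qed.

Lemma corner_eq a b : a.1 = b.1 -> a = b \/ a = other b.
Proof.
case: a b => [c b] [c' b'] /= <-.
by rewrite /other /=; case: b b' => -[]; auto.
Qed.

Lemma m_inj a b d : m a = Some d -> m b = Some d -> a = b.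
Proof. by move=> /m_sym h /m_sym; rewrite h => -[]. Qed.

Lemma turn_relP a b : reflect (m a = Some (other b)) (turn_rel a b).
Proof.
rewrite /turn_rel; case: (m a) => [d|] /=; last by constructor.
apply: (iffP eqP) => [[<-]|[->]]; by rewrite otherK.
Qed.

Lemma corner_relP a b : m a = Some b -> corner_rel a.1 b.1.
Proof.
case: a b => [c i] [c' i'] /= h; apply/existsP; exists i; apply/existsP; exists i'.
exact/eqP.
Qed.

Lemma corner_rel_sym : ssrbool.symmetric corner_rel.
Proof.
move=> c c'; apply/existsP/existsP => -[b /existsP[b' /eqP h]];
by exists b'; apply/existsP; exists b; apply/eqP/m_sym.
Qed.

Lemma connect_corner_sym : connect_sym corner_rel.
Proof. exact: sym_connect_sym corner_rel_sym. Qed.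

Lemma corner_ind (Q : T -> Prop) c c' :
  (forall a b, m a = Some b -> Q a.1 -> Q b.1) ->
  connect corner_rel c c' -> Q c -> Q c'.
Proof.
move=> h /connectP[p pp ->]; elim: p c pp => //= d p IH c /andP[cd /IH] {}IH Qc.
apply: IH; move/existsP: cd => [b /existsP[b' /eqP e]].
exact: (h _ _ e).
Qed.

Lemma path_connect x s : path turn_rel x s ->
  forall y, y \in x :: s -> connect corner_rel x.1 y.1.
Proof.
elim: s x => [|z s IH] x /=; first by move=> _ y; rewrite inE => /eqP ->.
case/andP=> /turn_relP xz /IH h y; rewrite inE => /predU1P[->//|/h].
by apply: connect_trans; apply: connect1; apply: (corner_relP xz).
Qed.

Definition closed_chain x s := turn_rel (last x s) x.
Definition open_chain x s := m (other x) = None /\ m (last x s) = None.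
Definition chain x s := path turn_rel x s /\ uniq (map fst (x :: s)).

Lemma chain_uniq x s : chain x s -> uniq (x :: s).
Proof. by case=> _; apply: map_uniq. Qed.

Lemma chain_inj x s i j : chain x s -> i < size (x :: s) -> j < size (x :: s) ->
  (nth x (x :: s) i).1 = (nth x (x :: s) j).1 -> i = j.
Proof.
move=> [_ u] hi hj; rewrite -!(nth_map _ x.1) // => /eqP.
by rewrite nth_uniq ?size_map // => /eqP.
Qed.

Lemma chain_next x s i : chain x s -> i < size s ->
  m (nth x (x :: s) i) = Some (other (nth x (x :: s) i.+1)).
Proof. by case=> /(pathP x) h _ /h /turn_relP. Qed.

Lemma corner_nth x s c : c \in map fst (x :: s) ->
  exists2 i, i < size (x :: s) & c = (nth x (x :: s) i).1.
Proof. by case/mapP=> a /(nthP x)[i hi <-] ->; exists i. Qed.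

Lemma chain_exists c : exists x s,
  [/\ chain x s, c \in map fst (x :: s) & closed_chain x s \/ open_chain x s].
Proof.
pose P n := `[< exists x s, [/\ chain x s, c \in map fst (x :: s) & size s = n] >].
have P0 : exists n, P n.
  by exists 0; apply/asboolP; exists (c, true), [::]; rewrite /= inE.
have Pb n : P n -> n <= #|T|.
  case/asboolP=> x [s [[_ u] _ <-]]; apply: ltnW.
  by have := max_card (mem (map fst (x :: s))); rewrite (card_uniqP u) /= size_map.
case: (ex_maxnP P0 Pb) => n /asboolP[x [s [ch cs sn]]] nmax.
have maxl x' s' : chain x' s' -> c \in map fst (x' :: s') -> size s' <= size s.
  by move=> ch' cs'; rewrite sn; apply: nmax; apply/asboolP; exists x', s'.
exists x, s; split=> //.
have [pxs us] := ch.
have lastE : last x s = nth x (x :: s) (size s) by rewrite (last_nth x).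
case E: (m (last x s)) => [y|]; last first.
  right; split=> //; case E': (m (other x)) => [y|//].
  have yx : m y = Some (other x) by apply: m_sym.
  have [/corner_nth[i hi yi]|yn] := boolP (y.1 \in map fst (x :: s)); last first.
    have := maxl y (x :: s); rewrite ltnn => h; exfalso; suff: false by []; apply: h; last by rewrite /= inE cs orbT.
    split; last by rewrite map_cons cons_uniq yn.
    by rewrite /= pxs andbT; apply/turn_relP.
  have {yi}[yi|yi] := corner_eq yi.
    move: hi; rewrite /= ltnS leq_eqVlt => /predU1P[ei|hi].
      by move: yx; rewrite yi ei -lastE E.
    have := chain_next ch hi; rewrite -yi yx => /Some_inj /(congr1 other); rewrite !otherK => e.
    by have := @chain_inj _ _ 0 i.+1 ch isT hi; rewrite -e => /(_ erefl).
  case: i hi yi => [|i] hi yi; first by move: E'; rewrite yi /= => /m_neq.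
  have e := chain_next ch hi; rewrite -yi in e.
  have e2 := m_sym e; rewrite yx in e2; move/Some_inj: e2 => e2.
  have h := @chain_inj _ _ 0 i ch isT (ltnW hi); rewrite /= in h.
  have /h i0 : x.1 = (nth x (x :: s) i).1 by rewrite -e2.
  by move: e2; rewrite -i0 /= => /other_neq.
left; apply/turn_relP; rewrite E; congr Some.
have [/corner_nth[i hi yi]|yn] := boolP (y.1 \in map fst (x :: s)); last first.
  have := maxl x (rcons s (other y)).
  rewrite size_rcons ltnn => h; exfalso; suff: false by []; apply: h; last first.
    by rewrite -rcons_cons map_rcons mem_rcons inE cs orbT.
  split; last by rewrite -rcons_cons map_rcons rcons_uniq yn.
  by rewrite rcons_path pxs; apply/turn_relP; rewrite otherK.
have {yi}[yi|yi] := corner_eq yi; last first.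
  case: i hi yi => [//|i] hi yi.
  have := chain_next ch hi; rewrite -yi -E => /esym e.
  have e2 : last x s = nth x (x :: s) i.
    by apply: (@m_inj _ _ y) => //; rewrite -e.
  have := @chain_inj _ _ (size s) i ch (leqnn _) (ltnW hi).
  rewrite -lastE e2 => /(_ erefl) e3.
  by move: hi; rewrite /= -e3 ltnn.
move: hi; rewrite /= ltnS leq_eqVlt => /predU1P[ei|hi].
  by move: E; rewrite yi ei -lastE => /m_neq.
have := chain_next ch hi; rewrite -yi (m_sym E) => /Some_inj e.
have := @chain_inj _ _ (size s) i.+1 ch (leqnn _) hi.
rewrite -lastE e => /(_ erefl) e3; move: e; rewrite -e3 -lastE => e.
by have := other_neq (esym e).
Qed.

Lemma chain_dir x s a b : chain x s -> closed_chain x s \/ open_chain x s ->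
  a.1 \in map fst (x :: s) -> m a = Some b -> a \in x :: s \/ b \in x :: s.
Proof.
move=> ch full /corner_nth[i hi /corner_eq[->|ea]] ab; first by left; apply: mem_nth.
right; case: i hi ea => [|i] hi ea.
  case: full => [/turn_relP h|[h _]]; last by rewrite ea h in ab.
  by move/m_sym: h; rewrite -[x]/(nth x (x :: s) 0) -ea ab => -[->]; apply: mem_last.
have := m_sym (chain_next ch hi); rewrite -ea ab => -[->].
by apply: mem_nth; apply: ltnW.
Qed.

Lemma chain_step x s i b : chain x s -> closed_chain x s \/ open_chain x s ->
  i < size (x :: s) -> m (nth x (x :: s) i) = Some b ->
  (i < size s /\ b = other (nth x (x :: s) i.+1)) \/
  [/\ i = size s, b = other x & closed_chain x s].
Proof.
move=> ch full; rewrite /= ltnS leq_eqVlt => /predU1P[->|hi]; last first.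
  by rewrite chain_next // => -[<-]; left.
rewrite -(last_nth x) => e; right; case: full => [|[_]]; last by rewrite e.
by move=> h; split=> //; move/turn_relP: h; rewrite e => -[].
Qed.

Lemma chain_closed x s c c' : chain x s -> closed_chain x s \/ open_chain x s ->
  c \in map fst (x :: s) -> connect corner_rel c c' = (c' \in map fst (x :: s)).
Proof.
move=> ch full cs; apply/idP/idP => [cc'|].
  pose Q d := d \in map fst (x :: s); apply: (@corner_ind Q c c') => // a b ab Qa.
  have fwd i d : i < size (x :: s) -> m (nth x (x :: s) i) = Some d -> Q d.1.
    move=> hi /(chain_step ch full hi)[[hi' ->]|[_ -> _]].
      exact: (map_f fst (@mem_nth _ x (x :: s) i.+1 hi')).
    exact: (map_f fst (mem_head x s)).
  have [/(nthP x)[i hi e]|bs] := chain_dir ch full Qa ab.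
    by apply: (fwd i) => //; rewrite e.
  exact: map_f.
case/mapP=> a ax ->; move/mapP: cs => [d dx ->].
have p := path_connect ch.1.
apply: connect_trans (p _ ax); rewrite connect_corner_sym; exact: p.
Qed.

Section Transport.
Variables (X : Type) (tau : T * bool -> X -> X).
Hypothesis tauK : forall a b, m a = Some b -> cancel (tau a) (tau b).
Hypothesis holonomy : forall s, s != [::] -> uniq s -> cycle turn_rel s ->
  forall v, foldl (fun v a => tau a v) v s = v.

Lemma transport_chain x s c w : chain x s -> closed_chain x s \/ open_chain x s ->
  c \in map fst (x :: s) -> exists D : T -> X, D c = w /\
  (forall a b, a.1 \in map fst (x :: s) -> m a = Some b -> D b.1 = tau a (D a.1)).
Proof.
move=> ch full cs; pose t := x :: s; pose F v a := tau a v.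
pose h v i := foldl F v (take i t).
have hS v i : i < size t -> h v i.+1 = tau (nth x t i) (h v i).
  by move=> hi; rewrite /h (take_nth x) // foldl_rcons.
have [i hi ci] := corner_nth cs.
have [v hv] : exists v, h v i = w.
  elim: i w hi {ci} => [|i IH] w hi; first by exists w; rewrite /h take0.
  have [v hv] := IH (tau (other (nth x t i.+1)) w) (ltnW hi).
  exists v; rewrite hS; last exact: ltnW.
  by rewrite hv tauK //; apply/m_sym/chain_next.
pose D d := h v (index d (map fst t)).
have Dn j : j < size t -> D (nth x t j).1 = h v j.
  move=> hj; rewrite /D -(nth_map x x.1) // index_uniq ?size_map //.
  exact: ch.2.
exists D; split; first by rewrite ci Dn.
have fwd a b : a \in t -> m a = Some b -> D b.1 = tau a (D a.1).
  case/(nthP x)=> j hj <- /(chain_step ch full hj)[[hj' ->]|[ej -> cl]].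
    by rewrite other1 (Dn j.+1) // (Dn j) // hS.
  rewrite other1 (Dn j) // -hS // {1}/h take_oversize; last by rewrite ej.
  rewrite -[x.1]/((nth x t 0).1) Dn //.
  rewrite /h take0; symmetry; apply: holonomy => //; first exact: chain_uniq ch.
  by rewrite /= rcons_path ch.1.
move=> a b /(chain_dir ch full) dir ab; have [/fwd|bt] := dir _ ab; first exact.
by rewrite (fwd _ _ bt (m_sym ab)) tauK //; apply: m_sym.
Qed.

Lemma transport (r : T -> X) : exists D : T -> X,
  (forall c, roots corner_rel c -> D c = r c) /\
  (forall a b, m a = Some b -> D b.1 = tau a (D a.1)).
Proof.
have /choice [D DP] : forall c : T, exists D : T -> X, D c = r c /\
    forall a b, connect corner_rel c a.1 -> m a = Some b -> D b.1 = tau a (D a.1).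
  move=> c; have [x [s [ch cs full]]] := chain_exists c.
  have [D [Dc DP]] := transport_chain (r c) ch full cs.
  by exists D; split=> // a b; rewrite (chain_closed _ ch full cs); apply: DP.
exists (fun c => D (fingraph.root corner_rel c) c); split.
  by move=> c /eqP ->; have [] := DP c.
move=> a b ab; have -> : fingraph.root corner_rel b.1 = fingraph.root corner_rel a.1.
  apply/eqP; rewrite root_connect; last exact: connect_corner_sym.
  by apply: connect1; apply: corner_relP (m_sym ab).
by apply: (DP _).2 ab; rewrite connect_corner_sym connect_root.
Qed.

End Transport.

Definition saturated c := [forall a, connect corner_rel c a.1 ==> (m a != None)].

Lemma saturated_cycle c : saturated c ->
  exists s, [/\ s != [::], uniq s, cycle turn_rel s & c \in map fst s].
Proof.
move=> /forallP sat; have [x [s [ch cs full]]] := chain_exists c.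
exists (x :: s); split=> //; first exact: chain_uniq ch.
rewrite /= rcons_path ch.1; case: full => [//|full]; case: (full) => xn _.
have := sat (other x); rewrite (chain_closed _ ch (or_intror full)) //.
by rewrite xn inE eqxx.
Qed.

Lemma cycle_saturated s a : cycle turn_rel s -> a.1 \in map fst s ->
  exists2 b, m a = Some b & b.1 \in map fst s.
Proof.
move=> cyc /mapP[d ds /corner_eq[->|->]].
  have /turn_relP h := next_cycle cyc ds; exists (other (next s d)) => //.
  by rewrite other1 (map_f fst) ?mem_next.
have /turn_relP h := prev_cycle cyc ds; exists (prev s d); first exact: m_sym.
by rewrite (map_f fst) ?mem_prev.
Qed.

Lemma cycle_class s c : cycle turn_rel s -> c \in map fst s ->
  forall c', connect corner_rel c c' = (c' \in map fst s).
Proof.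
move=> cyc cs c'; apply/idP/idP => [cc'|].
  apply: (@corner_ind (fun d => d \in map fst s) c c') => // a b ab /(cycle_saturated cyc)[b'].
  by rewrite ab => -[<-].
case: s cyc cs => // x s; rewrite [cycle _ _]/= rcons_path => /andP[p _] /mapP[d dx ->] /mapP[a ax ->].
have {}p := path_connect p.
apply: connect_trans (p _ ax); rewrite connect_corner_sym; exact: p.
Qed.

Lemma saturatedP c :
  reflect (exists s, [/\ s != [::], uniq s, cycle turn_rel s & c \in map fst s])
    (saturated c).
Proof.
apply: (iffP idP) => [/saturated_cycle //|[s [_ _ cyc cs]]].
apply/forallP => a; rewrite (cycle_class cyc cs); apply/implyP => /(cycle_saturated cyc)[b ->].
by [].
Qed.

Lemma unmatched_class c : roots corner_rel c ->
  #|[set a | (m a == None) && (fingraph.root corner_rel a.1 == c)]| = (2 * ~~ saturated c)%N.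
Proof.
move=> /eqP rc; have rootE a : (fingraph.root corner_rel a.1 == c) = connect corner_rel c a.1.
  rewrite -{1}rc root_connect; last exact: connect_corner_sym.
  exact: connect_corner_sym.
have [sat|nsat] := boolP (saturated c).
  rewrite muln0; apply: eq_card0 => a; rewrite !inE rootE; apply/negP => /andP[n ca].
  by have /forallP/(_ a) := sat; rewrite ca n.
have [x [s [ch cs full]]] := chain_exists c.
have op : open_chain x s.
  case: full => // cl; case/negP: nsat; apply/saturatedP; exists (x :: s); split=> //.
    exact: chain_uniq ch.
  by rewrite /= rcons_path ch.1.
rewrite muln1.
have -> : [set a | (m a == None) && (fingraph.root corner_rel a.1 == c)] = [set other x; last x s].
  apply/setP => a; rewrite !inE rootE (chain_closed _ ch full cs).
  apply/andP/orP => [[/eqP an /corner_nth[i hi /corner_eq[ea|ea]]]|[]/eqP->]; first 2 last.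
  - by rewrite op.1 [(other x).1]/= inE eqxx.
  - by rewrite op.2 map_f // mem_last.
  - right; move: hi; rewrite /= ltnS leq_eqVlt => /predU1P[ei|hi].
      by rewrite ea ei (last_nth x).
    by move: an; rewrite ea chain_next.
  left; case: i hi ea => [_ ->//|i hi ea].
  by have := m_sym (chain_next ch hi); rewrite -ea an.
rewrite cards2; case: eqP => // e; exfalso.
have := @chain_inj x s 0 (size s) ch isT (leqnn _).
rewrite -(last_nth x) -e => /(_ erefl) /esym s0.
by move: e; rewrite (size0nil s0) => /other_neq.
Qed.

Lemma card_unmatched :
  #|[set a | m a == None]| =
  (2 * #|[set c | roots corner_rel c && ~~ saturated c]|)%N.
Proof.
rewrite -sum1_card (partition_big (fun a => fingraph.root corner_rel a.1) (roots corner_rel)) /=; last first.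
  by move=> a _; apply: roots_root; apply: connect_corner_sym.
rewrite (eq_bigr (fun c => 2 * ~~ saturated c)%N); last first.
  move=> c rc; rewrite -unmatched_class // -sum1_card; apply: eq_bigl => a.
  by rewrite !inE.
rewrite -big_distrr /= -sum1_card; congr (_ * _)%N; rewrite big_mkcond [RHS]big_mkcond.
by apply: eq_bigr => c _; rewrite inE; case: ifP => //; case: (saturated c).
Qed.

End Chains.

Local Open Scope ring_scope.

(** * Polynomials on a face *)

Lemma mpoly_rmorph_eq (n : nat) (R S : comNzRingType) (f g : {rmorphism {mpoly R[n]} -> S}) :
  (forall c, f c%:MP = g c%:MP) -> (forall i, f 'X_i = g 'X_i) -> f =1 g.
Proof.
move=> fgC fgX p; rewrite (mpolyE p) !rmorph_sum /=; apply: eq_bigr => m _.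
rewrite -mul_mpolyC !rmorphM fgC mpolyXE_id !rmorph_prod; congr (_ * _).
by apply: eq_bigr => i _; rewrite !rmorphXn fgX.
Qed.

Lemma polyXY_rmorph_eq (R : nzRingType) (S : nzRingType) (f g : {rmorphism {poly {poly R}} -> S}) :
  (forall c, f c%:P%:P = g c%:P%:P) -> f 'X%:P = g 'X%:P -> f 'X = g 'X -> f =1 g.
Proof.
move=> fgC fgY fgX; elim/poly_ind => [|p c IH]; first by rewrite !rmorph0.
rewrite !rmorphD !rmorphM IH fgX; congr (_ + _).
elim/poly_ind: c => [|q c IHq]; first by rewrite !rmorph0.
by rewrite polyCD polyCM !rmorphD !rmorphM IHq fgY fgC.
Qed.

Lemma coef1M (R : nzRingType) (p q : {poly R}) : (p * q)`_1 = p`_0 * q`_1 + p`_1 * q`_0.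
Proof. by rewrite coefM !big_ord_recl big_ord0 addr0. Qed.

Section Bivariate.
Variable R : comNzRingType.
Implicit Types (c : {poly R}) (P : {poly {poly R}}).

Definition mvar (i : 'I_2) : {poly {poly R}} := if i == ord0 then 'X%:P else 'X.
Definition biv : {mpoly R[2]} -> {poly {poly R}} := mmap (polyC \o polyC) mvar.
HB.instance Definition _ := GRing.RMorphism.copy biv (mmap (polyC \o polyC) mvar).

Lemma bivC a : biv a%:MP = a%:P%:P.
Proof. by rewrite /biv mmapC. Qed.

Lemma bivX i : biv 'X_i = mvar i.
Proof. by rewrite /biv mmapX mmap1U. Qed.

Lemma bivZ a p : biv (a *: p) = a%:P%:P * biv p.
Proof. by rewrite -mul_mpolyC rmorphM /= bivC. Qed.

Definition mn2 (i j : nat) : 'X_{1..2} := [multinom (if k == ord0 then i else j) | k < 2].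

Lemma mn2E (m : 'X_{1..2}) : m = mn2 (m ord0) (m ord_max).
Proof.
by apply/mnmP => i; rewrite mnmE; case: (unliftP ord0 i) => [j|] -> //=; rewrite (ord1 j); congr (m _); apply: val_inj.
Qed.

Lemma coef_biv p i j : (biv p)`_j`_i = p@_(mn2 i j).
Proof.
elim/mpolyind: p => [|a m p _ _ IH]; first by rewrite rmorph0 !coef0 mcoeff0.
rewrite rmorphD /= !coefD IH mcoeffD mcoeffZ bivZ mcoeffX; congr (_ + _).
rewrite mpolyXE_id rmorph_prod big_ord_recl big_ord1 !rmorphXn /= !bivX.
rewrite !coefCM; congr (_ * _).
have -> : (lift ord0 ord0 : 'I_2) = ord_max by apply: val_inj.
rewrite /mvar /= -polyC_exp coefCM coefXn.
have -> : (m == mn2 i j) = (j == m ord_max) && (i == m ord0).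
  apply/eqP/andP => [->|[/eqP-> /eqP->]]; last exact: mn2E.
  by rewrite !mnmE.
by rewrite -mulr_natr; case: (j == _); rewrite ?mulr1 ?mulr0 ?coef0 // coefXn.
Qed.

Definition omega (F : nat) : {poly {poly R}} := 1 - 'X%:P - F%:R * 'X.
Fact flip_key : unit. Proof. by []. Qed.
Definition flipu_def F : {poly R} -> {poly {poly R}} :=
  horner_eval (omega F) \o map_poly (polyC \o polyC).
Definition flipu F : {poly R} -> {poly {poly R}} := locked_with flip_key flipu_def F.

Lemma flipuE F : flipu F = horner_eval (omega F) \o map_poly (polyC \o polyC).
Proof. by rewrite /flipu locked_withE. Qed.

Lemma flipu_zmod_morphism F : zmod_morphism (flipu F).
Proof. by rewrite flipuE; exact: (rmorphB (horner_eval (omega F) \o map_poly (polyC \o polyC))). Qed.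

Lemma flipu_monoid_morphism F : monoid_morphism (flipu F).
Proof.
rewrite flipuE; split; first exact: (rmorph1 (horner_eval (omega F) \o map_poly (polyC \o polyC))).
exact: (rmorphM (horner_eval (omega F) \o map_poly (polyC \o polyC))).
Qed.

HB.instance Definition _ F :=
  GRing.isZmodMorphism.Build {poly R} {poly {poly R}} (flipu F) (flipu_zmod_morphism F).
HB.instance Definition _ F :=
  GRing.isMonoidMorphism.Build {poly R} {poly {poly R}} (flipu F) (flipu_monoid_morphism F).

Definition flipXY_def F : {poly {poly R}} -> {poly {poly R}} :=
  horner_eval 'X \o map_poly (flipu F).
Definition flipXY F : {poly {poly R}} -> {poly {poly R}} := locked_with flip_key flipXY_def F.

Lemma flipXYE F : flipXY F = horner_eval 'X \o map_poly (flipu F).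
Proof. by rewrite /flipXY locked_withE. Qed.

Lemma flipXY_zmod_morphism F : zmod_morphism (flipXY F).
Proof. by rewrite flipXYE; exact: (rmorphB (horner_eval 'X \o map_poly (flipu F))). Qed.

Lemma flipXY_monoid_morphism F : monoid_morphism (flipXY F).
Proof.
rewrite flipXYE; split; first exact: (rmorph1 (horner_eval 'X \o map_poly (flipu F))).
exact: (rmorphM (horner_eval 'X \o map_poly (flipu F))).
Qed.

HB.instance Definition _ F :=
  GRing.isZmodMorphism.Build {poly {poly R}} {poly {poly R}} (flipXY F) (flipXY_zmod_morphism F).
HB.instance Definition _ F :=
  GRing.isMonoidMorphism.Build {poly {poly R}} {poly {poly R}} (flipXY F) (flipXY_monoid_morphism F).

Lemma flipuC F a : flipu F a%:P = a%:P%:P.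
Proof. by rewrite flipuE /= map_polyC /= /horner_eval hornerC. Qed.

Lemma flipuX F : flipu F 'X = omega F.
Proof. by rewrite flipuE /= map_polyX /horner_eval hornerX. Qed.

Lemma flipXYC F c : flipXY F c%:P = flipu F c.
Proof. by rewrite flipXYE /= map_polyC /= /horner_eval hornerC. Qed.

Lemma flipXYX F : flipXY F 'X = 'X.
Proof. by rewrite flipXYE /= map_polyX /horner_eval hornerX. Qed.

Lemma omega0 F : (omega F)`_0 = 1 - 'X.
Proof. by rewrite !coefB -polyC1 !coefC -polyC_natr coefCM coefX mulr0 subr0. Qed.

Lemma omega1 F : (omega F)`_1 = - F%:R.
Proof. by rewrite !coefB -polyC1 !coefC -polyC_natr coefCM coefX mulr1 !sub0r oppr0 add0r. Qed.

Lemma flipu0 F c : (flipu F c)`_0 = c \Po (1 - 'X).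
Proof.
elim/poly_ind: c => [|c a IH]; first by rewrite rmorph0 coef0 comp_poly0.
rewrite rmorphD rmorphM /= flipuC flipuX coefD coef0M IH omega0 coefC.
by rewrite comp_polyD comp_polyM comp_polyX comp_polyC.
Qed.

Lemma flipu1 F c : (flipu F c)`_1 = - F%:R * (c^`() \Po (1 - 'X)).
Proof.
elim/poly_ind: c => [|c a IH]; first by rewrite rmorph0 coef0 deriv0 comp_poly0 mulr0.
rewrite rmorphD rmorphM /= flipuC flipuX coefD coef1M IH omega0 omega1 flipu0 coefC addr0.
rewrite derivD derivC derivM derivX mulr1 addr0 comp_polyD comp_polyM comp_polyX.
ring.
Qed.

Lemma polyXY_split P : P = (P`_0)%:P + (P`_1)%:P * 'X + drop_poly 2 P * 'X * 'X.
Proof.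
rewrite -{1}(poly_take_drop 2 P) expr2 mulrA; congr (_ + _); apply/polyP => i.
rewrite coef_take_poly coefD coefC coefCM coefX.
by case: i => [|[|i]] /=; rewrite ?mulr0 ?addr0 ?mulr1 ?add0r.
Qed.

Lemma flipXY0 F P : (flipXY F P)`_0 = P`_0 \Po (1 - 'X).
Proof.
rewrite {1}(polyXY_split P) !rmorphD !rmorphM /= !flipXYC !flipXYX.
by rewrite !coefD !coef0M coefX !mulr0 !addr0 flipu0.
Qed.

Lemma flipXY1 F P : (flipXY F P)`_1 = (P`_1 - F%:R * (P`_0)^`()) \Po (1 - 'X).
Proof.
rewrite {1}(polyXY_split P) !rmorphD !rmorphM /= !flipXYC !flipXYX.
rewrite !coefD !coef1M !coef0M !coefX !mulr0 !mulr1 !addr0 !flipu0 flipu1.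
by rewrite -mulNr -polyC_natr -polyCN comp_polyM comp_polyC addrC polyCN.
Qed.

End Bivariate.

Section Evaluation.
Variable R : realType.
Implicit Types (q : {mpoly R[2]}) (a b t : R).

Lemma meval_biv q a b : q.@[pt a b] = (biv q).[b%:P].[a].
Proof.
pose f := horner_eval a \o (horner_eval b%:P \o @biv R).
rewrite -[RHS]/(f q); apply: (@mpoly_rmorph_eq _ _ _ (meval (pt a b)) f) => [c|i].
  by rewrite /f /= bivC /horner_eval mevalC !hornerC.
rewrite /f /= bivX /mvar mevalXU /pt /horner_eval.
by case: ifP; rewrite ?hornerC ?hornerX ?hornerC.
Qed.

Lemma biv_dv q : biv (dv q) = (biv q)^`().
Proof.
apply/polyP => j; apply/polyP => i; rewrite coef_biv mcoeff_deriv coef_deriv coefMn coef_biv.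
have -> : (mn2 i j + U_(ord_max))%MM = mn2 i j.+1.
  rewrite [LHS]mn2E; congr mn2; rewrite !mnmE /= ?addn0 ?addn1 //.
by rewrite /mn2 mnmE.
Qed.

Lemma swap_biv_du q : swapXY (biv (du q)) = (swapXY (biv q))^`().
Proof.
apply/polyP => j; apply/polyP => i.
rewrite coef_swapXY coef_deriv coefMn coef_swapXY !coef_biv mcoeff_deriv.
have -> : (mn2 j i + U_(ord0))%MM = mn2 j.+1 i.
  rewrite [LHS]mn2E; congr mn2; rewrite !mnmE /= ?addn0 ?addn1 //.
by rewrite /mn2 mnmE.
Qed.

Lemma meval_u q t : q.@[pt t 0] = ((biv q)`_0).[t].
Proof. by rewrite meval_biv horner_coef0. Qed.

Lemma meval_dv q t : (dv q).@[pt t 0] = ((biv q)`_1).[t].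
Proof. by rewrite meval_u biv_dv coef_deriv. Qed.

Lemma meval_v q t : q.@[pt 0 t] = ((swapXY (biv q))`_0).[t].
Proof. by rewrite meval_biv -horner2_swapXY horner_coef0. Qed.

Lemma meval_du q t : (du q).@[pt 0 t] = ((swapXY (biv q))`_1).[t].
Proof. by rewrite meval_v swap_biv_du coef_deriv. Qed.

End Evaluation.

Section Rectangle.
Variable R : realType.

Lemma det_dot_eq0 (w1 w2 e1 e2 : R) : (w1 != 0) || (w2 != 0) ->
  w1 * e1 + w2 * e2 = 0 -> w1 * e2 - w2 * e1 = 0 -> e1 = 0 /\ e2 = 0.
Proof.
move=> w0 h1 h2; have n0 : w1 ^+ 2 + w2 ^+ 2 != 0.
  by rewrite paddr_eq0 ?sqr_ge0 // !sqrf_eq0 negb_and.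
split; apply: (mulfI n0); rewrite mulr0.
  by transitivity (w1 * (w1 * e1 + w2 * e2) - w2 * (w1 * e2 - w2 * e1)); [ring|rewrite h1 h2; ring].
by transitivity (w2 * (w1 * e1 + w2 * e2) + w1 * (w1 * e2 - w2 * e1)); [ring|rewrite h1 h2; ring].
Qed.

Lemma parallelogram (A B C D : R * R) :
  det2 (B - A) (D - A) != 0 -> dot2 (B - A) (D - A) = 0 ->
  dot2 (C - B) (A - B) = 0 -> dot2 (D - C) (B - C) = 0 ->
  det2 (C - B) (A - B) != 0 -> C - B = D - A.
Proof.
case: A B C D => [a1 a2] [b1 b2] [c1 c2] [d1 d2]; rewrite /det2 /dot2 /=.
move=> n1 h1 h2 h3 n2.
have u0 : (b1 - a1 != 0) || (b2 - a2 != 0).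
  by apply: contraNT n1; rewrite negb_or !negbK => /andP[/eqP-> /eqP->]; rewrite !mul0r subrr.
have w0 : (c1 - b1 != 0) || (c2 - b2 != 0).
  by apply: contraNT n2; rewrite negb_or !negbK => /andP[/eqP-> /eqP->]; rewrite !mul0r subrr.
have h2' : (c1 - b1) * (b1 - a1) + (c2 - b2) * (b2 - a2) = 0 by lra.
have d0 : (c1 - b1) * ((d2 - a2) - (c2 - b2)) - (c2 - b2) * ((d1 - a1) - (c1 - b1)) = 0.
  have n0 : (b1 - a1) ^+ 2 + (b2 - a2) ^+ 2 != 0.
    by rewrite paddr_eq0 ?sqr_ge0 // !sqrf_eq0 negb_and.
  apply: (mulfI n0); rewrite mulr0.
  transitivity (((c1 - b1) * (b1 - a1) + (c2 - b2) * (b2 - a2)) * ((b1 - a1) * (d2 - a2) - (b2 - a2) * (d1 - a1)) - ((b1 - a1) * (d1 - a1) + (b2 - a2) * (d2 - a2)) * ((b1 - a1) * (c2 - b2) - (b2 - a2) * (c1 - b1))); first by ring.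
  by rewrite h1 h2'; ring.
have [] := det_dot_eq0 w0 _ d0; last first.
  move=> e1 e2; rewrite -[LHS]/(c1 - b1, c2 - b2) -[RHS]/(d1 - a1, d2 - a2).
  by move/eqP: e1; move/eqP: e2; rewrite !subr_eq0 => /eqP -> /eqP ->.
by lra.
Qed.

End Rectangle.

Lemma ordS_tri b (i : 'I_(nsides b)) : b -> ordS (ordS i) = ord_pred i.
Proof. by case: b i => // i _; apply: val_inj; case: i => -[|[|[|[]]]]. Qed.

Lemma ordS_rect b (i : 'I_(nsides b)) : ~~ b -> ordS (ordS (ordS i)) = ord_pred i.
Proof. by case: b i => // i _; apply: val_inj; case: i => -[|[|[|[|[]]]]]. Qed.

Lemma iter_ordS n (i j : 'I_n) : exists2 m, (m < n)%N & j = iter m (@ordS n) i.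
Proof.
case: n i j => [[] //|n] i j.
have itE m : (iter m (@ordS n.+1) i : nat) = ((i + m) %% n.+1)%N.
  elim: m => [|m IH]; first by rewrite addn0 modn_small.
  by rewrite iterS /= IH -addn1 modnDml addn1 addnS.
exists ((j + n.+1 - i) %% n.+1)%N; first by rewrite ltn_mod.
apply: val_inj; rewrite /= itE modnDmr addnC subnK ?modnDr ?modn_small //.
by rewrite ltnW // ltn_addl // ltn_ord.
Qed.

Section Flags.
Variables (R : realType) (P : polygons R).
Implicit Types (c : corner P) (x : flag P).

Lemma next_prevK c : next_corner (prev_corner c) = c.
Proof. by case: c => s i; rewrite /next_corner /= ord_predK. Qed.

Lemma prev_nextK c : prev_corner (next_corner c) = c.
Proof. by case: c => s i; rewrite /prev_corner /= ordSK. Qed.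

Lemma next_next_tri c : is_tri (tag c) -> next_corner (next_corner c) = prev_corner c.
Proof. by case: c => s i /= h; rewrite /next_corner /prev_corner /= ordS_tri. Qed.

Lemma next_next_next_rect c : ~~ is_tri (tag c) ->
  next_corner (next_corner (next_corner c)) = prev_corner c.
Proof. by case: c => s i /= h; rewrite /next_corner /prev_corner /= ordS_rect. Qed.

Lemma next_iter c c' : tag c = tag c' ->
  exists2 m, (m < nsides (is_tri (tag c)))%N & c' = iter m (@next_corner _ _) c.
Proof.
case: c c' => s i [s' j] /= e; subst s'; have [m hm ->] := iter_ordS i j.
exists m => //; elim: m {hm} => //= m <-.
by [].
Qed.

Lemma farK x : far (far x) = x.
Proof. by case: x => c []; rewrite /far /= ?prev_nextK ?next_prevK. Qed.

Lemma swapK x : swap (swap x) = x.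
Proof. by case: x => c b; rewrite /swap /= negbK. Qed.

Lemma fface_far x : fface (far x) = fface x.
Proof. by case: x => -[s i] []. Qed.

Lemma fface_swap x : fface (swap x) = fface x.
Proof. by []. Qed.

Lemma FD_far x : FD (far x) = FD x.
Proof. by rewrite /FD fface_far. Qed.

Definition fU x := pos (far x).1 - pos x.1.
Definition fV x := pos (far (swap x)).1 - pos x.1.

Lemma fU_swap x : fU (swap x) = fV x. Proof. by []. Qed.
Lemma fV_swap x : fV (swap x) = fU x. Proof. by rewrite /fV swapK. Qed.

Lemma det_fUV x : det2 (fU x) (fV x) != 0.
Proof.
have := pos_nondegenerate x.1; rewrite /fU /fV; case: x => c [] //=.
rewrite /det2 => h; rewrite -oppr_eq0 opprB; apply: contraNneq h => <-.
by apply/eqP; ring.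
Qed.

Lemma fU_far x : fU (far x) = - fU x.
Proof. by rewrite /fU farK opprB. Qed.

Lemma rectangle_sides c : ~~ is_tri (tag c) ->
  pos (next_corner (next_corner c)) - pos (next_corner c) =
  pos (prev_corner c) - pos c.
Proof.
move=> rc; apply: parallelogram.
- exact: pos_nondegenerate.
- exact: pos_right_angle.
- by have := pos_right_angle (c := next_corner c); rewrite prev_nextK; apply.
- have := pos_right_angle (c := next_corner (next_corner c)).
  by rewrite prev_nextK next_next_next_rect //; apply.
- by have := pos_nondegenerate (next_corner c); rewrite prev_nextK.
Qed.

Lemma fV_far x : fV (far x) = fV x - fU x *+ FD x.
Proof.
rewrite /FD /fface; have [tx|rx] := boolP (is_tri _).
  rewrite mulr1n /fV /fU; case: x tx => c [] /= tx; rewrite ?next_next_tri //.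
    by rewrite opprB addrA subrK.
  by rewrite -{1}[c]next_prevK -next_next_tri ?next_prevK // opprB addrA subrK.
rewrite mulr0n subr0 /fV /fU; case: x rx => c [] /= rx.
  exact: rectangle_sides.
have -> : prev_corner (prev_corner c) = next_corner (next_corner c).
  by rewrite -(next_next_next_rect (c := prev_corner c)) ?next_prevK.
have := rectangle_sides rx => /(canRL (subrK _)) ->.
by rewrite addrAC [X in X - _]addrC addrK addrC.
Qed.

End Flags.
Arguments fU : simpl never.
Arguments fV : simpl never.

Lemma affine_inverse (S : comNzRingType) (o1 o2 x0 x1 d : S) (u v : S * S) : d * det2 u v = 1 ->
  o1 + u.1 * (d * (v.2 * (x0 - o1) - v.1 * (x1 - o2))) + v.1 * (d * (u.1 * (x1 - o2) - u.2 * (x0 - o1))) = x0 /\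
  o2 + u.2 * (d * (v.2 * (x0 - o1) - v.1 * (x1 - o2))) + v.2 * (d * (u.1 * (x1 - o2) - u.2 * (x0 - o1))) = x1.
Proof.
case: u v => u1 u2 [v1 v2]; rewrite /det2 /= => e; split.
  transitivity (o1 + (x0 - o1) * (d * (u1 * v2 - u2 * v1))); first by ring.
  by rewrite e; ring.
transitivity (o2 + (x1 - o2) * (d * (u1 * v2 - u2 * v1))); first by ring.
by rewrite e; ring.
Qed.

Section Local.
Variables (R : realType) (M : surface R).
Implicit Types (x y : flag M) (p : {mpoly R[2]}) (P : {poly {poly R}}).

Definition coords x : 2.-tuple {mpoly R[2]} :=
  [tuple (pos x.1).1%:MP + (fU x).1 *: 'X_(@ord0 1) + (fV x).1 *: 'X_(@ord_max 1);
         (pos x.1).2%:MP + (fU x).2 *: 'X_(@ord0 1) + (fV x).2 *: 'X_(@ord_max 1)].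

(* Locked: unfolding it makes failing conversion tests explode. *)
Fact bloc_key : unit. Proof. by []. Qed.
Definition bloc_def x : {mpoly R[2]} -> {poly {poly R}} := @biv R \o comp_mpoly (coords x).
Definition bloc x : {mpoly R[2]} -> {poly {poly R}} := locked_with bloc_key bloc_def x.

Lemma blocE x p : bloc x p = biv (adapted x p).
Proof. by rewrite /bloc locked_withE. Qed.

Lemma bloc_zmod_morphism x : zmod_morphism (bloc x).
Proof. by rewrite /bloc locked_withE; exact: (rmorphB (@biv R \o comp_mpoly (coords x))). Qed.

Lemma bloc_monoid_morphism x : monoid_morphism (bloc x).
Proof.
rewrite /bloc locked_withE; split; first exact: (rmorph1 (@biv R \o comp_mpoly (coords x))).
exact: (rmorphM (@biv R \o comp_mpoly (coords x))).
Qed.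

HB.instance Definition _ x :=
  GRing.isZmodMorphism.Build {mpoly R[2]} {poly {poly R}} (bloc x) (bloc_zmod_morphism x).
HB.instance Definition _ x :=
  GRing.isMonoidMorphism.Build {mpoly R[2]} {poly {poly R}} (bloc x) (bloc_monoid_morphism x).

Lemma blocC x a : bloc x a%:MP = a%:P%:P.
Proof. by rewrite blocE /adapted comp_mpolyC bivC. Qed.

Lemma blocB x p q : bloc x (p - q) = bloc x p - bloc x q.
Proof. exact: rmorphB. Qed.

Lemma blocZ x a p : bloc x (a *: p) = a%:P%:P * bloc x p.
Proof. by rewrite -mul_mpolyC rmorphM /= blocC. Qed.

Lemma biv_affine (a b c : R) :
  biv (a%:MP + b *: 'X_(@ord0 1) + c *: 'X_(@ord_max 1)) =
  a%:P%:P + b%:P%:P * 'X%:P + c%:P%:P * 'X.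
Proof. by rewrite !rmorphD /= !bivZ !bivX bivC. Qed.

Lemma blocX0 x : bloc x 'X_(@ord0 1) =
  (pos x.1).1%:P%:P + (fU x).1%:P%:P * 'X%:P + (fV x).1%:P%:P * 'X.
Proof. by rewrite blocE /adapted comp_mpolyXU /= biv_affine. Qed.

Lemma blocX1 x : bloc x 'X_(@ord_max 1) =
  (pos x.1).2%:P%:P + (fU x).2%:P%:P * 'X%:P + (fV x).2%:P%:P * 'X.
Proof. by rewrite blocE /adapted comp_mpolyXU /= biv_affine. Qed.

Lemma bloc_eq (f : {rmorphism {mpoly R[2]} -> {poly {poly R}}}) x :
  (forall a, f a%:MP = a%:P%:P) -> f 'X_(@ord0 1) = bloc x 'X_(@ord0 1) ->
  f 'X_(@ord_max 1) = bloc x 'X_(@ord_max 1) -> bloc x =1 f.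
Proof.
move=> fC f0 f1; apply: mpoly_rmorph_eq => [a|i]; first by rewrite fC /= blocC.
case: (unliftP ord0 i) => [j|] -> //=.
by rewrite (ord1 j) (_ : lift ord0 ord0 = ord_max) //; apply: val_inj.
Qed.

Lemma bloc_swap x p : bloc (swap x) p = swapXY (bloc x p).
Proof.
apply: (@bloc_eq (@swapXY R \o bloc x)) => [a||] /=; first by rewrite blocC swapXY_polyC map_polyC.
all: rewrite !(blocX0, blocX1) fU_swap fV_swap -[pos (swap x).1]/(pos x.1).
all: move: (pos x.1) (fU x) (fV x) => O U V.
all: rewrite !rmorphD !rmorphM /= !swapXY_polyC swapXY_X !map_polyC map_polyX /=.
all: by rewrite addrAC.
Qed.

Lemma pos_far x : pos (far x).1 = pos x.1 + fU x.
Proof. by rewrite /fU addrC subrK. Qed.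

Lemma bloc_far x p : bloc (far x) p = flipXY (FD x) (bloc x p).
Proof.
apply: (@bloc_eq (flipXY (FD x) \o bloc x)) => [a||] /=; first by rewrite blocC flipXYC flipuC.
all: rewrite !(blocX0, blocX1) fU_far fV_far pos_far; move: (pos x.1) (fU x) (fV x) => [a1 a2] [b1 b2] [c1 c2].
all: rewrite !rmorphD !rmorphM /= !flipXYC !flipuC flipuX flipXYX /omega ?(raddfMn fst) ?(raddfMn snd) /=.
all: by rewrite ?(polyCD, polyCN, polyCMn); ring.
Qed.

Definition lu x : {mpoly R[2]} := (det2 (fU x) (fV x))^-1 *:
  ((fV x).2 *: ('X_(@ord0 1) - (pos x.1).1%:MP) - (fV x).1 *: ('X_(@ord_max 1) - (pos x.1).2%:MP)).
Definition lv x : {mpoly R[2]} := (det2 (fU x) (fV x))^-1 *: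
  ((fU x).1 *: ('X_(@ord_max 1) - (pos x.1).2%:MP) - (fU x).2 *: ('X_(@ord0 1) - (pos x.1).1%:MP)).

Lemma bloc_luv x : bloc x (lu x) = 'X%:P /\ bloc x (lv x) = 'X.
Proof.
have := det_fUV x; rewrite /lu /lv 2!blocZ 2!blocB !blocZ !blocB blocX0 blocX1 !blocC.
rewrite /det2; move: (pos x.1) (fU x) (fV x) => [o1 o2] [u1 u2] [v1 v2] /= d0.
split; rewrite -[RHS]mul1r -[1]/(1%:P%:P) -(mulVf d0); move: (_^-1) => d;
by rewrite !polyCM !polyCB !polyCM; ring.
Qed.

Lemma bloc_lu x : bloc x (lu x) = 'X%:P.
Proof. by have [] := bloc_luv x. Qed.

Lemma bloc_lv x : bloc x (lv x) = 'X.
Proof. by have [] := bloc_luv x. Qed.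

Definition globu x (c : {poly R}) : {mpoly R[2]} := (map_poly (@mpolyC 2 R) c).[lu x].
Fact glob_key : unit. Proof. by []. Qed.
Definition glob_def x P : {mpoly R[2]} := (map_poly (globu x) P).[lv x].
Definition glob x : {poly {poly R}} -> {mpoly R[2]} := locked_with glob_key glob_def x.

Lemma globu_zmod_morphism x : zmod_morphism (globu x).
Proof. by move=> c d; rewrite /globu rmorphB hornerD hornerN. Qed.

Lemma globu_monoid_morphism x : monoid_morphism (globu x).
Proof. by split=> [|c d]; rewrite /globu ?rmorph1 ?hornerC // rmorphM hornerM. Qed.

HB.instance Definition _ x :=
  GRing.isZmodMorphism.Build {poly R} {mpoly R[2]} (globu x) (globu_zmod_morphism x).
HB.instance Definition _ x :=
  GRing.isMonoidMorphism.Build {poly R} {mpoly R[2]} (globu x) (globu_monoid_morphism x).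

Lemma globE x P : glob x P = (map_poly (globu x) P).[lv x].
Proof. by rewrite /glob locked_withE. Qed.

Lemma glob_zmod_morphism x : zmod_morphism (glob x).
Proof. by move=> c d; rewrite !globE rmorphB hornerD hornerN. Qed.

Lemma glob_monoid_morphism x : monoid_morphism (glob x).
Proof. by split=> [|c d]; rewrite !globE ?rmorph1 ?hornerC // rmorphM hornerM. Qed.

HB.instance Definition _ x :=
  GRing.isZmodMorphism.Build {poly {poly R}} {mpoly R[2]} (glob x) (glob_zmod_morphism x).
HB.instance Definition _ x :=
  GRing.isMonoidMorphism.Build {poly {poly R}} {mpoly R[2]} (glob x) (glob_monoid_morphism x).

Lemma globC x a : glob x a%:P%:P = a%:MP.
Proof. by rewrite globE map_polyC hornerC /= /globu map_polyC hornerC. Qed.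

Lemma globY x : glob x 'X%:P = lu x.
Proof. by rewrite globE map_polyC hornerC /= /globu map_polyX hornerX. Qed.

Lemma globX x : glob x 'X = lv x.
Proof. by rewrite globE map_polyX hornerX. Qed.

Lemma globD x P Q : glob x (P + Q) = glob x P + glob x Q.
Proof. exact: rmorphD. Qed.

Lemma globM x P Q : glob x (P * Q) = glob x P * glob x Q.
Proof. exact: rmorphM. Qed.

Lemma globK x : cancel (glob x) (bloc x).
Proof.
move=> P; rewrite -[LHS]/((bloc x \o glob x) P) -[RHS]/((idfun : {rmorphism {poly {poly R}} -> _}) P).
apply: polyXY_rmorph_eq => [c||] /=.
- by rewrite globC blocC.
- by rewrite globY bloc_lu.
- by rewrite globX bloc_lv.
Qed.

Lemma blocK x : cancel (bloc x) (glob x).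
Proof.
move=> p; rewrite -[LHS]/((glob x \o bloc x) p) -[RHS]/((idfun : {rmorphism {mpoly R[2]} -> _}) p).
have e : ((det2 (fU x) (fV x))^-1)%:MP * det2 ((fU x).1%:MP, (fU x).2%:MP) ((fV x).1%:MP, (fV x).2%:MP) = 1 :> {mpoly R[2]}.
  by rewrite /det2 /= -!mpolyCM -mpolyCB -mpolyCM mulVf // det_fUV.
apply: mpoly_rmorph_eq => [a|i] /=; first by rewrite blocC globC.
case: (unliftP ord0 i) => [j|] -> /=.
  rewrite (ord1 j) (_ : lift ord0 ord0 = ord_max); last exact: val_inj.
  rewrite blocX1 !globD !globM !globC globY globX /lu /lv -!mul_mpolyC.
  exact: (affine_inverse (pos x.1).1%:MP (pos x.1).2%:MP ('X_ord0) ('X_ord_max) e).2.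
rewrite blocX0 !globD !globM !globC globY globX /lu /lv -!mul_mpolyC.
exact: (affine_inverse (pos x.1).1%:MP (pos x.1).2%:MP ('X_ord0) ('X_ord_max) e).1.
Qed.

End Local.

Section Degrees.
Variable R : realType.
Implicit Types (P Q : {poly {poly R}}) (a b : {poly R}).

Definition tdeg n P := forall i j, (n <= i + j)%N -> P`_j`_i = 0.
Definition bdeg (a b : nat) P := forall i j, (a <= i)%N || (b <= j)%N -> P`_j`_i = 0.

Lemma tdeg_sub n m P : (n <= m)%N -> tdeg n P -> tdeg m P.
Proof. by move=> nm h i j ij; apply: h; apply: leq_trans ij. Qed.

Lemma tdeg0 n : tdeg n 0.
Proof. by move=> i j _; rewrite !coef0. Qed.

Lemma tdegD n P Q : tdeg n P -> tdeg n Q -> tdeg n (P + Q).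
Proof. by move=> hP hQ i j ij; rewrite !coefD hP // hQ // addr0. Qed.

Lemma tdegZ n (a : R) P : tdeg n P -> tdeg n (a%:P%:P * P).
Proof. by move=> hP i j ij; rewrite !coefCM hP // mulr0. Qed.

Lemma tdegM m n P Q : tdeg m.+1 P -> tdeg n.+1 Q -> tdeg (m + n).+1 (P * Q).
Proof.
move=> hP hQ i j ij; rewrite coefM coef_sum big1 // => k _.
rewrite coefM big1 // => l _.
have [h|h] := leqP m.+1 (l + k); first by rewrite hP ?mul0r.
rewrite (hQ (i - l)%N (j - k)%N) ?mulr0 //.
by have := ltn_ord k; have := ltn_ord l; move: ij h; clear; lia.
Qed.

Lemma tdegX n m P : tdeg m.+1 P -> tdeg (m * n).+1 (P ^+ n).
Proof.
move=> hP; elim: n => [|n IH]; last by rewrite exprS mulnS; apply: tdegM.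
move=> i j; rewrite muln0 expr0 -!polyC1 !coefC.
by case: j => [|j]; rewrite ?coef0 //= coefC; case: i.
Qed.

Lemma bdegP (a b : nat) P : bdeg a b P <-> (size P <= b)%N /\ forall j, (size (P`_j)%R <= a)%N.
Proof.
split=> [h|[h1 h2] i j /orP[]].
- split=> [|j]; last by apply/leq_sizeP => i ij; apply: h; rewrite ij.
  apply/leq_sizeP => j bj; apply/polyP => i; rewrite coef0; apply: h.
  by rewrite bj orbT.
- by move=> ai; move/leq_sizeP: (h2 j); apply.
- by move=> bj; have /leq_sizeP/(_ _ bj) -> := h1; rewrite coef0.
Qed.

Lemma bdeg_sub (a b c d : nat) P : (a <= c)%N -> (b <= d)%N -> bdeg a b P -> bdeg c d P.
Proof.
move=> ac bd h i j /orP[ci|dj]; apply: h; first by rewrite (leq_trans ac).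
by rewrite (leq_trans bd) ?orbT.
Qed.

Lemma bdeg_swap (a b : nat) P : bdeg a b P -> bdeg b a (swapXY P).
Proof. by move=> h i j ij; rewrite coef_swapXY; apply: h; rewrite orbC. Qed.

Lemma size_1subX : size (1 - 'X : {poly R}) = 2.
Proof. by rewrite -opprB size_polyN size_XsubC. Qed.

Lemma flipXY_rect P : flipXY 0 P = map_poly (comp_poly (1 - 'X)) P.
Proof.
move: P; pose g : {rmorphism {poly {poly R}} -> {poly {poly R}}} :=
  map_poly (comp_poly (1 - 'X)).
pose f : {rmorphism {poly {poly R}} -> {poly {poly R}}} := flipXY 0.
suff h : f =1 g by move=> P; apply: h.
apply: polyXY_rmorph_eq; rewrite /f /g /=.
- by move=> c; rewrite flipXYC flipuC map_polyC /= comp_polyC.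
- by rewrite flipXYC flipuX map_polyC /= comp_polyX /omega mul0r subr0 polyCB.
- by rewrite flipXYX map_polyX.
Qed.

Lemma bdeg_flip (a b : nat) P : bdeg a b P -> bdeg a b (flipXY 0 P).
Proof.
rewrite flipXY_rect.
move=> /bdegP[h1 h2]; apply/bdegP; split; first by rewrite (leq_trans (size_poly _ _)).
by move=> j; rewrite coef_map /= size_comp_poly2 // size_1subX.
Qed.

Lemma coef_poly2 a b : [/\ (a%:P + b%:P * 'X : {poly {poly R}})`_0 = a,
  (a%:P + b%:P * 'X : {poly {poly R}})`_1 = b & forall j, (a%:P + b%:P * 'X)`_j.+2 = 0].
Proof.
by split=> [||j]; rewrite coefD coefC coefCM coefX /= ?mulr0 ?mulr1 ?addr0 ?add0r.
Qed.

Lemma tdeg_poly2 n a b : (size a <= n)%N -> (size b <= n.-1)%N -> tdeg n (a%:P + b%:P * 'X).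
Proof.
have [p0 p1 p2] := coef_poly2 a b; move=> /leq_sizeP sa /leq_sizeP sb i [|[|j]] ij.
- by rewrite p0 sa //; move: ij; clear; lia.
- by rewrite p1 sb //; move: ij; clear; lia.
by rewrite p2 coef0.
Qed.

Lemma bdeg_poly2 n m a b : (1 < m)%N -> (size a <= n)%N -> (size b <= n)%N ->
  bdeg n m (a%:P + b%:P * 'X).
Proof.
have [p0 p1 p2] := coef_poly2 a b; move=> hm /leq_sizeP sa /leq_sizeP sb i [|[|j]] ij.
- by rewrite p0 sa //; move: ij hm; clear; lia.
- by rewrite p1 sb //; move: ij hm; clear; lia.
by rewrite p2 coef0.
Qed.

Lemma msizeM_bound m n (p q : {mpoly R[2]}) :
  (msize p <= m.+1)%N -> (msize q <= n.+1)%N -> (msize (p * q) <= (m + n).+1)%N.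
Proof.
have [->|p0] := eqVneq p 0; first by rewrite mul0r msize0.
have [->|q0] := eqVneq q 0; first by rewrite mulr0 msize0.
rewrite msizeM // => hp hq; move: (leq_add hp hq); clear.
by move: (_ + _)%N => s; rewrite addSn addnS; case: s.
Qed.

Lemma msizeX_bound m n (p : {mpoly R[2]}) :
  (msize p <= m.+1)%N -> (msize (p ^+ n) <= (m * n).+1)%N.
Proof.
move=> h; elim: n => [|n IH]; first by rewrite msize1.
by rewrite exprS mulnS msizeM_bound.
Qed.

End Degrees.

Notation jet R := (R * R * R * R)%type.
Notation zero4 := (0, 0, 0, 0).

Section LocalDegrees.
Variables (R : realType) (M : surface R).
Implicit Types (x y : flag M) (p : {mpoly R[2]}) (P : {poly {poly R}}).

Lemma tdeg_affine (a b c : R) : tdeg 2 (a%:P%:P + b%:P%:P * 'X%:P + c%:P%:P * 'X).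
Proof.
move=> i j ij; rewrite !coefD !coefCM coefX !coefC.
case: j ij => [|[|j]]; case: i => [|[|i]] //= _;
  by rewrite ?coefC ?coefX ?coefCM ?coef0 /= ?mulr0 ?addr0 ?coef0.
Qed.

Lemma bloc_tdeg x n p : (msize p <= n)%N -> tdeg n (bloc x p).
Proof.
move=> hp; rewrite (mpolyE p) rmorph_sum /= big_seq.
elim/big_ind: _ => [||m mp]; [exact: tdeg0|exact: tdegD|].
rewrite blocZ; apply: tdegZ.
apply: (@tdeg_sub _ (mdeg m).+1); first by apply: leq_trans hp; apply: msize_mdeg_lt.
rewrite mpolyXE_id rmorph_prod big_ord_recl big_ord1 mdegE big_ord_recl big_ord1.
have -> : (lift ord0 ord0 : 'I_2) = ord_max by apply: val_inj.
apply: tdegM; rewrite -[in X in tdeg X.+1](mul1n (m _)) rmorphXn; apply: tdegX.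
  by rewrite /= blocX0; apply: tdeg_affine.
by rewrite /= blocX1; apply: tdeg_affine.
Qed.

Lemma msize_affine (f : {mpoly R[2]}) a : (msize f <= 2)%N -> (msize (a *: f) <= 2)%N.
Proof. by apply: leq_trans; apply: msizeZ_le. Qed.

Lemma msize_lin (i : 'I_2) (a : R) : (msize ('X_i - a%:MP) <= 2)%N.
Proof.
apply: leq_trans (msizeD_le _ _) _; rewrite geq_max msizeX mdeg1 msizeN msizeC leqnn.
by case: (_ == _).
Qed.

Lemma msize_luv x : (msize (lu x) <= 2)%N /\ (msize (lv x) <= 2)%N.
Proof.
by split; apply: msize_affine; apply: leq_trans (msizeD_le _ _) _;
   rewrite geq_max msizeN !msize_affine // msize_lin.
Qed.

Lemma msize_glob x n P : tdeg n P -> (msize (glob x P) <= n)%N.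
Proof.
move=> hP; rewrite -[P]coefK poly_def rmorph_sum /=.
apply: leq_trans (msize_sum _ _ _) _; apply/bigmax_leqP => j _.
rewrite -mul_polyC rmorphM rmorphXn /= globX -[P`_j]coefK poly_def !rmorph_sum /=.
rewrite mulr_suml; apply: leq_trans (msize_sum _ _ _) _; apply/bigmax_leqP => i _.
rewrite -mul_polyC polyCM globM globC polyC_exp rmorphXn /= globY mul_mpolyC -scalerAl.
have [ij|ij] := leqP n (i + j); first by rewrite (hP _ _ ij) scale0r msize0.
apply: leq_trans (msizeZ_le _ _) _; apply: leq_trans ij.
have [hu hv] := msize_luv x.
by apply: msizeM_bound; rewrite -[in X in (_ <= X)%N](mul1n (nat_of_ord _)); apply: msizeX_bound.
Qed.

Lemma face_ind (Q : flag M -> Prop) x y :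
  (forall z, Q z -> Q (swap z)) -> (forall z, Q z -> Q (far z)) ->
  fface x = fface y -> Q x -> Q y.
Proof.
move=> hs hf /next_iter[m _ ym] Qx.
have hb c b b' : Q (c, b) -> Q (c, b').
  move=> h; have [->//|e] := eqVneq b' b; have := hs _ h.
  by rewrite /swap /=; case: b b' e {h} => -[].
have h : Q (y.1, true).
  rewrite ym; elim: m {ym} => [|m /hf]; first by apply: (hb _ x.2); rewrite /= -surjective_pairing.
  by rewrite /far /=; apply: hb.
by rewrite [y]surjective_pairing; apply: hb h.
Qed.

Definition ldeg x k P := if is_tri (fface x) then tdeg k.+1 P else bdeg k.+1 k.+1 P.

Lemma bdeg_bloc a x y p : fface x = fface y -> ~~ is_tri (fface x) ->
  bdeg a a (bloc x p) -> bdeg a a (bloc y p).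
Proof.
move=> xy rx h; suff [] : fface y = fface x /\ bdeg a a (bloc y p) by [].
apply: (@face_ind (fun y => fface y = fface x /\ bdeg a a (bloc y p)) x); [| |by []|by split] => z [zx hz].
  by split; [exact: zx|rewrite bloc_swap; exact: bdeg_swap].
split; first by rewrite fface_far.
by rewrite bloc_far /FD zx (negPf rx); exact: bdeg_flip.
Qed.

Lemma bdeg_supp k (q : {mpoly R[2]}) : bdeg k.+1 k.+1 (biv q) <->
  forall (m : 'X_{1..2}) (i : 'I_2), m \in msupp q -> (m i <= k)%N.
Proof.
split=> [h m i|h i j].
  apply: contraTT; rewrite -ltnNge => ki; rewrite mcoeff_msupp negbK.
  rewrite (mn2E m) -coef_biv; apply/eqP/h; apply/orP.
  case: (unliftP ord0 i) ki => [j|] ->; last by left.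
  by rewrite (ord1 j) (_ : lift ord0 ord0 = ord_max); [right|apply: val_inj].
rewrite coef_biv => ij; apply/eqP; apply: contraTT ij; rewrite -mcoeff_msupp => mn.
have := h _ ord0 mn; have := h _ ord_max mn; rewrite !mnmE /= => hj hi.
by rewrite negb_or -!ltnNge !ltnS hi hj.
Qed.

Lemma RkP x k p : Rk k (fface x) p <-> ldeg x k (bloc x p).
Proof.
rewrite /Rk /ldeg; case: ifPn => tx.
  split; first exact: bloc_tdeg.
  by rewrite -{2}(blocK x p); apply: msize_glob.
have supp y := bdeg_supp k (adapted y p).
split=> [h|h y yx]; first by rewrite blocE; apply/supp/h.
by apply/supp; rewrite -blocE; apply: (bdeg_bloc (x := x)).
Qed.

Definition e0 x p : {poly R} := (bloc x p)`_0.
Definition e1 x p : {poly R} := (bloc x p)`_1.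

Lemma blocD x p q : bloc x (p + q) = bloc x p + bloc x q.
Proof. exact: rmorphD. Qed.

Lemma e0_lin x a p q : e0 x (a *: p + q) = a *: e0 x p + e0 x q.
Proof. by rewrite /e0 blocD blocZ coefD coefCM mul_polyC. Qed.

Lemma e1_lin x a p q : e1 x (a *: p + q) = a *: e1 x p + e1 x q.
Proof. by rewrite /e1 blocD blocZ coefD coefCM mul_polyC. Qed.

Lemma e0_far x p : e0 (far x) p = e0 x p \Po (1 - 'X).
Proof. by rewrite /e0 bloc_far flipXY0. Qed.

Lemma e1_far x p : e1 (far x) p = (e1 x p - (e0 x p)^`() *+ FD x) \Po (1 - 'X).
Proof. by rewrite /e1 bloc_far flipXY1 mulr_natl. Qed.

Lemma e0_swap x p : (e0 (swap x) p).[0] = (e0 x p).[0].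
Proof.
rewrite !horner_coef0 /e0 bloc_swap coef_swapXY.
reflexivity.
Qed.

Lemma de0_swap x p : ((e0 (swap x) p)^`()).[0] = (e1 x p).[0].
Proof. by rewrite !horner_coef0 coef_deriv /e0 /e1 bloc_swap coef_swapXY. Qed.

Lemma e1_swap x p : (e1 (swap x) p).[0] = ((e0 x p)^`()).[0].
Proof. by rewrite -de0_swap swapK. Qed.

Lemma de1_swap x p : ((e1 (swap x) p)^`()).[0] = ((e1 x p)^`()).[0].
Proof. by rewrite !horner_coef0 !coef_deriv /e1 bloc_swap coef_swapXY. Qed.

Lemma size_e0 x k p : Rk k (fface x) p -> (size (e0 x p) <= k.+1)%N.
Proof.
move/RkP; rewrite /ldeg; case: ifP => _ h; apply/leq_sizeP => i ki; apply: h.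
  by rewrite addn0.
by rewrite ki.
Qed.

Lemma size_e1 x k p : Rk k (fface x) p -> (size (e1 x p) <= k.+1 - FD x)%N.
Proof.
move/RkP; rewrite /ldeg /FD; case: ifP => _ h; apply/leq_sizeP => i ki; apply: h.
  by rewrite addn1; move: ki; clear; lia.
by rewrite subn0 in ki; rewrite ki.
Qed.

Lemma edge_extension x k (h C : {poly R}) : (0 < k)%N -> (size h <= k.+1)%N ->
  (size C <= k.+1 - FD x)%N ->
  exists p, [/\ Rk k (fface x) p, e0 x p = h & e1 x p = C].
Proof.
move=> k0 sh sC; exists (glob x (h%:P + C%:P * 'X)).
have [p0 p1 _] := coef_poly2 h C; rewrite /e0 /e1 globK p0 p1; split=> //.
apply/RkP; rewrite globK /ldeg; move: sC; rewrite /FD; case: ifP => _ sC.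
  by apply: tdeg_poly2; rewrite -?subn1.
by apply: bdeg_poly2; rewrite // subn0 in sC *.
Qed.

Definition tay (h C : {poly R}) : jet R := (h.[0], h^`().[0], C.[0], C^`().[0]).

Lemma taylorE x p : taylor x p = tay (e0 x p) (e1 x p).
Proof.
rewrite /taylor /tay /e0 /e1 !blocE /= !meval_dv !meval_u; congr (_, _, _, _).
  rewrite !horner_coef0 coef_deriv mulr1n.
  have := congr1 (fun P : {poly {poly R}} => (swapXY P)`_0`_0) (swap_biv_du (adapted x p)).
  by rewrite swapXYK coef_swapXY coef_deriv mulr1n coef_swapXY => ->.
rewrite !horner_coef0 coef_deriv mulr1n.
have := congr1 (fun P : {poly {poly R}} => (swapXY P)`_0`_0) (swap_biv_du (dv (adapted x p))).
rewrite swapXYK coef_swapXY coef_deriv mulr1n coef_swapXY => ->.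
by rewrite biv_dv coef_deriv mulr1n.
Qed.

End LocalDegrees.

Section Univariate.
Variable R : realType.
Implicit Types (p q h C : {poly R}).

Definition flip F (z : {poly R} * {poly R}) : {poly R} * {poly R} :=
  (z.1 \Po (1 - 'X), (z.2 - z.1^`() *+ F) \Po (1 - 'X)).

Lemma comp_1subXK p : (p \Po (1 - 'X)) \Po (1 - 'X) = p.
Proof.
rewrite -comp_polyA comp_polyB comp_polyX -polyC1 comp_polyC subKr.
by rewrite comp_polyXr.
Qed.

Lemma deriv_comp_1subX p : (p \Po (1 - 'X))^`() = - (p^`() \Po (1 - 'X)).
Proof. by rewrite deriv_comp derivB derivX -polyC1 derivC sub0r mulrN1. Qed.

Lemma flipK F : involutive (flip F).
Proof.
case=> h C; rewrite /flip /=; congr (_, _); first exact: comp_1subXK.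
rewrite deriv_comp_1subX mulNrn opprK comp_polyD comp_1subXK.
by rewrite (raddfMn (comp_poly _)) /= comp_1subXK subrK.
Qed.

Lemma horner_1subX p t : (p \Po (1 - 'X)).[t] = p.[1 - t].
Proof. by rewrite horner_comp !hornerE. Qed.

Lemma tay_flip F h C : tay (flip F (h, C)).1 (flip F (h, C)).2 =
  (h.[1], - (h^`().[1]), C.[1] - h^`().[1] *+ F, - (C^`().[1] - h^`()^`().[1] *+ F)).
Proof.
rewrite /tay /flip /= !deriv_comp_1subX !hornerN !horner_1subX subr0.
by rewrite derivB derivMn !hornerD !hornerN !hornerMn.
Qed.

Lemma tay_lin (a : R) h1 C1 h2 C2 : tay (a *: h1 + h2) (a *: C1 + C2) =
  (a * h1.[0] + h2.[0], a * h1^`().[0] + h2^`().[0],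
   a * C1.[0] + C2.[0], a * C1^`().[0] + C2^`().[0]).
Proof. by rewrite /tay !derivD !derivZ !hornerD !hornerZ. Qed.

Lemma tay0P h C : tay h C = zero4 <->
  [/\ h.[0] = 0, h^`().[0] = 0, C.[0] = 0 & C^`().[0] = 0].
Proof. by rewrite /tay; split=> [[-> -> -> ->]|[-> -> -> ->]]. Qed.

Lemma tay00 : tay (0 : {poly R}) 0 = zero4.
Proof. by rewrite /tay !deriv0 !horner0. Qed.

Lemma double_root p (a : R) : p.[a] = 0 -> p^`().[a] = 0 -> exists q, p = q * ('X - a%:P) ^+ 2.
Proof.
move=> /eqP /factor_theorem[q ->]; rewrite derivM derivXsubC mulr1 !hornerE /=.
rewrite subrr mulr0 add0r => /eqP /factor_theorem[r ->].
by exists r; rewrite expr2 mulrA.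
Qed.

Definition bubble : {poly R} := 'X ^+ 2 * (1 - 'X) ^+ 2.

Lemma size_bubble : size bubble = 5.
Proof.
have -> : bubble = 'X ^+ 2 * ('X - 1%:P) ^+ 2 by rewrite /bubble -polyC1; ring.
by rewrite size_mul ?expf_neq0 ?polyX_eq0 ?polyXsubC_eq0 // size_polyXn size_exp_XsubC.
Qed.

Lemma bubbleP p : p.[0] = 0 -> p^`().[0] = 0 -> p.[1] = 0 -> p^`().[1] = 0 ->
  exists2 q, p = bubble * q & (size q <= size p - 4)%N.
Proof.
move=> p0 dp0 p1 dp1; have [q pq] := double_root p0 dp0.
rewrite subr0 in pq; have q1 : q.[1] = 0 by move: p1; rewrite pq hornerM hornerXn expr1n mulr1.
have dq1 : q^`().[1] = 0.
  by move: dp1; rewrite pq derivM hornerD (hornerM q^`()) (hornerM q) q1 mul0r addr0 hornerXn expr1n mulr1.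
have [r qr] := double_root q1 dq1; exists r.
  by rewrite pq qr /bubble -polyC1; ring.
have [->|r0] := eqVneq r 0; first by rewrite size_poly0.
have e : p = bubble * r by rewrite pq qr /bubble -polyC1; ring.
rewrite e size_mul // ?size_bubble; first by rewrite addnC -subn1 -subnDA addnK.
by rewrite -size_poly_eq0 size_bubble.
Qed.

Lemma omega_rect : omega R 0 = 1 - 'X%:P.
Proof. by rewrite /omega mulr0n mul0r subr0. Qed.

Lemma swapXY_1subY : swapXY (1 - 'X%:P) = 1 - 'X :> {poly {poly R}}.
Proof. by rewrite raddfB /= rmorph1 swapXY_Y. Qed.

Lemma flip_1subX F : flipXY F (1 - 'X) = 1 - 'X :> {poly {poly R}}.
Proof. by rewrite raddfB /= rmorph1 flipXYX. Qed.

End Univariate.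

Section Face.
Variables (R : realType) (M : surface R).
Implicit Types (x y : flag M) (c : corner M) (p g : {mpoly R[2]}) (P : {poly {poly R}}).
Implicit Types (h C a b : {poly R}).

Lemma blocM x p g : bloc x (p * g) = bloc x p * bloc x g.
Proof. exact: rmorphM. Qed.

Definition edat x p := (e0 x p, e1 x p).
Definition tay2 (z : {poly R} * {poly R}) := tay z.1 z.2.
Definition perm4 (d : jet R) := let: (v, g1, g2, w) := d in (v, g2, g1, w).

Lemma edat_far x p : edat (far x) p = flip (FD x) (edat x p).
Proof. by rewrite /edat e0_far e1_far. Qed.

Lemma tay_swap x p : tay2 (edat (swap x) p) = perm4 (tay2 (edat x p)).
Proof. by rewrite /tay2 /tay /= e0_swap de0_swap e1_swap de1_swap. Qed.

Lemma edat_lin x (r : R) p q : edat x (r *: p + q) = r *: edat x p + edat x q.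
Proof. by rewrite /edat e0_lin e1_lin. Qed.

Lemma edat_linmap x : linmap (edat x).
Proof. by move=> r p q; apply: edat_lin. Qed.

Lemma edat_vanish x g : edat x (lv x ^+ 2 * g) = 0.
Proof. by rewrite /edat /e0 /e1 blocM rmorphXn /= bloc_lv !coefXnM. Qed.

Lemma edat_far0 x p : edat x p = 0 -> edat (far x) p = 0.
Proof.
move=> h; rewrite edat_far h /flip /= deriv0 mul0rn subr0.
by rewrite comp_poly0.
Qed.

Definition rot x := swap (far x).

Lemma bloc_lv_swap x : bloc x (lv (swap x)) = 'X%:P.
Proof. by rewrite -{1}[x]swapK bloc_swap bloc_lv swapXY_X. Qed.

Lemma bloc_rot x p : bloc x p = flipXY (FD x) (swapXY (bloc (rot x) p)).
Proof. by rewrite -{1}[x]farK bloc_far FD_far -[far x]swapK bloc_swap. Qed.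

Lemma bloc_lv_rot x : bloc x (lv (rot x)) = omega R (FD x).
Proof. by rewrite bloc_rot bloc_lv swapXY_X flipXYC flipuX. Qed.

Lemma FD_rot x : FD (rot x) = FD x.
Proof. by rewrite /rot /FD fface_swap fface_far. Qed.

Lemma bloc_lv_rot2 x : FD x = 0%N -> bloc x (lv (rot (rot x))) = 1 - 'X.
Proof.
by move=> F0; rewrite bloc_rot bloc_lv_rot FD_rot F0 omega_rect swapXY_1subY flip_1subX.
Qed.

Lemma face_flag (s : face M) : exists x : flag M, fface x = s.
Proof.
have i0 : (0 < nsides (is_tri s))%N by case: is_tri.
by exists (Tagged (fun s => 'I_(nsides (is_tri s))) (Ordinal i0), true).
Qed.

Lemma Rk_subspace k (s : face M) : subspace (Rk k s).
Proof.
have [x <-] := face_flag s; split.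
  by apply/RkP; rewrite rmorph0 /ldeg; case: ifP => _ i j _; rewrite !coef0.
move=> a p q /RkP hp /RkP hq; apply/RkP; move: hp hq; rewrite blocD blocZ /ldeg.
by case: ifP => _ hp hq i j ij; rewrite !(coefD, coefCM) hp // hq // mulr0 addr0.
Qed.

Lemma bdegM (m n m' n' : nat) P (Q : {poly {poly R}}) : bdeg m.+1 n.+1 P -> bdeg m'.+1 n'.+1 Q ->
  bdeg (m + m').+1 (n + n').+1 (P * Q).
Proof.
move=> hP hQ i j ij; rewrite coefM coef_sum big1 // => k _.
rewrite coefM big1 // => l _.
have [h|h] := boolP ((m.+1 <= l)%N || (n.+1 <= k)%N); first by rewrite hP ?mul0r.
rewrite (hQ (i - l)%N (j - k)%N) ?mulr0 //.
by have := ltn_ord k; have := ltn_ord l; move: ij h; clear; lia.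
Qed.

(* The first-order coefficient in v of (1 - u - v)^2 on triangles and of
   (1 - u)^2 (1 - v)^2 on rectangles, the squared products of the equations of
   the edges that avoid the origin. *)
Definition kappa (F : nat) : {poly R} := - ((1 - 'X) ^+ (2 - F)) *+ 2.

Lemma adjacent_function x k a b : (3 + FD x <= k)%N -> (size a <= k.-1)%N ->
  (size b <= k.-1 - FD x)%N -> exists p,
  [/\ Rk k (fface x) p,
      edat x p = ((1 - 'X) ^+ 2 * a, (1 - 'X) ^+ 2 * b + kappa (FD x) * a),
      edat (rot x) p = 0, (FD x = 0%N -> edat (rot (rot x)) p = 0) &
      'X ^+ 2 %| a -> 'X ^+ 2 %| b -> edat (swap x) p = 0].
Proof.
move=> hk sa sb.
pose g := glob x (a%:P + b%:P * 'X).
pose eta : {mpoly R[2]} := if is_tri (fface x) then 1 else lv (rot (rot x)) ^+ 2.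
exists (lv (rot x) ^+ 2 * (eta * g)).
have blocE : bloc x (lv (rot x) ^+ 2 * (eta * g)) =
    omega R (FD x) ^+ 2 * (bloc x eta * (a%:P + b%:P * 'X)).
  by rewrite blocM [bloc x (eta * g)]blocM rmorphXn /= bloc_lv_rot globK.
have [ab0 ab1 _] := coef_poly2 a b.
have om0 := omega0 R (FD x); have om1 := omega1 R (FD x).
split.
- apply/RkP; rewrite /ldeg blocE /eta; case tx: (is_tri (fface x)); last rename tx into rx.
    rewrite rmorph1 mul1r; move: sb hk; rewrite /FD tx => sb hk.
    have -> : k.+1 = (1 * 2 + k.-2).+1 by move: hk; clear; lia.
    apply: tdegM; first by apply: tdegX; move: (tdeg_affine (1 : R) (-1) (-1));
      rewrite /omega !polyCN !mulN1r mul1r.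
    by apply: tdeg_poly2; move: sa sb hk; clear; lia.
  have F0 : FD x = 0%N by rewrite /FD rx.
  move: sb hk; rewrite F0 omega_rect => sb hk; rewrite rmorphXn /= bloc_lv_rot2 //.
  have b1 : bdeg 3 1 ((1 - 'X%:P) ^+ 2 : {poly {poly R}}).
    rewrite expr2; apply: (@bdegM 1 0 1 0) => i j; rewrite -[1]/(1%:P) -polyCB coefC;
    by case: j => [|j]; rewrite ?coef0 // orbF => hi; apply/leq_sizeP: i hi; rewrite size_1subX.
  have b2 : @bdeg R 1 3 ((1 - 'X) ^+ 2).
    rewrite expr2; apply: (@bdegM 0 1 0 1) => i j; rewrite coefB coefX -polyC1 coefC;
    by case: j i => [|[|j]] [|i] //= _; rewrite ?subr0 ?coef1 ?coefB ?coef1 ?coef0 ?subrr.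
  have b3 : @bdeg R k.-2.+1 4 ((1 - 'X) ^+ 2 * (a%:P + b%:P * 'X)).
    apply: (@bdegM 0 2 k.-2 1) b2 _.
    by apply: bdeg_poly2; move: sa sb hk; clear; lia.
  apply: bdeg_sub (@bdegM 2 0 k.-2 3 _ _ b1 b3); move: hk; clear; lia.
- rewrite /edat /e0 /e1 blocE.
  have [K0 K1] : (omega R (FD x) ^+ 2 * bloc x eta)`_0 = (1 - 'X) ^+ 2 /\
      (omega R (FD x) ^+ 2 * bloc x eta)`_1 = kappa (FD x).
    rewrite coef0M coef1M expr2 coef0M coef1M om0 om1 /eta /kappa /FD; case tx: (is_tri (fface x)).
      rewrite rmorph1 -!polyC1 !coefC /= mulr1 mulr0 add0r mulr1; split=> //.
      by rewrite subSS subn0 expr1; ring.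
    rewrite rmorphXn /= bloc_lv_rot2; last by rewrite /FD tx.
    rewrite expr2 coef0M coef1M !coefB !coefX -polyC1 !coefC /= subr0 sub0r mulr0n oppr0.
    by rewrite !mulr1 mul1r mul0r mulr0 !addr0 subn0 polyC1; split=> //; ring.
  by rewrite mulrA coef0M [in X in (_, X)]coef1M K0 K1 ab0 ab1.
- exact: edat_vanish.
- move=> F0; have -> : lv (rot x) ^+ 2 * (eta * g) = lv (rot (rot x)) ^+ 2 * (lv (rot x) ^+ 2 * g).
    by rewrite /eta; move: F0; rewrite /FD; case: ifP => // _ _; rewrite mulrCA.
  exact: edat_vanish.
move=> /dvdpP[a' ea] /dvdpP[b' eb].
have -> : lv (rot x) ^+ 2 * (eta * g) = lv (swap x) ^+ 2 * (lv (rot x) ^+ 2 * eta * glob x (a'%:P + b'%:P * 'X)).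
  have -> : g = lv (swap x) ^+ 2 * glob x (a'%:P + b'%:P * 'X).
    apply: (can_inj (@blocK _ _ x)); rewrite /g blocM rmorphXn /= !globK bloc_lv_swap ea eb.
    by rewrite !polyCM; ring.
  by rewrite mulrA mulrCA.
exact: edat_vanish.
Qed.

End Face.

Section Hermite.
Variable R : realType.
Implicit Types (p q a b h C : {poly R}).

Lemma deriv1 : (1 : {poly R})^`() = 0.
Proof. by rewrite -polyC1 derivC. Qed.

Lemma horner_sqr0 a : ((1 - 'X) ^+ 2 * a).[0] = a.[0] /\
  ((1 - 'X) ^+ 2 * a)^`().[0] = a^`().[0] - a.[0] *+ 2.
Proof.
rewrite expr2 !derivM !derivB !derivX -polyC1 derivC.
by rewrite !hornerE /= ; split; ring.
Qed.

Lemma horner_kappa F : (F <= 1)%N -> (kappa R F).[0] = - 2 /\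
  (kappa R F)^`().[0] = (2 - F)%:R *+ 2.
Proof.
case: F => [|[|//]] _; rewrite /kappa /= ?subn0 ?subSS ?subn0 ?expr2 ?expr1
  !derivMn !derivN ?derivM !derivB !derivX -polyC1 !derivC !hornerE /=;
by split; ring.
Qed.

Lemma horner_lin2 (r s : R) : (r%:P + s *: 'X).[0] = r /\ (r%:P + s *: 'X)^`().[0] = s.
Proof. by rewrite derivD derivC derivZ derivX !hornerE; split; ring. Qed.

Lemma size_lin2 (r s : R) : (size (r%:P + s *: 'X : {poly R})%R <= 2)%N.
Proof.
apply: leq_trans (size_polyD _ _) _; rewrite geq_max (leq_trans (size_polyC_leq1 _)) //=.
by apply: leq_trans (size_scale_leq _ _) _; rewrite size_polyX.
Qed.

Lemma corner_coefs F (D : jet R) : (F <= 1)%N -> exists a b,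
  [/\ (size a <= 2)%N, (size b <= 2)%N &
      tay ((1 - 'X) ^+ 2 * a) ((1 - 'X) ^+ 2 * b + kappa R F * a) = D].
Proof.
move=> hF; case: D => -[[v g1] g2] w.
pose be := g1 + v *+ 2; pose ga := g2 + v *+ 2.
pose de := w + ga *+ 2 + be *+ 2 - (2 - F)%:R *+ 2 * v.
exists (v%:P + be *: 'X), (ga%:P + de *: 'X); split; try exact: size_lin2.
have [a0 a1] := horner_lin2 v be; have [b0 b1] := horner_lin2 ga de.
have [k0 k1] := horner_kappa hF.
have [c0 c1] := horner_sqr0 (ga%:P + de *: 'X).
rewrite b0 b1 in c0 c1.
have [d0 d1] := horner_sqr0 (v%:P + be *: 'X).
rewrite a0 a1 in d0 d1.
move: ((1 - 'X) ^+ 2 * (v%:P + be *: 'X)) d0 d1 => d d0 d1.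
move: ((1 - 'X) ^+ 2 * (ga%:P + de *: 'X)) c0 c1 => c c0 c1.
move: (v%:P + be *: 'X) a0 a1 => a a0 a1.
rewrite /tay d0 d1 derivD derivM !hornerD !(hornerM (kappa R F)) (hornerM (kappa R F)^`()).
rewrite k0 k1 c0 c1 a0 a1 /de /be /ga.
by congr (_, _, _, _); ring.
Qed.

Lemma size_bubbleM q : q != 0 -> size (bubble R * q) = (size q + 4)%N.
Proof.
move=> q0; have b0 : bubble R != 0 by rewrite -size_poly_eq0 size_bubble.
by rewrite size_mul // size_bubble addSn addnC.
Qed.

Lemma edge_coefs F k h C : (F <= 1)%N -> (3 + F <= k)%N ->
  (size h <= k.+1)%N -> (size C <= k.+1 - F)%N ->
  tay h C = zero4 -> tay (flip F (h, C)).1 (flip F (h, C)).2 = zero4 ->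
  exists a b, [/\ (size a <= k.-1)%N, (size b <= k.-1 - F)%N, 'X ^+ 2 %| a, 'X ^+ 2 %| b &
    h = (1 - 'X) ^+ 2 * a /\ C = (1 - 'X) ^+ 2 * b + kappa R F * a].
Proof.
move=> hF hk sh sC /tay0P[h0 dh0 C0 dC0].
rewrite tay_flip => -[h1 /eqP]; rewrite oppr_eq0 => /eqP dh1.
rewrite dh1 mul0rn subr0 => C1 /eqP; rewrite oppr_eq0 subr_eq0 => /eqP dC1.
have [h' eh sh'] := bubbleP h0 dh0 h1 dh1.
have ddh1 : h^`()^`().[1] = h'.[1] *+ 2.
  rewrite eh /bubble expr2 expr2 !(derivM, derivD, derivN, derivX, deriv1, deriv0).
  by rewrite !hornerE /=; ring.
have nX : size ((1 - 'X) ^+ 2 : {poly R}) = 3.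
  have -> : (1 - 'X) ^+ 2 = ('X - 1%:P) ^+ 2 :> {poly R} by rewrite -polyC1; ring.
  by rewrite size_exp_XsubC.
have sa : (size ('X ^+ 2 * h' : {poly R})%R <= k.-1)%N.
  have [->|n0] := eqVneq h' 0; first by rewrite mulr0 size_poly0.
  by rewrite mulrC size_mulXn //; move: sh' sh hk; clear; lia.
pose E := C - kappa R F * ('X ^+ 2 * h').
have ka0 : (kappa R F * ('X ^+ 2 * h')).[0] = 0 /\ (kappa R F * ('X ^+ 2 * h'))^`().[0] = 0.
  rewrite derivM [('X ^+ 2 * h')^`()]derivM derivXn !hornerE /=.
  by rewrite ?expr0n /= ?mul0r; split; ring.
have ka1 : (kappa R F * ('X ^+ 2 * h')).[1] = 0 /\
    (kappa R F * ('X ^+ 2 * h'))^`().[1] = h'.[1] *+ 2 *+ F.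
  case: F hF {sC hk dC1 E ka0} => [|[|//]] _; rewrite /kappa ?subn0 ?subSS ?subn0 ?expr2 ?expr1;
  rewrite !(derivMn, derivM, derivD, derivN, derivX, deriv1, deriv0) !hornerE /=;
  by split; ring.
have [q eq sq] : exists2 q, E = bubble R * q & (size q <= size E - 4)%N.
  apply: bubbleP; rewrite /E ?derivB hornerD hornerN.
  - by rewrite C0 ka0.1 subr0.
  - by rewrite dC0 ka0.2 subr0.
  - by rewrite C1 ka1.1 subr0.
  - by rewrite dC1 ka1.2 ddh1 subrr.
exists ('X ^+ 2 * h'), ('X ^+ 2 * q); split=> //; try exact: dvdp_mulIl.
  have sE : (size E <= k.+1 - F)%N.
    apply: leq_trans (size_polyD _ _) _; rewrite size_polyN geq_max sC /=.
    apply: leq_trans (size_polyMleq _ _) _.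
    have : (size (kappa R F) <= 3 - F)%N.
      rewrite /kappa -scaler_nat; apply: leq_trans (size_scale_leq _ _) _; rewrite size_polyN.
      case: (F) hF => [|[|//]] _; first by rewrite nX.
      by rewrite expr1 size_1subX.
    by move: sa hk hF; clear; lia.
  have [->|n0] := eqVneq q 0; first by rewrite mulr0 size_poly0.
  rewrite mulrC size_mulXn //.
  by move: sE hk; rewrite eq size_bubbleM //; clear; lia.
split; first by rewrite eh /bubble; ring.
by rewrite -[C](subrK (kappa R F * ('X ^+ 2 * h'))) -/E eq /bubble; congr (_ + _); ring.
Qed.

End Hermite.

Section FaceInterpolation.
Variables (R : realType) (M : surface R).
Implicit Types (x y : flag M) (c : corner M) (p : {mpoly R[2]}).
Implicit Types (h C : {poly R}).

Lemma FD_le1 x : (FD x <= 1)%N.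
Proof. by rewrite /FD; case: is_tri. Qed.

Lemma rotE c : rot (c, true) = (next_corner c, true).
Proof. by []. Qed.

(* The edges of a face are represented by the flags (c, true). *)
Lemma other_edge c c' : tag c' = tag c -> c' != c ->
  [\/ (c', true) = rot (c, true), FD (c, true) = 0%N /\ (c', true) = rot (rot (c, true)) |
      c' = prev_corner c].
Proof.
move=> tc nc; have [m hm cm] := next_iter (esym tc).
rewrite !rotE /FD /fface /=; move: hm; have [tri|rect] := boolP (is_tri (tag c)) => /= hm.
  case: m hm cm => [|[|[|//]]] _ /= e; first by rewrite e eqxx in nc.
    by constructor 1; rewrite e.
  by constructor 3; rewrite e next_next_tri.
case: m hm cm => [|[|[|[|//]]]] _ /= e; first by rewrite e eqxx in nc.
- by constructor 1; rewrite e.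
- by constructor 2; rewrite e.
by constructor 3; rewrite e next_next_next_rect.
Qed.

Lemma fface_rot x : fface (rot x) = fface x.
Proof. by rewrite /rot fface_swap fface_far. Qed.

Lemma tay_swap0 x p : tay2 (edat x p) = zero4 -> tay2 (edat (swap x) p) = zero4.
Proof. by rewrite tay_swap => ->. Qed.

Lemma tay2_0 : tay2 (0 : {poly R} * {poly R}) = zero4.
Proof. exact: tay00. Qed.

Lemma corner_function k c (D : jet R) : (3 + FD (c, true) <= k)%N -> exists p,
  [/\ Rk k (tag c) p, tay2 (edat (c, true) p) = D &
      forall c', tag c' = tag c -> c' != c -> tay2 (edat (c', true) p) = zero4].
Proof.
move=> hk; have [a [b [sa sb ab]]] := corner_coefs D (FD_le1 (c, true)).
have [||p [hp ep er er2 _]] := @adjacent_function _ _ (c, true) k a b hk.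
- by move: sa hk; clear; lia.
- by move: sb hk; clear; lia.
exists p; split=> //; first by rewrite ep.
move=> c' tc nc; case: (other_edge tc nc) => [->|[F0 ->]|cp].
- by rewrite er tay2_0.
- by rewrite (er2 F0) tay2_0.
rewrite {}cp {c' tc nc}; rewrite -[(_, true)]/(swap (prev_corner c, false)); apply: tay_swap0.
have [tri|rect] := boolP (is_tri (tag c)).
  have -> : (prev_corner c, false) = far (rot (c, true)) :> flag M.
    by rewrite rotE /far /= next_next_tri.
  by rewrite edat_far0 ?tay2_0.
have -> : (prev_corner c, false) = far (rot (rot (c, true))) :> flag M.
  by rewrite !rotE /far /= next_next_next_rect.
by rewrite edat_far0 ?tay2_0 // er2 // /FD /fface /= (negPf rect).
Qed.

Lemma edge_function k c h C : (3 + FD (c, true) <= k)%N ->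
  (size h <= k.+1)%N -> (size C <= k.+1 - FD (c, true))%N ->
  tay h C = zero4 -> tay2 (flip (FD (c, true)) (h, C)) = zero4 ->
  exists p, [/\ Rk k (tag c) p, edat (c, true) p = (h, C) &
      forall c', tag c' = tag c -> c' != c -> edat (c', true) p = 0].
Proof.
move=> hk sh sC t0 t1.
have [a [b [sa sb da db [eh eC]]]] := edge_coefs (FD_le1 (c, true)) hk sh sC t0 t1.
have [p [hp ep er er2 es]] := @adjacent_function _ _ (c, true) k a b hk sa sb.
exists p; split=> //; first by rewrite ep eh eC.
move=> c' tc nc; case: (other_edge tc nc) => [->//|[F0 ->]|->]; first exact: er2.
rewrite -[(_, true)]/(far (c, false)).
by apply: edat_far0; apply: es.
Qed.

Lemma tay2_lin (r : R) z1 z2 : tay2 z1 = zero4 -> tay2 z2 = zero4 ->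
  tay2 (r *: z1 + z2) = zero4.
Proof.
rewrite /tay2 => /tay0P[h1 h2 h3 h4] /tay0P[g1 g2 g3 g4].
by rewrite tay_lin h1 h2 h3 h4 g1 g2 g3 g4 !mulr0 !addr0.
Qed.

Lemma tay2_eq (z1 z2 : {poly R} * {poly R}) :
  tay2 z1 = tay2 z2 <-> tay2 (z1 - z2) = zero4.
Proof.
case: z1 z2 => [h1 C1] [h2 C2]; rewrite /tay2 /tay /= !derivB !hornerD !hornerN.
split=> [[-> -> -> ->]|[]]; first by rewrite !subrr.
by do 4 ?[move/eqP; rewrite subr_eq0 => /eqP ->].
Qed.

Lemma tay2_subspace : subspace [set z : {poly R} * {poly R} | tay2 z = zero4]%classic.
Proof. by split; [exact: tay2_0|move=> a u v; apply: tay2_lin]. Qed.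

Lemma flipB F (z1 z2 : {poly R} * {poly R}) : flip F (z1 - z2) = flip F z1 - flip F z2.
Proof.
case: z1 z2 => [h1 C1] [h2 C2]; rewrite /flip /=; congr (_, _).
  by rewrite comp_polyB.
by rewrite -comp_polyB derivB mulrnBl opprB; congr (_ \Po _); ring.
Qed.

Lemma face_interpolation k (z : flag M -> {poly R} * {poly R}) :
  (forall x, (3 + FD x <= k)%N) ->
  (forall x, z (far x) = flip (FD x) (z x)) ->
  (forall x, tay2 (z (swap x)) = perm4 (tay2 (z x))) ->
  (forall x, (size (z x).1 <= k.+1)%N /\ (size (z x).2 <= k.+1 - FD x)%N) ->
  exists f : {ffun face M -> {mpoly R[2]}},
    (forall s, Rk k s (f s)) /\ forall x, edat x (f (fface x)) = z x.
Proof.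
move=> hk zfar zswap zsize.
have /choice [cf cfP] := fun c => corner_function (tay2 (z (c, true))) (hk (c, true)).
pose p1 s := \sum_(c : corner M | tag c == s) cf c.
have p1R s : Rk k s (p1 s).
  apply: subspace_sum; first exact: Rk_subspace.
  by move=> c /eqP <-; have [] := cfP c.
pose y c := z (c, true) - edat (c, true) (p1 (tag c)).
have yT c : tay2 (y c) = zero4.
  rewrite /y /p1 (bigD1 c) //= (linmapD _ _ (edat_linmap _)) opprD addrA.
  apply: (subspaceB tay2_subspace).
    by apply/tay2_eq; have [_ ->] := cfP c.
  rewrite (linmap_sum _ _ _ (edat_linmap _)); apply: (subspace_sum _ tay2_subspace).
  move=> c' /andP[/eqP tc nc]; have [_ _] := cfP c'; apply; first by rewrite tc.
  by rewrite eq_sym.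
have yF c : tay2 (flip (FD (c, true)) (y c)) = zero4.
  rewrite /y flipB -zfar -edat_far; apply/tay2_eq.
  rewrite -[far _]/(swap (next_corner c, true)) zswap tay_swap; congr perm4.
  exact/tay2_eq/(yT (next_corner c)).
have ys c : (size (y c).1 <= k.+1)%N /\ (size (y c).2 <= k.+1 - FD (c, true))%N.
  have [s1 s2] := zsize (c, true); have R1 := p1R (fface (c, true)).
  split; apply: leq_trans (size_polyD _ _) _; rewrite size_polyN geq_max ?s1 ?s2 /=.
    exact: size_e0 R1.
  exact: size_e1 R1.
have /choice [ef efP] : forall c, exists p, [/\ Rk k (tag c) p, edat (c, true) p = y c &
      forall c', tag c' = tag c -> c' != c -> edat (c', true) p = 0].
  move=> c; have [s1 s2] := ys c; have := yT c; have := yF c.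
  case: (y c) s1 s2 => h C /= s1 s2 t1 t0.
  exact: (edge_function (hk (c, true)) s1 s2 t0 t1).
exists [ffun s => p1 s + \sum_(c : corner M | tag c == s) ef c].
split=> [s|x]; rewrite ffunE.
  apply: subspaceD (p1R s) _; first exact: Rk_subspace.
  apply: subspace_sum; first exact: Rk_subspace.
  by move=> c /eqP <-; have [] := efP c.
have key c : edat (c, true) (p1 (tag c) + \sum_(c' : corner M | tag c' == tag c) ef c') = z (c, true).
  rewrite (linmapD _ _ (edat_linmap _)) (linmap_sum _ _ ef (edat_linmap _)) (bigD1 c) //=.
  rewrite big1 ?addr0; last first.
    move=> c' /andP[/eqP tc nc]; have [_ _ h] := efP c'; rewrite h ?tc //.
    by rewrite eq_sym.
  by have [_ -> _] := efP c; rewrite /y addrC subrK.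
case: x => c [|]; first exact: key.
rewrite -[(c, false)]/((c, ~~ true)) -[X in (X, ~~ true)](next_prevK c).
rewrite -[(_, ~~ true)]/(far (prev_corner c, true)) edat_far zfar.
by rewrite fface_far key.
Qed.

End FaceInterpolation.

Section GluingPolynomials.
Variables (R : realType).

Lemma poly_eq_on01 (p q : {poly R}) : (forall t, 0 <= t <= 1 -> p.[t] = q.[t]) -> p = q.
Proof.
move=> h; apply/eqP; rewrite -subr_eq0; apply: contraT => n0.
pose s := [seq (i.+1%:R : R)^-1 | i <- iota 0 (size (p - q))].
have us : uniq s.
  rewrite map_inj_uniq ?iota_uniq // => i j /invr_inj /eqP.
  by rewrite eqr_nat => /eqP [].
have rs : all (root (p - q)) s.
  apply/allP => t /mapP[i _ ->]; rewrite /root hornerD hornerN h ?subrr //.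
  by rewrite invr_ge0 ler0n invf_le1 ?ltr0n // ler1n.
by have := max_poly_roots n0 rs us; rewrite size_map size_iota ltnn.
Qed.

Variables (M : surface R) (G : gluing M).
Implicit Types (x y : flag M).

Lemma G1P x y p1 p2 : mate x = Some y -> G1 G x y p1 p2 <->
  e0 x p1 = e0 y p2 /\
  na G x * (e0 y p2)^`() + nb G x * e1 y p2 = dc G x * e1 x p1.
Proof.
move=> xy; have v1 t : (adapted x p1).@[pt t 0] = (e0 x p1).[t] by rewrite meval_u /e0 blocE.
have v2 t : (adapted (swap y) p2).@[pt 0 t] = (e0 y p2).[t].
  by rewrite meval_v -blocE -bloc_swap swapK.
have d1 t : (dv (adapted x p1)).@[pt t 0] = (e1 x p1).[t] by rewrite meval_dv /e1 blocE.
have d2 t : (du (adapted (swap y) p2)).@[pt 0 t] = (e1 y p2).[t].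
  by rewrite meval_du -blocE -bloc_swap swapK.
have d3 t : (dv (adapted (swap y) p2)).@[pt 0 t] = (e0 y p2)^`().[t].
  rewrite meval_v biv_dv -blocE bloc_swap; congr _.[t].
  by apply/polyP => i; rewrite coef_swapXY !coef_deriv coefMn coef_swapXY.
have ne t : 0 <= t <= 1 -> (dc G x).[t] != 0 by move=> /(gluing_nonzero G xy)[].
rewrite /G1 /=; split=> [h|[h1 h2] t t01]; last first.
  rewrite v1 v2 d1 d2 d3 h1; split=> //.
  have := congr1 (fun p => p.[t]) h2; rewrite /= hornerD !hornerM /ga /gb /rval => h3.
  apply: (mulfI (ne _ t01)); rewrite -h3; field; exact: ne.
split; apply: poly_eq_on01 => t t01; have [] := h t t01.
  by rewrite v1 v2.
rewrite d1 d2 d3 => _ h1; rewrite hornerD !hornerM h1 /ga /gb /rval.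
by field; apply: ne.
Qed.

End GluingPolynomials.

Lemma is_dim_image (K : fieldType) (V W : lmodType K) (f : V -> W) (S : set V) n :
  linmap f -> (forall x, f x = 0 -> x = 0) -> is_dim S n -> is_dim (f @` S)%classic n.
Proof.
move=> hf inj [e [fr sp]]; exists (fun i => f (e i)).
have fs (c : 'I_n -> K) : f (\sum_(i < n) c i *: e i) = \sum_(i < n) c i *: f (e i).
  by rewrite linmap_sum //; apply: eq_bigr => i _; rewrite linmapZ.
split=> [c|y]; first by rewrite -fs => /inj; apply: fr.
split=> [[x /sp[c ->] <-]|[c ->]]; first by exists c; rewrite fs.
by exists (\sum_(i < n) c i *: e i); [apply/sp; exists c|rewrite fs].
Qed.

Lemma card_set_pair (I J : finType) (P : I -> J -> bool) :
  #|[set p : I * J | P p.1 p.2]| = (\sum_i \sum_(j | P i j) 1)%N.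
Proof. by rewrite -sum1_card pair_big_dep /=; apply: eq_bigl => p; rewrite inE. Qed.

Lemma card_triangle n : #|[set p : 'I_n * 'I_n | (p.1 + p.2 < n)%N]| = 'C(n.+1, 2).
Proof.
rewrite (card_set_pair (fun i j : 'I_n => (i + j < n)%N)).
rewrite -bin2_sum big_nat_recl // add0n big_mkord (reindex_inj rev_ord_inj) /=.
apply: eq_bigr => i _.
rewrite (eq_bigl (fun j : 'I_n => (j < i.+1)%N)); last first.
  by move=> j; have := ltn_ord i; clear; lia.
by rewrite -(big_ord_widen n (fun=> 1%N)) // sum1_card card_ord.
Qed.

Section Bubbles.
Variables (R : realType) (M : surface R).
Implicit Types (x y w : flag M) (c : corner M) (p g : {mpoly R[2]}).

Lemma edat0P x p : edat x p = 0 <-> (bloc x p)`_0 = 0 /\ (bloc x p)`_1 = 0.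
Proof. by rewrite /edat /e0 /e1; split=> [[-> ->]|[-> ->]]. Qed.

Lemma edat_mull x p g : edat x p = 0 -> edat x (p * g) = 0.
Proof.
move=> /edat0P[p0 p1]; apply/edat0P; rewrite blocM coef0M coef1M p0 p1.
by rewrite !mul0r addr0.
Qed.

Lemma edat_mulr x p g : edat x p = 0 -> edat x (g * p) = 0.
Proof. by rewrite mulrC; apply: edat_mull. Qed.

Lemma edat_lv x : edat x (lv x ^+ 2) = 0.
Proof. by rewrite -[lv x ^+ 2]mulr1 edat_vanish. Qed.

Lemma double_edge x p : edat x p = 0 -> exists g, [/\ p = lv x ^+ 2 * g,
  forall n, tdeg n (bloc x p) -> tdeg (n - 2) (bloc x g) &
  forall a b, bdeg a b (bloc x p) -> bdeg a (b - 2) (bloc x g)].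
Proof.
move=> /edat0P[p0 p1]; exists (glob x (drop_poly 2 (bloc x p))); rewrite globK; split.
- apply: (can_inj (@blocK _ _ x)); rewrite blocM rmorphXn /= bloc_lv globK.
  rewrite -{1}[bloc x p](poly_take_drop 2) [X in X + _](_ : _ = 0) ?add0r 1?mulrC //.
  apply/polyP => i; rewrite coef_take_poly coef0.
  by case: i => [|[|i]] //=; rewrite ?p0 ?p1.
- by move=> n h i j ij; rewrite coef_drop_poly; apply: h; move: ij; clear; lia.
- by move=> a b h i j ij; rewrite coef_drop_poly; apply: h; move: ij; clear; lia.
Qed.

Lemma edat_cancel x w g : (bloc w (lv x))`_0 != 0 -> edat w (lv x ^+ 2 * g) = 0 -> edat w g = 0.
Proof.
move=> n0; have n2 : (bloc w (lv x) ^+ 2)`_0 != 0 by rewrite expr2 coef0M mulf_neq0.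
move=> /edat0P; rewrite blocM rmorphXn /=; move: (_ ^+ 2) n2 => A n2.
rewrite coef0M coef1M => -[/eqP]; rewrite mulf_eq0 (negPf n2) => /eqP g0.
rewrite g0 mulr0 addr0 => /eqP; rewrite mulf_eq0 (negPf n2) => /eqP g1.
exact/edat0P.
Qed.

Lemma bloc_rotE x p : bloc (rot x) p = swapXY (flipXY (FD x) (bloc x p)).
Proof. by rewrite /rot bloc_swap bloc_far. Qed.

Lemma bloc_rot_lv x : bloc (rot x) (lv x) = 'X%:P.
Proof. by rewrite bloc_rotE bloc_lv flipXYX swapXY_X. Qed.

Lemma bloc_rot2_lv x : bloc (rot (rot x)) (lv x) = 1 - 'X - (FD x)%:R * 'X%:P.
Proof.
rewrite bloc_rotE bloc_rot_lv flipXYC flipuX FD_rot /omega.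
rewrite raddfB /= raddfB /= rmorph1 swapXY_Y.
by rewrite -[(FD x)%:R * 'X]mulr_natl || rewrite mulr_natl raddfMn /= swapXY_X mulr_natl.
Qed.

Lemma coef0_rot x : (bloc (rot x) (lv x))`_0 != 0.
Proof. by rewrite bloc_rot_lv coefC polyX_eq0. Qed.

Lemma coef0_rot2 x : (bloc (rot (rot x)) (lv x))`_0 != 0.
Proof.
have -> : (bloc (rot (rot x)) (lv x))`_0 = 1 - (FD x)%:R * 'X.
  rewrite bloc_rot2_lv -polyC_natr -polyCM.
  by rewrite !coefB coef1 !coefC coefX /= subr0.
have [->|->] : FD x = 0%N \/ FD x = 1%N by rewrite /FD; case: is_tri; auto.
  by rewrite mulr0n mul0r subr0 oner_eq0.
by rewrite mul1r -size_poly_eq0 size_1subX.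
Qed.

Lemma coef0_rot3 x : FD x = 0%N -> (bloc (rot (rot (rot x))) (lv x))`_0 != 0.
Proof.
move=> F0; rewrite bloc_rotE bloc_rot2_lv !FD_rot F0 mulr0n mul0r subr0 flip_1subX.
have -> : swapXY (1 - 'X) = 1 - 'X%:P :> {poly {poly R}}.
  by rewrite -swapXY_1subY swapXYK.
by rewrite coefB coef1 coefC /= -size_poly_eq0 size_1subX.
Qed.

Lemma bdeg_rot x a b p : FD x = 0%N -> bdeg a b (bloc x p) -> bdeg b a (bloc (rot x) p).
Proof. by move=> F0 h; rewrite bloc_rotE F0; apply/bdeg_swap/bdeg_flip. Qed.

Definition inner k (s : face M) : set {mpoly R[2]} :=
  [set p | Rk k s p /\ forall c, tag c = s -> edat (c, true) p = 0]%classic.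

Lemma mulmp_linmap (l : {mpoly R[2]}) : linmap (fun g => l * g : {mpoly R[2]}).
Proof. by move=> a u v; rewrite mulrDr scalerAr. Qed.

Lemma lv_neq0 x : lv x != 0.
Proof.
apply/eqP => h; have := bloc_lv x; rewrite h rmorph0 => /eqP.
by rewrite eq_sym polyX_eq0.
Qed.

Lemma coef_dim x n (A : {set 'I_n * 'I_n}) (D : set {mpoly R[2]}) : subspace D ->
  (forall g, D g <-> forall i j, (bloc x g)`_j`_i != 0 ->
     exists2 p, p \in A & i = p.1 /\ j = p.2) -> is_dim D #|A|.
Proof.
move=> sD DP.
pose lam (p : 'I_n * 'I_n) (g : {mpoly R[2]}) : R := ((bloc x g)`_(p.2))`_(p.1).
apply: (is_dim_coord (lam := lam)) => //; rewrite /lam.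
- by move=> p a u v; rewrite blocD blocZ !(coefD, coefCM).
- move=> g Dg g0; apply: (can_inj (@blocK _ _ x)); rewrite rmorph0.
  apply/polyP => j; apply/polyP => i; rewrite !coef0; apply/eqP; apply: contraT => n0.
  by have [p pA [ei ej]] := (DP g).1 Dg i j n0; rewrite ei ej g0 // eqxx in n0.
move=> v; pose P : {poly {poly R}} := \poly_(j < n) \poly_(i < n)
  (if [pick p in A | (val p.1 == i) && (val p.2 == j)] is Some p then v p else 0).
have PE i j : P`_j`_i = if [pick p in A | (val p.1 == i) && (val p.2 == j)] is Some p
    then v p else 0.
  rewrite coef_poly; case: pickP => [p /and3P[pA /eqP <- /eqP <-]|h].
    rewrite ltn_ord coef_poly ltn_ord; case: pickP => [q /and3P[qA e1 e2]|/(_ p)].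
      by congr v; case: p q {pA qA} e1 e2 => [? ?] [? ?] /= /eqP e1 /eqP e2;
        congr (_, _); apply: val_inj.
    by rewrite pA !eqxx.
  case: ifP => _; last by rewrite coef0.
  by rewrite coef_poly; case: pickP => [q|_]; rewrite ?h ?if_same.
exists (glob x P).
  apply/DP => i j; rewrite globK PE; case: pickP => [p /and3P[pA /eqP <- /eqP <-] _|_].
    by exists p.
  by rewrite eqxx.
move=> p pA; rewrite globK PE; case: pickP => [q /and3P[_ e1 e2]|/(_ p)].
  by congr v; case: p q {pA} e1 e2 => [? ?] [? ?] /= /eqP e1 /eqP e2;
    congr (_, _); apply: val_inj.
by rewrite pA !eqxx.
Qed.

Lemma tdeg_dim x n : is_dim [set g | tdeg n (bloc x g)]%classic 'C(n.+1, 2).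
Proof.
rewrite -card_triangle; apply: (@coef_dim x).
  split; first by rewrite /= rmorph0; apply: tdeg0.
  by move=> a u v /= hu hv; rewrite blocD blocZ; apply: tdegD => //; apply: tdegZ.
move=> g; split=> [h i j n0|h i j ij].
  have ij : (i + j < n)%N by rewrite ltnNge; apply: contra n0 => ij; rewrite h.
  have hi : (i < n)%N by move: ij; clear; lia.
  have hj : (j < n)%N by move: ij; clear; lia.
  by exists (Ordinal hi, Ordinal hj); rewrite ?inE.
apply/eqP; apply: contraT => /h[p]; rewrite inE => hp [ei ej].
by rewrite ltnNge -ei -ej ij in hp.
Qed.

Lemma bdeg_dim x n : is_dim [set g | bdeg n n (bloc x g)]%classic (n * n)%N.
Proof.
have -> : (n * n = #|[set: 'I_n * 'I_n]|)%N by rewrite cardsT card_prod !card_ord.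
apply: (@coef_dim x).
  split; first by rewrite /= rmorph0 => i j _; rewrite !coef0.
  move=> a u v /= hu hv i j ij; rewrite blocD blocZ !(coefD, coefCM).
  by rewrite hu // hv // mulr0 addr0.
move=> g; split=> [h i j n0|h i j ij].
  have : ~~ ((n <= i)%N || (n <= j)%N) by apply: contra n0 => ij; rewrite h.
  rewrite negb_or -!ltnNge => /andP[hi hj].
  by exists (Ordinal hi, Ordinal hj).
apply/eqP; apply: contraT => /h[p _ [ei ej]].
by case/orP: ij; rewrite leqNgt ?ei ?ej ltn_ord.
Qed.

Lemma bloc_eq0 x p : tdeg 0 (bloc x p) \/ bdeg 0 0 (bloc x p) -> p = 0.
Proof.
move=> h; apply: (can_inj (@blocK _ _ x)); rewrite rmorph0.
by apply/polyP => j; apply/polyP => i; rewrite !coef0; case: h; apply.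
Qed.

Lemma tri_inner k c : is_tri (tag c) -> (4 <= k)%N ->
  is_dim (inner k (tag c)) 'C((k - 5).+1, 2).
Proof.
move=> tc hk; pose x : flag M := (c, true).
have F1 : FD x = 1%N by rewrite /FD /fface tc.
have RE p : Rk k (tag c) p <-> tdeg k.+1 (bloc x p).
  by have := RkP x k p; rewrite /ldeg /fface /= tc.
have tdeg_rot y n p : tdeg n (bloc x p) <-> tdeg n (bloc y p).
  by split=> h; apply: bloc_tdeg; [rewrite -(blocK x p)|rewrite -(blocK y p)]; apply: msize_glob h.
pose L := lv x ^+ 2 * (lv (rot x) ^+ 2 * lv (rot (rot x)) ^+ 2).
have L0 : L != 0 by rewrite !mulf_neq0 ?expf_neq0 ?lv_neq0.
apply: eq_is_dim (is_dim_image (mulmp_linmap L) _ (tdeg_dim x (k - 5))); last first.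
  by move=> g /eqP; rewrite mulf_eq0 (negPf L0) => /eqP.
move=> p; split=> [[g hg <-]|[/RE hp e0p]].
  split; last first.
    move=> c' e; apply: edat_mull; have [->|nc] := eqVneq c' c.
      exact/edat_mull/edat_lv.
    have [->|[]|->] := other_edge e nc; last 1 first.
    - by rewrite -next_next_tri // -!rotE -/x; apply/edat_mulr/edat_mulr/edat_lv.
    - exact/edat_mulr/edat_mull/edat_lv.
    by rewrite -/x F1.
  apply/RE; have [k5|k5] := leqP k 4.
    have -> : g = 0; first by apply: (@bloc_eq0 x); left; move: hg; rewrite /= (_ : (k - 5 = 0)%N) //; move: k5; clear; lia.
    by rewrite mulr0 rmorph0; apply: tdeg0.
  apply: bloc_tdeg.
  have lb y : (msize (lv y ^+ 2) <= 3)%N by apply: (@msizeX_bound _ 1 2); have [] := msize_luv y.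
  case E : (k - 5)%N hg => [|n] hg; first by rewrite (@bloc_eq0 x g) ?mulr0 ?msize0 //; left.
  have {}hg : (msize g <= n.+1)%N by rewrite -[g](blocK x); apply: msize_glob hg.
  have -> : k.+1 = (2 + (2 + 2) + n).+1 by move: E hk; clear; lia.
  by do ?apply: msizeM_bound.
have e0x : edat x p = 0 by apply: e0p.
have e0r : edat (rot x) p = 0 by rewrite rotE; apply: e0p.
have e0rr : edat (rot (rot x)) p = 0 by rewrite !rotE; apply: e0p.
have [g1 [pg1 t1 _]] := double_edge e0x; rewrite pg1 in e0r e0rr.
have [g2 [pg2 t2 _]] := double_edge (edat_cancel (coef0_rot x) e0r).
have := edat_cancel (coef0_rot2 x) e0rr; rewrite pg2 => /(edat_cancel (coef0_rot (rot x))) e3.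
have [g3 [pg3 t3 _]] := double_edge e3.
exists g3; last by rewrite pg1 pg2 pg3 /L; ring.
have := t1 _ hp => /(tdeg_rot (rot x)) /t2 h2.
have /(tdeg_rot x) {}h2 := (tdeg_rot (rot x) _ _).2 h2.
have := (tdeg_rot (rot (rot x)) _ _).1 h2 => /t3 h3.
have := (tdeg_rot (rot (rot x)) _ _).2 h3.
by rewrite /= -!subnDA.
Qed.

Lemma bdeg_unrot x a b p : FD x = 0%N -> bdeg a b (bloc (rot x) p) -> bdeg b a (bloc x p).
Proof. by move=> F0 h; rewrite bloc_rot F0; apply/bdeg_flip/bdeg_swap. Qed.

Lemma rect_inner k c : ~~ is_tri (tag c) -> (3 <= k)%N ->
  is_dim (inner k (tag c)) ((k - 3) * (k - 3)).
Proof.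
move=> tc hk; pose x : flag M := (c, true).
have F0 y : fface y = tag c -> FD y = 0%N by rewrite /FD => ->; rewrite (negPf tc).
have F1 : FD x = 0%N by apply: F0.
have F2 : FD (rot x) = 0%N by rewrite FD_rot.
have F3 : FD (rot (rot x)) = 0%N by rewrite FD_rot.
have RE p : Rk k (tag c) p <-> bdeg k.+1 k.+1 (bloc x p).
  by have := RkP x k p; rewrite /ldeg /fface /= (negPf tc).
pose L := lv x ^+ 2 * (lv (rot x) ^+ 2 * (lv (rot (rot x)) ^+ 2 * lv (rot (rot (rot x))) ^+ 2)).
have L0 : L != 0 by rewrite !mulf_neq0 ?expf_neq0 ?lv_neq0.
apply: eq_is_dim (is_dim_image (mulmp_linmap L) _ (bdeg_dim x (k - 3))); last first.
  by move=> g /eqP; rewrite mulf_eq0 (negPf L0) => /eqP.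
move=> p; split=> [[g hg <-]|[/RE hp e0p]].
  split; last first.
    move=> c' e; apply: edat_mull; have [->|nc] := eqVneq c' c.
      exact/edat_mull/edat_lv.
    have [->|[_ ->]|->] := other_edge e nc.
    - exact/edat_mulr/edat_mull/edat_lv.
    - exact/edat_mulr/edat_mulr/edat_mull/edat_lv.
    rewrite -next_next_next_rect // -!rotE -/x.
    exact/edat_mulr/edat_mulr/edat_mulr/edat_lv.
  apply/RE; case E : (k - 3)%N hg => [|n] hg.
    by rewrite (@bloc_eq0 x g) ?mulr0 ?rmorph0; [move=> i j _; rewrite !coef0|right].
  have lb y : bdeg 1 3 (bloc y (lv y ^+ 2)).
    rewrite rmorphXn /= bloc_lv => i j ij; rewrite coefXn.
    by move: ij; case: eqP => [->|_]; rewrite ?coef0 // orbF coef1; case: i.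
  have b2 := bdeg_unrot F1 (lb (rot x)).
  have b3 := bdeg_unrot F1 (bdeg_unrot F2 (lb (rot (rot x)))).
  have b4 := bdeg_unrot F1 (bdeg_unrot F2 (bdeg_unrot F3 (lb (rot (rot (rot x)))))).
  have bL : bdeg 5 5 (bloc x L).
    have := @bdegM _ 0 2 2 0 _ _ b3 b4; rewrite -blocM => /(@bdegM _ 2 0 2 2 _ _ b2).
    by rewrite -blocM => /(@bdegM _ 0 2 4 2 _ _ (lb x)); rewrite -blocM.
  have -> : k.+1 = (4 + n).+1 by move: E hk; clear; lia.
  by rewrite blocM; apply: bdegM bL hg.
have e0x : edat x p = 0 by apply: e0p.
have e1x : edat (rot x) p = 0 by rewrite rotE; apply: e0p.
have e2x : edat (rot (rot x)) p = 0 by rewrite !rotE; apply: e0p.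
have e3x : edat (rot (rot (rot x))) p = 0 by rewrite !rotE; apply: e0p.
have [g1 [pg1 _ t1]] := double_edge e0x; rewrite pg1 in e1x e2x e3x.
have [g2 [pg2 _ t2]] := double_edge (edat_cancel (coef0_rot x) e1x).
have := edat_cancel (coef0_rot2 x) e2x; rewrite pg2 => /(edat_cancel (coef0_rot (rot x))) e2.
have [g3 [pg3 _ t3]] := double_edge e2.
have := edat_cancel (coef0_rot3 F1) e3x; rewrite pg2 => /(edat_cancel (coef0_rot2 (rot x))).
rewrite pg3 => /(edat_cancel (coef0_rot (rot (rot x)))) e3.
have [g4 [pg4 _ t4]] := double_edge e3.
exists g4; last by rewrite pg1 pg2 pg3 pg4 /L; ring.
have h1 := t2 _ _ (bdeg_rot F1 (t1 _ _ hp)).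
have h2 := t4 _ _ (bdeg_rot F3 (t3 _ _ (bdeg_rot F2 h1))).
have e4 : fface (rot (rot (rot x))) = fface x by rewrite !fface_rot.
apply: (bdeg_bloc e4); first by rewrite e4.
by move: h2; rewrite -!subnDA !subSS.
Qed.

End Bubbles.

(** * Syzygies and separability *)

Notation etriple R := ({poly R} * {poly R} * {poly R})%type.

Section GluedEdges.
Variables (R : realType) (M : surface R) (G : gluing M).
Implicit Types (x y : flag M) (h A B C : {poly R}).

Lemma zero01 : 0 <= (0 : R) <= 1. Proof. by rewrite lexx ler01. Qed.

Lemma unit01 (t : R) : 0 <= t <= 1 -> 0 <= 1 - t <= 1.
Proof. by case/andP=> t0 t1; rewrite subr_ge0 t1 lerBlDr lerDl t0. Qed.

Lemma dc_neq0 x y t : mate x = Some y -> 0 <= t <= 1 -> (dc G x).[t] != 0.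
Proof. by move=> xy t01; have [] := gluing_nonzero G xy t01. Qed.

Lemma nb_neq0 x y t : mate x = Some y -> 0 <= t <= 1 -> (nb G x).[t] != 0.
Proof. by move=> xy t01; have [] := gluing_nonzero G xy t01. Qed.

Lemma gb_neq0 x y t : mate x = Some y -> 0 <= t <= 1 -> gb G x t != 0.
Proof. by move=> xy t01; rewrite mulf_neq0 ?invr_eq0 ?(dc_neq0 xy) ?(nb_neq0 xy). Qed.

Definition syz x A B C := na G x * A + nb G x * B = dc G x * C.

Lemma syzP x y A B C : mate x = Some y -> syz x A B C <->
  forall t, 0 <= t <= 1 -> C.[t] = gb G x t * B.[t] + ga G x t * A.[t].
Proof.
move=> xy; split=> [h t t01|h].
  have c0 := dc_neq0 xy t01; apply: (mulfI c0).
  by rewrite -hornerM -h !hornerE /ga /gb /rval; field.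
apply: poly_eq_on01 => t t01; have c0 := dc_neq0 xy t01.
by rewrite !hornerE h // /ga /gb /rval; field.
Qed.

Lemma G1_syz x y p1 p2 : mate x = Some y -> G1 G x y p1 p2 <->
  e0 x p1 = e0 y p2 /\ syz x (e0 x p1)^`() (e1 y p2) (e1 x p1).
Proof. by move=> xy; rewrite G1P //; split=> -[h1 h2]; split=> //; move: h2; rewrite /syz h1. Qed.

Lemma syz_mate x y A B C : mate x = Some y -> syz x A B C -> syz y A C B.
Proof.
move=> xy /(syzP _ _ _ xy) h; apply/(syzP _ _ _ (mate_sym xy)) => t t01.
have [a b] := gluing_mate G xy t01; have b0 := gb_neq0 xy t01.
by rewrite h // /ga /gb a b -/(ga G x t) -/(gb G x t); field.
Qed.

Lemma syz_far x y h B C : mate x = Some y -> syz x h^`() B C ->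
  syz (far x) (flip (FD x) (h, C)).1^`() (flip (FD y) (h, B)).2 (flip (FD x) (h, C)).2.
Proof.
move=> xy /(syzP _ _ _ xy) H; apply/(syzP _ _ _ (mate_far xy)) => t t01.
have [a b] := gluing_far G xy t01; have := H _ (unit01 t01).
rewrite /flip /= deriv_comp_1subX hornerN !horner_1subX !hornerD !hornerN !hornerMn.
rewrite /ga /gb a b -/(ga G x (1 - t)) -/(gb G x (1 - t)) => ->.
by move: (ga G x _) (gb G x _) => a0 b0; ring.
Qed.

Lemma syz_deriv x y A B C : mate x = Some y -> syz x A B C ->
  C^`().[0] = gb' G x 0 * B.[0] + gb G x 0 * B^`().[0] + ga' G x 0 * A.[0] + ga G x 0 * A^`().[0].
Proof.
move=> xy H; have c0 := dc_neq0 xy zero01.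
have H0 := congr1 (fun p => p.[0]) H; have := congr1 (fun p => p^`().[0]) H.
move: H0; rewrite /= !derivD !derivM !(hornerD, hornerM) => H0 H1.
rewrite /gb' /ga' /ga /gb /rval /rderiv; apply: (mulfI c0); apply: (mulfI c0).
transitivity ((dc G x).[0] * (((dc G x)^`()).[0] * C.[0] + (dc G x).[0] * C^`().[0]) -
   ((dc G x)^`()).[0] * ((dc G x).[0] * C.[0])); first by ring.
by rewrite -H1 -H0; field.
Qed.

(* The first-order part of the gluing condition at the corner of x, and, for a
   crossing edge, what it imposes on the mixed derivatives. *)
Definition corner_glue x (d1 d2 : jet R) : Prop :=
  let: (v1, s1, c1, w1) := d1 in let: (v2, s2, c2, w2) := d2 in
  [/\ v1 = v2, s1 = s2, c1 = gb G x 0 * c2 + ga G x 0 * s2 &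
      ga G x 0 = 0 -> w1 = gb' G x 0 * c2 + gb G x 0 * w2 + ga' G x 0 * s2].

Lemma syz_corner_glue x y h B C : mate x = Some y -> syz x h^`() B C ->
  corner_glue x (tay h C) (tay h B).
Proof.
move=> xy H; split=> //; first by move/(syzP _ _ _ xy): H => ->; rewrite ?zero01.
by move=> a0; rewrite (syz_deriv xy H) a0 mul0r addr0.
Qed.

Lemma ga_mate0 x y : mate x = Some y -> (ga G y 0 == 0) = (ga G x 0 == 0).
Proof.
move=> xy; have [a _] := gluing_mate G xy zero01; rewrite /ga a mulf_eq0 oppr_eq0.
by rewrite invr_eq0 (negPf (gb_neq0 xy zero01)) orbF.
Qed.

Lemma crossing_mate x y : mate x = Some y -> crossing G y = crossing G x.
Proof. by move=> xy; rewrite /crossing xy (mate_sym xy) (ga_mate0 xy). Qed.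

Lemma gderiv_mate x y : mate x = Some y -> ga G x 0 = 0 ->
  gb' G y 0 = - gb' G x 0 / gb G x 0 ^+ 2 /\ ga' G y 0 = - ga' G x 0 / gb G x 0.
Proof.
move=> xy a0; have c0 := dc_neq0 xy zero01; have b0 := nb_neq0 xy zero01.
have c1 := dc_neq0 (mate_sym xy) zero01.
have [P1 P2] : na G y * nb G x = - (na G x * dc G y) /\ nb G y * nb G x = dc G x * dc G y.
  split; apply: poly_eq_on01 => t t01; have := gluing_mate G xy t01;
  have c := dc_neq0 xy t01; have b := nb_neq0 xy t01; have d := dc_neq0 (mate_sym xy) t01;
  rewrite /rval !hornerE => -[ea eb]; apply: (mulIf (invr_neq0 d)).
    by rewrite mulrAC ea; field; rewrite b c d.
  by rewrite mulrAC eb; field; rewrite b c d.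
have n0 : (na G x).[0] = 0.
  by move/eqP: a0; rewrite /ga /rval mulf_eq0 invr_eq0 (negPf c0) orbF => /eqP.
have := congr1 (fun p => p.[0]) P2; have := congr1 (fun p => p^`().[0]) P2.
have := congr1 (fun p => p.[0]) P1; have := congr1 (fun p => p^`().[0]) P1.
rewrite /= !derivN !derivM !(hornerN, hornerD, hornerM) n0.
rewrite /gb' /ga' /gb /rval /rderiv n0 => e1 e2 e3 e4.
have ny : (na G y).[0] = 0.
  by move/eqP: e2; rewrite mul0r oppr0 mulf_eq0 (negPf b0) orbF => /eqP.
have mb : (nb G y).[0] = (dc G x).[0] * (dc G y).[0] / (nb G x).[0] by rewrite -e4 mulfK.
have mb' : (nb G y)^`().[0] = ((dc G x)^`().[0] * (dc G y).[0] + (dc G x).[0] * (dc G y)^`().[0]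
    - (nb G y).[0] * (nb G x)^`().[0]) / (nb G x).[0].
  by rewrite -e3 addrK mulfK.
have nay' : (na G y)^`().[0] = - ((na G x)^`().[0] * (dc G y).[0]) / (nb G x).[0].
  by move: e1; rewrite ny !mul0r !addr0 => <-; rewrite mulfK.
by rewrite ny mb' nay' mb; split; field; rewrite ?b0 ?c0 ?c1.
Qed.

Lemma corner_glue_mate x y d1 d2 : mate x = Some y -> corner_glue x d1 d2 -> corner_glue y d2 d1.
Proof.
case: d1 d2 => -[[v1 s1] c1] w1 [[[v2 s2] c2] w2] xy [-> -> e1 e2].
have b0 := gb_neq0 xy zero01; have [a b] := gluing_mate G xy zero01.
split=> //.
  by rewrite e1 /ga /gb a b -/(ga G x 0) -/(gb G x 0); field.
move/eqP; rewrite (ga_mate0 xy) => /eqP a0; have [-> ->] := gderiv_mate xy a0.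
rewrite e2 // e1 a0 /gb b -/(gb G x 0); field; exact: b0.
Qed.

Lemma edge_splinesP x y k p1 p2 : mate x = Some y ->
  edge_splines G x y k (p1, p2) <-> [/\ Rk k (fface x) p1, Rk k (fface y) p2 &
    e0 x p1 = e0 y p2 /\ syz x (e0 x p1)^`() (e1 y p2) (e1 x p1)].
Proof. by move=> xy; split=> -[h1 h2 h3]; split=> //; apply/(G1_syz _ _ xy). Qed.

Definition espace x y k : set (etriple R) := [set z : etriple R | [/\ (size z.1.1 <= k.+1)%N,
  (size z.1.2 <= k.+1 - FD y)%N, (size z.2 <= k.+1 - FD x)%N & syz x z.1.1^`() z.1.2 z.2]]%classic.

Definition eflip x y (z : etriple R) : etriple R :=
  ((flip (FD x) (z.1.1, z.2)).1, (flip (FD y) (z.1.1, z.1.2)).2, (flip (FD x) (z.1.1, z.2)).2).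

Definition etay (z : etriple R) := (tay z.1.1 z.2, tay z.1.1 z.1.2).

Lemma eflipK x y z : eflip x y (eflip x y z) = z.
Proof.
case: z => -[h B] C; have := flipK (FD x) (h, C); have := flipK (FD y) (h, B).
by rewrite /eflip /flip /= => -[_ ->] [-> ->].
Qed.

Lemma size_lin (a : R) n (p q : {poly R}) : (size p <= n)%N -> (size q <= n)%N ->
  (size (a *: p + q)%R <= n)%N.
Proof.
move=> sp sq; apply: leq_trans (size_polyD _ _) _; rewrite geq_max sq andbT.
exact: leq_trans (size_scale_leq _ _) sp.
Qed.

Lemma size_comp_1subX (p : {poly R}) : size (p \Po (1 - 'X)) = size p.
Proof. by rewrite size_comp_poly2 // size_1subX. Qed.

Lemma size_deriv_le h n : (size h <= n.+1)%N -> (size h^`() <= n)%N.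
Proof.
have [->|h0] := eqVneq h 0; first by rewrite deriv0 size_poly0.
by move=> sh; rewrite -ltnS; apply: leq_trans sh; apply: lt_size_deriv.
Qed.

Lemma size_flip F k h C : (F <= 1)%N -> (size h <= k.+1)%N -> (size C <= k.+1 - F)%N ->
  (size (flip F (h, C)).1 <= k.+1)%N /\ (size (flip F (h, C)).2 <= k.+1 - F)%N.
Proof.
move=> F1 sh sC; rewrite /flip /= !size_comp_1subX; split=> //.
apply: leq_trans (size_polyD _ _) _; rewrite size_polyN geq_max sC /=.
case: F F1 sC => [|[|//]] _ _; first by rewrite mulr0n size_poly0.
by rewrite mulr1n subn1; apply: size_deriv_le.
Qed.

Lemma espace_far x y k z : mate x = Some y -> espace x y k z ->
  espace (far x) (far y) k (eflip x y z).
Proof.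
move=> xy [sh sB sC H]; rewrite /espace /= !FD_far.
have [h1 C1] := size_flip (FD_le1 x) sh sC; have [_ B1] := size_flip (FD_le1 y) sh sB.
by split=> //; apply: syz_far.
Qed.

Lemma eflip_far x y z : eflip (far x) (far y) z = eflip x y z.
Proof. by rewrite /eflip !FD_far. Qed.

Lemma espace_unfar x y k z : mate x = Some y -> espace (far x) (far y) k z ->
  espace x y k (eflip x y z).
Proof.
move=> xy hz; rewrite -eflip_far -{1}[x]farK -{1}[y]farK.
by apply: espace_far hz; apply: mate_far.
Qed.

Lemma espace_subspace x y k : subspace (espace x y k).
Proof.
split; first by rewrite /espace /syz /= !size_poly0 deriv0 !mulr0 addr0.
move=> a [[h1 B1] C1] [[h2 B2] C2] [/= s1 s2 s3 s4] [/= t1 t2 t3 t4].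
split; rewrite /= ?size_lin //; move: s4 t4; rewrite /syz derivD derivZ => s4 t4.
rewrite !mulrDr -!scalerAr -s4 -t4; rewrite scalerDr -!addrA; congr (_ + _).
by rewrite addrCA.
Qed.

Lemma edge_splines_etriple x y k p1 p2 : mate x = Some y -> edge_splines G x y k (p1, p2) ->
  e0 x p1 = e0 y p2 /\ espace x y k (e0 x p1, e1 y p2, e1 x p1).
Proof.
move=> xy /(edge_splinesP _ _ _ xy)[h1 h2 [h3 h4]]; split=> //; split=> //=.
- exact: size_e0.
- exact: size_e1.
- exact: size_e1.
Qed.

Lemma etriple_edge_splines x y k z : mate x = Some y -> (0 < k)%N -> espace x y k z ->
  exists p1 p2, [/\ edge_splines G x y k (p1, p2), e0 x p1 = z.1.1, e0 y p2 = z.1.1,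
    e1 x p1 = z.2 & e1 y p2 = z.1.2].
Proof.
case: z => -[h B] C /= xy k0 [/= sh sB sC H].
have [p1 [R1 a1 b1]] := edge_extension k0 sh sC.
have [p2 [R2 a2 b2]] := edge_extension k0 sh sB.
exists p1, p2; split=> //; apply/(edge_splinesP _ _ _ xy).
by rewrite a1 a2 b1 b2.
Qed.

Lemma perm4K : involutive (@perm4 R).
Proof. by case=> -[[v a] b] w. Qed.

Lemma perm4_pair_inj (u v : jet R * jet R) :
  (u.1, perm4 u.2) = (v.1, perm4 v.2) -> u = v.
Proof.
move=> e; have := congr1 fst e; have := congr1 snd e => /= /(inv_inj perm4K).
by case: u v {e} => [? ?] [? ?] /= -> ->.
Qed.

Lemma taylor_swapE y p : taylor (swap y) p = perm4 (tay2 (edat y p)).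
Proof. by rewrite taylorE -tay_swap. Qed.

Lemma taylor2E x y p1 p2 : e0 x p1 = e0 y p2 -> taylor2 x y (p1, p2) =
  ((etay (e0 x p1, e1 y p2, e1 x p1)).1, perm4 (etay (e0 x p1, e1 y p2, e1 x p1)).2).
Proof. by move=> e; rewrite /taylor2 taylorE taylor_swapE /etay /tay2 /= -e. Qed.

Lemma taylor2_farE x y p1 p2 : e0 x p1 = e0 y p2 -> taylor2 (far x) (far y) (p1, p2) =
  ((etay (eflip x y (e0 x p1, e1 y p2, e1 x p1))).1,
   perm4 (etay (eflip x y (e0 x p1, e1 y p2, e1 x p1))).2).
Proof.
move=> e; rewrite taylor2E; last by rewrite !e0_far e.
by rewrite /etay /eflip /= !e0_far !e1_far e.
Qed.

Lemma separated_pairs x y k p1 p2 q1 q2 : mate x = Some y -> separated G x y k ->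
  edge_splines G x y k (p1, p2) -> edge_splines G x y k (q1, q2) ->
  exists2 z, espace x y k z &
    etay z = etay (e0 x p1, e1 y p2, e1 x p1) /\
    etay (eflip x y z) = etay (eflip x y (e0 x q1, e1 y q2, e1 x q1)).
Proof.
move=> xy sep hp hq.
have [ep _] := edge_splines_etriple xy hp; have [eq _] := edge_splines_etriple xy hq.
move: sep; rewrite /separated => /seteqP[_ sep].
have [|[r1 r2] hr e12] := sep (taylor2 x y (p1, p2), taylor2 (far x) (far y) (q1, q2)).
  by split; [exists (p1, p2)|exists (q1, q2)].
have [er er'] := edge_splines_etriple xy hr.
exists (e0 x r1, e1 y r2, e1 x r1); first exact: er'.
have /pair_equal_spec[] : (taylor2 x y (r1, r2), taylor2 (far x) (far y) (r1, r2)) =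
  (taylor2 x y (p1, p2), taylor2 (far x) (far y) (q1, q2)) by exact: e12.
rewrite (taylor2E er) (taylor2E ep) (taylor2_farE er) (taylor2_farE eq).
by move=> /perm4_pair_inj e1' /perm4_pair_inj e2'; split.
Qed.

Lemma separatedP x y k : mate x = Some y -> (0 < k)%N -> separated G x y k <->
  forall z1 z2, espace x y k z1 -> espace x y k z2 -> exists2 z, espace x y k z &
    etay z = etay z1 /\ etay (eflip x y z) = etay (eflip x y z2).
Proof.
move=> xy k0; split=> [sep z1 z2 h1 h2|sep].
  have [p1 [p2 [hp a1 a2 a3 a4]]] := etriple_edge_splines xy k0 h1.
  have [q1 [q2 [hq b1 b2 b3 b4]]] := etriple_edge_splines xy k0 h2.
  have [z hz] := separated_pairs xy sep hp hq; rewrite a1 a3 a4 b1 b3 b4 => e.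
  by exists z; [exact: hz|case: z1 z2 {h1 h2 a1 a2 a3 a4 b1 b2 b3 b4} e hz => [[? ?] ?] [[? ?] ?]].
apply/seteqP; split=> [t [f hf <-]|[t1 t2] [[[p1 p2] hp /= <-] [[q1 q2] hq /= <-]]].
  by split; exists f.
have [ep hp'] := edge_splines_etriple xy hp; have [eq hq'] := edge_splines_etriple xy hq.
have [z hz [e1' e2']] := sep _ _ hp' hq'.
have [r1 [r2 [hr a1 a2 a3 a4]]] := etriple_edge_splines xy k0 hz.
have [er _] := edge_splines_etriple xy hr.
exists (r1, r2); first exact: hr.
rewrite (taylor2E er) (taylor2_farE er) (taylor2E ep) (taylor2_farE eq).
by rewrite a1 a3 a4 -e1' -e2'; case: z {hz e1' e2' a1 a2 a3 a4} => [[? ?] ?].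
Qed.

End GluedEdges.

Section Primitives.
Variable R : realType.
Implicit Types (p q u h c : {poly R}).

Lemma primitive p n (v : R) : (size p <= n)%N ->
  exists h, [/\ (size h <= n.+1)%N, h^`() = p & h.[0] = v].
Proof.
move=> sp; exists (\poly_(i < n.+1) (if i == 0%N then v else p`_i.-1 / i%:R)).
split; first exact: size_poly.
  apply/polyP => i; rewrite coef_deriv coef_poly ltnS /=.
  have [hi|hi] := ltnP i n; last by rewrite mul0rn (leq_sizeP _ _ sp).
  by rewrite -[LHS]mulr_natr divfK // pnatr_eq0.
by rewrite horner_coef0 coef_poly.
Qed.

Lemma hermite (a b c d : R) : exists p,
  [/\ (size p <= 4)%N, p.[0] = a, p^`().[0] = b, p.[1] = c & p^`().[1] = d].
Proof.
pose e := (c - a) *+ 3 - b *+ 2 - d; pose f := (a - c) *+ 2 + b + d.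
exists (a%:P + b *: 'X + e *: 'X ^+ 2 + f *: 'X ^+ 3).
rewrite !derivD !derivZ derivC derivX !derivXn !hornerE /= /e /f.
split; try by ring.
apply/leq_sizeP => i hi; rewrite !coefD !coefZ coefC coefX !coefXn.
by case: i hi => [|[|[|[|i]]]] //= _; rewrite !mulr0 !addr0.
Qed.

(* With m = X^3 c^2 / c(1)^2, the polynomial 1 - (1 - m)^3 goes from 0 to 1 and
   its derivative is a multiple of c with double zeros at both ends. *)
Lemma step_poly c : c.[1] != 0 -> exists h u, [/\ h^`() = c * u, h.[0] = 0, h.[1] = 1 &
  [/\ u.[0] = 0, u^`().[0] = 0, u.[1] = 0 & u^`().[1] = 0]].
Proof.
move=> c1; pose kap := (c.[1] ^+ 2)^-1.
pose m := kap *: ('X * 'X * 'X * (c * c)).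
pose r := kap *: ('X * 'X * (c *+ 3 + 'X * c^`() *+ 2)).
have m0 : m.[0] = 0 by rewrite /m !hornerE /= ?(mul0r, mulr0).
have m1 : m.[1] = 1 by rewrite /m !hornerE /= /kap; field.
have dm : m^`() = c * r.
  rewrite /m /r derivZ !derivM derivX -!scalerAr; congr (_ *: _); ring.
have r0 : r.[0] = 0 by rewrite /r !hornerE /= ?(mul0r, mulr0).
have dr0 : r^`().[0] = 0.
  by rewrite /r derivZ !derivM derivX !hornerE /= ?(mul0r, mulr0, addr0).
clearbody m r; exists (1 - (1 - m) * (1 - m) * (1 - m)), ((1 - m) * (1 - m) * r *+ 3).
split.
- by rewrite derivB !derivM !derivB deriv1 dm; ring.
- by rewrite !hornerE m0 /=; ring.
- by rewrite !hornerE m1 /=; ring.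
rewrite !derivMn !derivM !derivB deriv1.
by split; rewrite !(hornerMn, hornerD, hornerN, hornerM, hornerC) ?m0 ?m1 ?r0 ?dr0; ring.
Qed.

Lemma adjusted_primitive c : c.[0] != 0 -> c.[1] != 0 -> exists N, forall u0 u1 v : R,
  exists u h, [/\ (size u <= N)%N, (size h <= N)%N, h^`() = c * u,
    h.[0] = v /\ h.[1] = 0 & [/\ u.[0] = u0, u^`().[0] = u1, u.[1] = 0 & u^`().[1] = 0]].
Proof.
move=> c0 c1; have [hs [us [dhs hs0 hs1 [us0 dus0 us1 dus1]]]] := step_poly c1.
exists (5 + size us + size hs + size (c)%R)%N => u0 u1 v.
have [u [su u_0 du0 u_1 du1]] := hermite u0 u1 0 0.
have [|h [sh dh h0]] := @primitive (c * u) (size (c)%R + 4) v.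
  apply: leq_trans (size_polyMleq _ _) _; move: su; clear; lia.
exists (u - h.[1] *: us), (h - h.[1] *: hs); split.
- apply: leq_trans (size_polyD _ _) _; rewrite size_polyN geq_max.
  apply/andP; split; first by move: su; clear; lia.
  by apply: leq_trans (size_scale_leq _ _) _; rewrite -!addnA addnCA leq_addr.
- apply: leq_trans (size_polyD _ _) _; rewrite size_polyN geq_max.
  apply/andP; split; first by move: sh; clear; lia.
  by apply: leq_trans (size_scale_leq _ _) _; rewrite -!addnA addnCA addnA addnCA leq_addr.
- by rewrite derivB derivZ dh dhs mulrBr scalerAr.
- by rewrite !hornerE h0 hs0 hs1 mulr1 mulr0 subr0 subrr.
rewrite derivB derivZ !hornerE u_0 u_1 du0 du1 us0 us1 dus0 dus1.
by rewrite !mulr0 !subr0.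
Qed.

End Primitives.

Section Separability.
Variables (R : realType) (M : surface R) (G : gluing M).
Implicit Types (x y : flag M) (h A B C : {poly R}) (d : jet R).

Lemma one01 : 0 <= (1 : R) <= 1. Proof. by rewrite ler01 lexx. Qed.

Lemma half_separation x y : mate x = Some y -> exists N, forall k, (N <= k)%N ->
  forall d1 d2, corner_glue G x d1 d2 -> exists2 z, espace G x y k z &
    etay z = (d1, d2) /\ etay (eflip x y z) = (zero4, zero4).
Proof.
move=> xy; have c0 := dc_neq0 G xy (@zero01 R); have c1 := dc_neq0 G xy one01.
have [N1 adj] := adjusted_primitive c0 c1.
set a := na G x; set b := nb G x; set c := dc G x in c0 c1 adj *.
exists (N1 + (size a + N1) + (size b + 4) + (size c + 4) + 1)%N => k hk.
case=> -[[v1 s1] g1] w1 [[[v2 s2] g2] w2] glue.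
have glue' := glue; case: glue' => ev es eg ew; subst v2 s2.
pose u0 := s1 / c.[0]; pose t0 := g2 / c.[0]; pose t1 := (w2 - c^`().[0] * t0) / c.[0].
pose u1 := if a.[0] == 0 then 0
  else (w1 - a^`().[0] * u0 - b^`().[0] * t0 - b.[0] * t1) / a.[0].
have [u [h [su sh dh [h0 h1] [u_0 du0 u_1 du1]]]] := adj u0 u1 v1.
have [t [st t_0 dt0 t_1 dt1]] := hermite t0 t1 0 0.
have H : syz G x (c * u) (c * t) (a * u + b * t) by rewrite /syz -/a -/b -/c; ring.
have szM (p q : {poly R}) n : (size q <= n)%N -> (size (p * q)%R <= size p + n)%N.
  by move=> sq; apply: leq_trans (size_polyMleq _ _) _; apply: leq_trans (leq_pred _) _;
     rewrite leq_add2l.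
exists (h, c * t, a * u + b * t).
  split=> /=.
  - by apply: leq_trans sh _; move: hk; clear; lia.
  - apply: leq_trans (szM _ _ _ st) _; move: hk (FD_le1 y); clear; lia.
  - apply: leq_trans (size_polyD _ _) _; rewrite geq_max.
    apply/andP; split; [apply: leq_trans (szM _ _ _ su) _|apply: leq_trans (szM _ _ _ st) _];
      move: hk (FD_le1 x); clear; lia.
  - by rewrite dh.
rewrite /etay /=; split; last first.
  rewrite !tay_flip dh /= h1.
  rewrite !(derivM, derivD) !(hornerD, hornerM) u_1 du1 t_1 dt1.
  by rewrite !(mulr0, addr0, oppr0, mul0rn, subr0).
have e1 : (c * u).[0] = s1 by rewrite hornerM u_0 /u0 mulrC divfK.
have e2 : (c * t).[0] = g2 by rewrite hornerM t_0 /t0 mulrC divfK.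
have e3 : (c * t)^`().[0] = w2.
  rewrite derivM hornerD !hornerM t_0 dt0 /t1; field; exact: c0.
have e4 : (a * u + b * t).[0] = g1.
  have /(syzP _ _ _ _ xy)/(_ 0 (zero01 _)) -> := H.
  by rewrite e1 e2 eg.
rewrite /tay dh h0 e1 e2 e3 e4; congr (_, _, _, _, _).
have [a0|a0] := eqVneq a.[0] 0.
  have ga0 : ga G x 0 = 0 by rewrite /ga /rval -/a a0 mul0r.
  by rewrite (syz_deriv xy H) ga0 mul0r addr0 e1 e2 e3 ew.
rewrite derivD !derivM !(hornerD, hornerM) u_0 du0 t_0 dt0 /u1 (negPf a0).
by field; exact: a0.
Qed.

Lemma half_separation_far x y : mate x = Some y -> exists N, forall k, (N <= k)%N ->
  forall d1 d2, corner_glue G (far x) d1 d2 -> exists2 z, espace G x y k z &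
    etay (eflip x y z) = (d1, d2) /\ etay z = (zero4, zero4).
Proof.
move=> xy; have [N hN] := half_separation (mate_far xy); exists N => k /hN {}hN d1 d2 /hN[z hz [e1 e2]].
exists (eflip x y z); last by rewrite eflipK -eflip_far.
exact: espace_unfar hz.
Qed.

Lemma espace_corner_glue x y k z : mate x = Some y -> espace G x y k z ->
  corner_glue G x (etay z).1 (etay z).2.
Proof. by move=> xy [_ _ _ H]; apply: (syz_corner_glue xy). Qed.

Lemma tay_lin_eq (r : R) h1 C1 h2 C2 : tay h2 C2 = zero4 ->
  tay (r *: h1 + h2) (r *: C1 + C2) = tay (r *: h1) (r *: C1).
Proof.
by case/tay0P=> e1 e2 e3 e4; rewrite tay_lin e1 e2 e3 e4 !addr0 /tay !derivZ !hornerZ.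
Qed.

Lemma etayD (z1 z2 : etriple R) : etay z2 = (zero4, zero4) -> etay (z1 + z2) = etay z1.
Proof.
case: z1 z2 => [[h1 B1] C1] [[h2 B2] C2]; rewrite /etay /= => /pair_equal_spec[e1 e2].
have := tay_lin_eq 1 h1 C1 e1; have := tay_lin_eq 1 h1 B1 e2.
by rewrite !scale1r => -> ->.
Qed.

Lemma eflip_lin x y : linmap (eflip x y : etriple R -> etriple R).
Proof.
move=> r [[h1 B1] C1] [[h2 B2] C2]; rewrite /eflip /flip /=.
congr (_, _, _); first by rewrite comp_polyD comp_polyZ.
  rewrite /= -comp_polyZ -comp_polyD; congr (_ \Po _).
  by rewrite derivD derivZ -!mul_polyC; ring.
rewrite /= -comp_polyZ -comp_polyD; congr (_ \Po _).
by rewrite derivD derivZ -!mul_polyC; ring.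
Qed.

Lemma separated_large x y : mate x = Some y -> exists N, forall k, (N <= k)%N ->
  (forall d1 d2, corner_glue G x d1 d2 -> exists2 z, espace G x y k z & etay z = (d1, d2)) /\
  separated G x y k.
Proof.
move=> xy; have [N1 h1] := half_separation xy; have [N2 h2] := half_separation_far xy.
exists (maxn 1 (maxn N1 N2)) => k; rewrite !geq_max => /and3P[k0 /h1 {}h1 /h2 {}h2].
split=> [d1 d2 /h1[z hz [e _]]|]; first by exists z.
apply/(separatedP G xy k0) => z1 z2 hz1 hz2.
have [y1 hy1 []] := h1 _ _ (espace_corner_glue xy hz1).
rewrite -surjective_pairing => e1 e1'.
have [y2 hy2 []] := h2 _ _ (espace_corner_glue (mate_far xy) (espace_far xy hz2)).
rewrite -surjective_pairing => e2 e2'.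
exists (y1 + y2); first exact: subspaceD (espace_subspace G x y k) hy1 hy2.
rewrite etayD // e1; split=> //.
by rewrite (linmapD _ _ (eflip_lin x y)) addrC etayD // e2.
Qed.

Lemma separabilityP x y k : mate x = Some y -> (separability G x <= k)%N -> separated_from G x y k.
Proof.
move=> xy; rewrite /separability xy; have [N hN] := separated_large xy.
have ex : exists n, `[< separated_from G x y n >].
  by exists N; apply/asboolP => k' /hN[].
case: (ex_minnP ex) => m /asboolP hm minm.
case: xgetP => [n -> [hn _] nk|/(_ m) []]; last first.
  by split=> // j hj; apply: minm; apply/asboolP.
by move=> k' kk'; apply: hn; apply: leq_trans kk'.
Qed.

End Separability.

Section SeparatedEdges.
Variables (R : realType) (M : surface R) (G : gluing M).
Implicit Types (x y : flag M) (h A B C p : {poly R}) (d : jet R).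

Lemma poly_size4 p : (size p <= 4)%N ->
  p = (p`_0)%:P + p`_1 *: 'X + p`_2 *: 'X ^+ 2 + p`_3 *: 'X ^+ 3.
Proof.
move=> /leq_sizeP sp; apply/polyP => i; rewrite !coefD !coefZ coefC coefX !coefXn.
case: i => [|[|[|[|i]]]] /=; rewrite ?mulr0 ?mulr1 ?addr0 ?add0r //.
by rewrite sp.
Qed.

Lemma hermite_cubic p : (size p <= 4)%N -> p.[0] = 1 -> p^`().[0] = 0 -> p.[1] = 0 ->
  p^`().[1] = 0 -> p`_3 != 0 /\ p^`()^`().[1] != 0.
Proof.
move=> /poly_size4 ->; move: p`_0 p`_1 p`_2 p`_3 => a b c d.
rewrite !(derivD, derivZ, derivC, derivX, derivXn, deriv1) !hornerE /= => e1 e2 e3 e4.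
have d2 : d = 2 by lra.
have c3 : c = - 3 by lra.
have -> : (a%:P + b *: 'X + c *: 'X ^+ 2 + d *: 'X ^+ 3)`_3 = d.
  by rewrite !coefD !coefZ coefC coefX !coefXn /= !mulr0 !add0r mulr1.
rewrite d2 c3; split; first by rewrite pnatr_eq0.
by apply/eqP => h; lra.
Qed.

Lemma flat_quadratic p : (size p <= 3)%N -> p.[0] = 0 -> p^`().[0] = 0 -> p.[1] = 0 -> p = 0.
Proof.
move=> sp; have /poly_size4 -> : (size p <= 4)%N by apply: leq_trans sp _.
have -> : p`_3 = 0 by move/leq_sizeP: sp; apply.
move: p`_0 p`_1 p`_2 => a b c.
rewrite !(derivD, derivZ, derivC, derivX, derivXn) !hornerE /= => e1 e2 e3.
have -> : a = 0 by lra. have -> : b = 0 by lra. have -> : c = 0 by lra.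
by rewrite !scale0r !addr0.
Qed.

Lemma Rk1 k (s : face M) : Rk k s 1.
Proof.
have [x <-] := face_flag s; apply/RkP; rewrite rmorph1 /ldeg.
case: ifP => _ i j; rewrite coef1; case: j => [|j]; rewrite ?coef0 // coef1;
by case: i => //; rewrite ?orbF ?orbT.
Qed.

Lemma Rk0 k (s : face M) : Rk k s 0.
Proof. by have [] := Rk_subspace k s. Qed.

(* Separating the spline 1 at one end from the spline 0 at the other forces the
   common trace h to be a Hermite step, of degree at least 3. *)
Lemma separated_ge x y k : mate x = Some y -> separated G x y k ->
  (3 + FD x <= k)%N /\ (3 + FD y <= k)%N.
Proof.
move=> xy sep.
have b1 (z : flag M) : e0 z 1 = 1 /\ e1 z 1 = 0 by rewrite /e0 /e1 rmorph1 !coef1.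
have b0 (z : flag M) : e0 z 0 = 0 /\ e1 z 0 = 0 by rewrite /e0 /e1 rmorph0 !coef0.
have s1 : edge_splines G x y k (1, 1).
  apply/(edge_splinesP _ _ _ _ xy); have [h1 h2] := b1 x; have [h3 h4] := b1 y.
  rewrite h1 h2 h3 h4 /syz deriv1 !mulr0 addr0; split; [exact: Rk1|exact: Rk1|by []].
have s0 : edge_splines G x y k (0, 0).
  apply/(edge_splinesP _ _ _ _ xy); have [h1 h2] := b0 x; have [h3 h4] := b0 y.
  rewrite h1 h2 h3 h4 /syz deriv0 !mulr0 addr0; split; [exact: Rk0|exact: Rk0|by []].
have [[[h B] C] [/= sh sB sC _] []] := separated_pairs xy sep s1 s0.
have [-> ->] := b1 x; have [_ ->] := b1 y; have [-> ->] := b0 x; have [_ ->] := b0 y.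
rewrite /etay /= !tay_flip !deriv0 !horner0 !(mul0rn, subr0, oppr0) => /pair_equal_spec[].
rewrite /tay deriv1 deriv0 !horner0 hornerC => -[h0 dh0 C0 dC0] [_ _ B0 dB0].
case/pair_equal_spec=> -[h1 /eqP]; rewrite oppr_eq0 => /eqP dh1.
rewrite dh1 !mul0rn !subr0 => C1 /eqP; rewrite oppr_eq0 subr_eq0 => /eqP dC1.
case=> _ _ B1 /eqP; rewrite oppr_eq0 subr_eq0 => /eqP dB1.
have k3 : (3 <= k)%N.
  rewrite leqNgt; apply/negP => hk; have sh3 : (size h <= 3)%N by apply: leq_trans sh _.
  have [|+ _] := hermite_cubic _ h0 dh0 h1 dh1; first exact: leq_trans sh3 _.
  by move/leq_sizeP: sh3 => ->; rewrite ?eqxx.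
have side F (E : {poly R}) : (F <= 1)%N -> (size E <= k.+1 - F)%N ->
    E.[0] = 0 -> E^`().[0] = 0 -> E.[1] = 0 -> E^`().[1] = h^`()^`().[1] *+ F -> (3 + F <= k)%N.
  case: F => [|[|//]] _; first by rewrite addn0.
  rewrite addn1 mulr1n => sE E0 dE0 E1 dE1; rewrite ltn_neqAle k3 andbT; apply/eqP => ek.
  move: sh sE; rewrite -ek subn1 /= => sh sE.
  have [_] := hermite_cubic sh h0 dh0 h1 dh1.
  by rewrite -dE1 (flat_quadratic sE) // deriv0 horner0 eqxx.
by split; [apply: (side _ C)|apply: (side _ B)] => //; apply: FD_le1.
Qed.

Definition onto x y k := forall s b : R, exists A B C,
  [/\ (size A <= k)%N, (size B <= k.+1 - FD y)%N, (size C <= k.+1 - FD x)%N &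
    [/\ syz G x A B C, A.[0] = s & B.[0] = b]].

Lemma size_divX1 p n : (size ((1 - 'X) * p)%R <= n)%N -> (size p <= n.-1)%N.
Proof.
have [->|p0] := eqVneq p 0; first by rewrite size_poly0.
have x0 : (1 - 'X : {poly R}) != 0 by rewrite -size_poly_eq0 size_1subX.
by rewrite size_mul // size_1subX; move: (size p) => m; clear; lia.
Qed.

Lemma root1 p : p.[1] = 0 -> exists q, p = (1 - 'X) * q.
Proof.
move=> /eqP /factor_theorem[q ->]; exists (- q); rewrite -polyC1; ring.
Qed.

Lemma onto_large x y : mate x = Some y -> exists N, forall k, (N <= k)%N -> onto x y k.
Proof.
move=> xy; have [N hN] := separated_large G xy; exists N => k /hN[real _] s b.
have [|[[h B] C] [/= sh sB sC H]] := real (0, s, gb G x 0 * b + ga G x 0 * s, gb' G x 0 * b + ga' G x 0 * s) (0, s, b, 0).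
  by split=> // _; rewrite mulr0 addr0.
rewrite /etay /tay /= => /pair_equal_spec[[_ e1 _ _] [_ _ e2 _]].
by exists h^`(), B, C; split=> //; apply: size_deriv_le.
Qed.

(* Replacing the data at the other end by 0 makes the syzygy divisible by 1 - X. *)
Lemma onto_down x y k : mate x = Some y -> separated G x y k -> onto x y k -> onto x y k.-1.
Proof.
move=> xy sep real s b; have [kx ky] := separated_ge xy sep.
have k0 : (0 < k)%N by move: kx; clear; lia.
have [A [B [C [sA sB sC [H e1 e2]]]]] := real s b.
have [h [sh dh _]] := primitive 0 sA.
have hz : espace G x y k (h, B, C) by split; rewrite //= dh.
have [[[h' B'] C'] [/= sh' sB' sC' H'] []] :=
  (separatedP G xy k0).1 sep _ _ hz (espace_subspace G x y k).1.
have -> : eflip x y (0 : etriple R) = 0.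
  exact: linmap0 (eflip_lin x y).
rewrite /etay /= !tay_flip tay00 => /pair_equal_spec[[_ f1 _ _] [_ _ f2 _]].
case/pair_equal_spec=> -[_ /eqP]; rewrite oppr_eq0 => /eqP dh1.
rewrite dh1 !mul0rn !subr0 => C1 _ [_ _ B1 _].
have [A2 eA] := root1 dh1; have [B2 eB] := root1 B1; have [C2 eC] := root1 C1.
exists A2, B2, C2.
split.
- by apply: size_divX1; rewrite -eA size_deriv_le.
- apply: leq_trans (@size_divX1 B2 (k.+1 - FD y) _) _; first by rewrite -eB.
  by move: k0; clear; lia.
- apply: leq_trans (@size_divX1 C2 (k.+1 - FD x) _) _; first by rewrite -eC.
  by move: k0; clear; lia.
have ev (p q : {poly R}) : p = (1 - 'X) * q -> q.[0] = p.[0].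
  by move=> ->; rewrite !hornerE; ring.
split; last 2 first.
- by rewrite (ev _ _ eA) f1 dh e1.
- by rewrite (ev _ _ eB) f2 e2.
have x0 : (1 - 'X : {poly R}) != 0 by rewrite -size_poly_eq0 size_1subX.
by apply: (mulfI x0); move: H'; rewrite /syz eA eB eC => H'; rewrite [RHS]mulrCA -H'; ring.
Qed.

Lemma separated_from_onto x y k : mate x = Some y -> separated_from G x y k -> onto x y k.-1.
Proof.
move=> xy sep; have k0 : (0 < k)%N by have [] := separated_ge xy (sep k (leqnn k)); clear; lia.
have [N hN] := onto_large xy.
have : onto x y (k.-1 + N) by apply: hN; rewrite leq_addl.
elim: N {hN} => [|N IH]; first by rewrite addn0.
rewrite addnS => h; apply: IH; apply: (@onto_down _ _ (k.-1 + N).+1) => //.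
by apply: sep; rewrite -addSn prednK // leq_addr.
Qed.

Lemma corner_realized x y k : mate x = Some y -> separated_from G x y k ->
  forall d1 d2, corner_glue G x d1 d2 -> exists2 z, espace G x y k z & etay z = (d1, d2).
Proof.
move=> xy sep [[[v1 s1] g1] w1] [[[v2 s2] g2] w2] [ev es eg ew]; subst v2 s2.
have k0 : (0 < k)%N by have [] := separated_ge xy (sep k (leqnn k)); clear; lia.
have real := separated_from_onto xy sep.
have [A [B [C [sA sB sC [H eA eB]]]]] := real s1 g2.
have g0 : C.[0] = g1 by have /(syzP _ _ _ _ xy)/(_ 0 (zero01 _)) -> := H; rewrite eA eB.
have sd := syz_deriv xy H.
pose r := if ga G x 0 == 0 then 0 else (w1 - C^`().[0] - gb G x 0 * (w2 - B^`().[0])) / ga G x 0.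
have [A' [B' [C' [sA' sB' sC' [H' eA' eB']]]]] := real r (w2 - B^`().[0]).
have g0' : C'.[0] = gb G x 0 * (w2 - B^`().[0]) + ga G x 0 * r.
  by have /(syzP _ _ _ _ xy)/(_ 0 (zero01 _)) -> := H'; rewrite eA' eB'.
have szX p (q : {poly R}) n : (size p <= n)%N -> (size q <= n)%N -> (size (p + 'X * q)%R <= n.+1)%N.
  move=> sp sq; apply: leq_trans (size_polyD _ _) _; rewrite geq_max (leqW sp) mulrC.
  by apply: leq_trans (size_polyMleq _ _) _; rewrite size_polyX addn2.
have [h [sh dh h0]] : exists h, [/\ (size h <= k.+1)%N, h^`() = A + 'X * A' & h.[0] = v1].
  by apply: primitive; rewrite -(prednK k0) szX.
have szF F p (q : {poly R}) : (F <= 1)%N -> (size p <= k.-1.+1 - F)%N -> (size q <= k.-1.+1 - F)%N ->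
    (size (p + 'X * q)%R <= k.+1 - F)%N.
  move=> F1 sp /(szX _ _ _ sp) spq; apply: leq_trans spq _.
  by move: F1 k0; clear; lia.
have X0 p q : (p + 'X * q).[0] = p.[0] /\ (p + 'X * q)^`().[0] = p^`().[0] + q.[0].
  by rewrite derivD derivM derivX !hornerE /=; split; ring.
exists (h, B + 'X * B', C + 'X * C').
  split=> //=; [exact: szF (FD_le1 y) sB sB'|exact: szF (FD_le1 x) sC sC'|].
  rewrite dh; move: H H'; rewrite /syz => H H'.
  by rewrite !mulrDr -H [dc G x * ('X * C')]mulrCA -H'; ring.
rewrite /etay /tay /= dh h0 !(X0 _ _).1 !(X0 _ _).2 eA eB g0 eB' g0'.
congr (_, _, _, _, (_, _, _, _)); last by rewrite addrC subrK.
rewrite /r; case: eqP => a0; last by move/eqP: a0 => a0; field; exact: a0.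
by rewrite mulr0 addr0 sd a0 ew // eA eB mul0r addr0; ring.
Qed.

End SeparatedEdges.

Section EdgeDimensions.
Variables (R : realType) (M : surface R) (G : gluing M).
Implicit Types (x y : flag M) (h A B C p : {poly R}) (d : jet R) (z : etriple R).

Lemma triple_dim (n1 n2 n3 : nat) : is_dim [set z : etriple R |
  [/\ (size z.1.1 <= n1)%N, (size z.1.2 <= n2)%N & (size z.2 <= n3)%N]]%classic (n1 + n2 + n3).
Proof.
have -> : (n1 + n2 + n3 = #|[set: 'I_n1 + 'I_n2 + 'I_n3]|)%N.
  by rewrite cardsT !card_sum !card_ord.
pose lam (i : 'I_n1 + 'I_n2 + 'I_n3) z : R :=
  match i with inl (inl i) => (z.1.1)`_i | inl (inr i) => (z.1.2)`_i | inr i => (z.2)`_i end.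
apply: (is_dim_coord (lam := lam)).
- by case=> [[i|i]|i] a u v; rewrite /lam /= coefD coefZ.
- split; first by rewrite /= !size_poly0.
  move=> a [[h1 B1] C1] [[h2 B2] C2] [/= s1 s2 s3] [/= t1 t2 t3].
  by split; rewrite size_lin.
- move=> [[h B] C] [/= s1 s2 s3] z0.
  have poly0 n (p : {poly R}) : (size p <= n)%N -> (forall i : 'I_n, p`_i = 0) -> p = 0.
    move=> /leq_sizeP sp p0; apply/polyP => i; rewrite coef0.
    by have [hi|hi] := ltnP i n; [rewrite (p0 (Ordinal hi))|rewrite sp].
  have p1 := poly0 _ _ s1 (fun i => z0 (inl (inl i)) (finset.in_setT _)).
  have p2 := poly0 _ _ s2 (fun i => z0 (inl (inr i)) (finset.in_setT _)).
  have p3 := poly0 _ _ s3 (fun i => z0 (inr i) (finset.in_setT _)).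
  by rewrite p1 p2 p3.
move=> g; pose poly n (f : 'I_n -> R) : {poly R} := \poly_(i < n) (if insub i is Some j then f j else 0).
have polyE n f (i : 'I_n) : (poly n f)`_i = f i.
  by rewrite coef_poly ltn_ord; case: insubP => [j _ /val_inj -> //|]; rewrite ltn_ord.
exists (poly _ (fun i => g (inl (inl i))), poly _ (fun i => g (inl (inr i))), poly _ (fun i => g (inr i))).
  by split; apply: size_poly.
by case=> [[i|i]|i] _; rewrite /lam /= polyE.
Qed.

Lemma deriv_eq0 p : p^`() = 0 -> p = (p.[0])%:P.
Proof.
move=> dp; apply/polyP => -[|i]; rewrite coefC /=; first by rewrite horner_coef0.
have := congr1 (fun q : {poly R} => q`_i) dp; rewrite /= coef_deriv coef0.
by move/eqP; rewrite mulrn_eq0 => /eqP.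
Qed.

Lemma syzygies_dim x y k : mate x = Some y -> is_dim (syzygies G x y k) (d_ G x k).
Proof.
move=> xy; rewrite /d_ xy.
have sS : subspace (syzygies G x y k).
  split; first by rewrite /syzygies /= !mulr0 !addr0 !size_poly0.
  move=> a [[A1 B1] C1] [[A2 B2] C2] [e1 [s1 s2 s3]] [e2 [t1 t2 t3]].
  split; last by split; rewrite size_lin.
  transitivity (a *: (na G x * A1 + nb G x * B1 + dc G x * C1) + (na G x * A2 + nb G x * B2 + dc G x * C2)).
    by rewrite /= -!mul_polyC; ring.
  by rewrite e1 e2 scaler0 addr0.
have [|n hn] := is_dim_sub (triple_dim k (k.+1 - FD y) (k.+1 - FD x)) sS.
  by case=> [[A B] C] [_ [s1 s2 s3]].
by rewrite (dimSE hn).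
Qed.

Lemma espace_dim x y k : mate x = Some y -> is_dim (espace G x y k) (1 + d_ G x k).
Proof.
move=> xy; pose f z : etriple R := (z.1.1^`(), z.1.2, - z.2).
have hf : linmap f.
  by move=> a u v; rewrite /f /= derivD derivZ opprD -scalerN.
apply: (is_dim_ker_im hf (espace_subspace G x y k)).
  have -> : 1%N = #|{: unit}| by rewrite card_unit.
  apply: (is_dim_fin (e := fun=> (1, 0, 0) : etriple R)) => [c|z].
    rewrite (bigD1 tt) //= big1 ?addr0; last by case.
    move=> /(congr1 (fun z : etriple R => z.1.1)) /= /eqP.
    by rewrite scaler_eq0 oner_eq0 orbF => /eqP c0 [].
  split=> [[_ [/deriv_eq0 e1 e2 /eqP]]|[c ->]].
    rewrite oppr_eq0 => /eqP e3; exists (fun=> z.1.1.[0]).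
    rewrite (bigD1 tt) //= big1 ?addr0; last by case.
    case: z e1 e2 e3 => [[h B] C] /= e1 -> ->; congr (_, _, _); rewrite ?scaler0 //.
    by rewrite {1}e1 alg_polyC.
  rewrite (bigD1 tt) //= big1 ?addr0; last by case.
  rewrite /f /espace /syz /= derivZ deriv1 !scaler0 !mulr0 addr0 oppr0 !size_poly0.
  split=> //; split=> //; apply: leq_trans (size_scale_leq _ _) _.
  by rewrite size_poly1.
apply: eq_is_dim (syzygies_dim k xy) => -[[A B] C]; split.
  case=> e [s1 s2 s3]; have [h [sh dh _]] := primitive 0 s1.
  exists (h, B, - C); last by rewrite /f /= dh opprK.
  split=> //=; first by rewrite size_polyN.
  by rewrite /syz dh mulrN; apply/eqP; rewrite -addr_eq0 e.
case=> -[[h B'] C'] [/= sh sB sC H] [<- <- <-]; split; last first.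
  split=> //; last by rewrite size_polyN.
  exact: size_deriv_le.
by move: H; rewrite /syz => ->; rewrite mulrN subrr.
Qed.

Definition ekernel x k : set (etriple R) := if mate x is Some y
  then [set z : etriple R | [/\ espace G x y k z, etay z = (zero4, zero4) & etay (eflip x y z) = (zero4, zero4)]]%classic
  else [set z : etriple R | [/\ z.1.2 = 0, (size z.1.1 <= k.+1)%N, (size z.2 <= k.+1 - FD x)%N,
          tay z.1.1 z.2 = zero4 & tay2 (flip (FD x) (z.1.1, z.2)) = zero4]]%classic.

Lemma boundary_realized F k d d' : (F <= 1)%N -> (3 + F <= k)%N -> exists h C,
  [/\ (size h <= k.+1)%N, (size C <= k.+1 - F)%N, tay h C = d & tay2 (flip F (h, C)) = d'].
Proof.
case: d d' => [[[a0 a1] a2] a3] [[[b0 b1] b2] b3] F1 hk.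
have [h [sh h0 dh0 h1 dh1]] := hermite a0 a1 b0 (- b1).
have [C [sC C0 dC0 C1 dC1]] := hermite a2 a3
  (b2 + h^`().[1] *+ F) (- b3 + h^`()^`().[1] *+ F).
exists h, C; split.
- by apply: leq_trans sh _; move: hk; clear; lia.
- by apply: leq_trans sC _; move: hk; clear; lia.
- by rewrite /tay h0 dh0 C0 dC0.
by rewrite /tay2 tay_flip h1 C1 dC1 !addrK dh1 !opprK.
Qed.

Lemma boundary_kernel_dim x k : mate x = None -> (3 + FD x <= k)%N ->
  exists2 e, (e + 9 = 2 * k + 3 - FD x)%N & is_dim (ekernel x k) e.
Proof.
move=> xn hk; rewrite /ekernel xn; have F1 := FD_le1 x.
pose co (d : jet R) (i : 'I_4) : R :=
  match val i with 0%N => d.1.1.1 | 1%N => d.1.1.2 | 2%N => d.1.2 | _ => d.2 end.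
pose td (b : bool) z : jet R := if b then (z.1.1.[1], - (z.1.1^`().[1]),
    z.2.[1] - z.1.1^`().[1] *+ FD x, - (z.2^`().[1] - z.1.1^`()^`().[1] *+ FD x))
  else tay z.1.1 z.2.
have tdE z : tay2 (flip (FD x) (z.1.1, z.2)) = td true z by apply: tay_flip.
pose lam (p : bool * 'I_4) z : R := co (td p.1 z) p.2.
have lamP (p : bool * 'I_4) (a : R) (u v : etriple R) : lam p (a *: u + v) = a * lam p u + lam p v.
  case: p => b i; case: u v => [[h1 B1] C1] [[h2 B2] C2]; rewrite /lam /td /=; case: b => /=.
    rewrite /co !(derivD, derivZ) !(hornerD, hornerZ).
    by case: i => -[|[|[|[|//]]]] hi /=; ring.
  rewrite tay_lin /co; by case: i => -[|[|[|[|//]]]] hi.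
have co0 d : d = zero4 <-> forall i, co d i = 0.
  case: d => -[[v a] b] c; split=> [[-> -> -> ->] [[|[|[|[|//]]]] hi] //|h].
  have h0 := h (@Ordinal 4 0 isT); have h1 := h (@Ordinal 4 1 isT).
  have h2 := h (@Ordinal 4 2 isT); have h3 := h (@Ordinal 4 3 isT).
  by move: h0 h1 h2 h3; rewrite /co /= => -> -> -> ->.
have dimS := triple_dim k.+1 0 (k.+1 - FD x).
have [|e [ee he]] := is_dim_kernel (A := [set: bool * 'I_4]) lamP dimS.
  move=> g; pose g' b i := g (b, @inord 3 i).
  pose d b := (g' b 0%N, g' b 1%N, g' b 2%N, g' b 3%N).
  have [h [C [sh sC t0 t1]]] := boundary_realized (d false) (d true) F1 hk.
  exists (h, 0, C); first by split; rewrite /= ?size_poly0.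
  case=> b i _; have -> : g (b, i) = g' b i by rewrite /g' inord_val.
  rewrite /lam /= (_ : td b _ = d b); last by case: b; rewrite -?tdE.
  by rewrite /co /d; case: i => -[|[|[|[|//]]]].
exists e.
  by move: ee; rewrite cardsT card_prod card_bool card_ord; move: hk F1; clear; lia.
apply: eq_is_dim he => z; split=> [[[s1 s2 s3] l0]|[s2 s1 s3 t0 t1]]; last first.
  split; first by split=> //; rewrite s2 size_poly0.
  by case=> b i _; rewrite /lam /td /=; case: b; [rewrite -[X in co X]/(td true z) -tdE t1|rewrite t0]; apply: (co0 zero4).1.
split=> //.
- by apply/eqP; rewrite -size_poly_eq0 -leqn0.
- by apply/co0 => i; apply: (l0 (false, i) (finset.in_setT _)).
- by rewrite tdE; apply/co0 => i; apply: (l0 (true, i) (finset.in_setT _)).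
Qed.

Lemma separated_from_far x y k : mate x = Some y -> separated_from G x y k ->
  separated_from G (far x) (far y) k.
Proof.
move=> xy sep j kj; have [hj _] := separated_ge xy (sep j kj).
have j0 : (0 < j)%N by move: hj; clear; lia.
apply/(separatedP G (mate_far xy) j0) => z1 z2 hz1 hz2.
have [z hz [e1 e2]] := (separatedP G xy j0).1 (sep j kj) _ _ (espace_unfar xy hz2) (espace_unfar xy hz1).
exists (eflip x y z); first exact: espace_far.
by rewrite !eflip_far eflipK e1 e2 eflipK.
Qed.

Lemma ends_realized x y k d1 d2 d1' d2' : mate x = Some y -> separated_from G x y k ->
  corner_glue G x d1 d2 -> corner_glue G (far x) d1' d2' ->
  exists z, [/\ espace G x y k z, etay z = (d1, d2) & etay (eflip x y z) = (d1', d2')].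
Proof.
move=> xy sep gl gl'; have [hk _] := separated_ge xy (sep k (leqnn k)).
have k0 : (0 < k)%N by move: hk; clear; lia.
have [z1 hz1 e1] := corner_realized xy sep gl.
have [z2 hz2 e2] := corner_realized (mate_far xy) (separated_from_far xy sep) gl'.
have hz2' := espace_unfar xy hz2.
have [z hz [f1 f2]] := (separatedP G xy k0).1 (sep k (leqnn k)) _ _ hz1 hz2'.
by exists z; rewrite f1 f2 eflipK.
Qed.

Lemma interior_kernel_dim x y k : mate x = Some y -> separated_from G x y k ->
  exists2 e, (e + 9 = d_ G x k + crossing G x + crossing G (far x))%N & is_dim (ekernel x k) e.
Proof.
move=> xy sep; rewrite /ekernel xy.
pose fl (b : bool) := if b then far x else x.
pose td (b : bool) z : jet R * jet R :=
  if b then etay (eflip x y z) else etay z.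
pose co (t : jet R * jet R) (i : 'I_5) : R :=
  match val i with 0%N => t.2.1.1.1 | 1%N => t.2.1.1.2 | 2%N => t.2.1.2 | 3%N => t.2.2 | _ => t.1.2 end.
pose lam (p : bool * 'I_5) z : R := co (td p.1 z) p.2.
have lamP (p : bool * 'I_5) (a : R) (u v : etriple R) : lam p (a *: u + v) = a * lam p u + lam p v.
  have lin i w1 w2 : co (etay (a *: w1 + w2)) i = a * co (etay w1) i + co (etay w2) i.
    case: w1 w2 => [[h1 B1] C1] [[h2 B2] C2]; rewrite /etay /= !tay_lin /co.
    by case: i => -[|[|[|[|[|//]]]]] hi.
  case: p => -[] i; rewrite /lam /td /=; last exact: lin.
  by rewrite eflip_lin lin.
pose A := [set p : bool * 'I_5 | (val p.2 != 4%N) || ~~ crossing G (fl p.1)].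
have crE b : crossing G (fl b) = (ga G (fl b) 0 == 0).
  by rewrite /crossing /fl; case: b; rewrite ?(mate_far xy) ?xy.
have zero_glue b (t : jet R * jet R) : corner_glue G (fl b) t.1 t.2 ->
    (forall i, (b, i) \in A -> co t i = 0) -> t = (zero4, zero4).
  case: t => -[[[v1 s1] g1] w1] [[[v2 s2] g2] w2] [/= -> -> e1 e2] h.
  have h0 := h (@Ordinal 5 0 isT); have h1 := h (@Ordinal 5 1 isT).
  have h2 := h (@Ordinal 5 2 isT); have h3 := h (@Ordinal 5 3 isT).
  move: h0 h1 h2 h3; rewrite /co !inE /= => /(_ isT) v0 /(_ isT) s0 /(_ isT) g0 /(_ isT) w0.
  subst v2 s2 g2 w2; rewrite e1 !mulr0 addr0; congr (_, _, _, _, _).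
  have := h (@Ordinal 5 4 isT); rewrite inE /= crE /co /=.
  by case: eqP => [a0 _|_ -> //]; rewrite e2 // !mulr0 !addr0.
have [|m [em hm]] := is_dim_kernel (A := A) lamP (espace_dim k xy).
  move=> g; pose g' b i := g (b, @inord 4 i).
  pose d2 b := (g' b 0%N, g' b 1%N, g' b 2%N, g' b 3%N).
  pose d1 b := (g' b 0%N, g' b 1%N, gb G (fl b) 0 * g' b 2%N + ga G (fl b) 0 * g' b 1%N,
    if ga G (fl b) 0 == 0 then gb' G (fl b) 0 * g' b 2%N + gb G (fl b) 0 * g' b 3%N + ga' G (fl b) 0 * g' b 1%N
    else g' b 4%N).
  have gl b : corner_glue G (fl b) (d1 b) (d2 b) by split=> // /eqP ->.
  have [z [hz f1 f2]] := ends_realized xy sep (gl false) (gl true).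
  exists z => // -[b i]; rewrite inE /= crE => cr.
  have -> : g (b, i) = g' b i by rewrite /g' inord_val.
  rewrite /lam /= (_ : td b z = (d1 b, d2 b)); last first.
    by rewrite /td; case: b {cr}; rewrite ?f1 ?f2.
  rewrite /co /=; case: i cr => -[|[|[|[|[|//]]]]] hi //=.
  by move=> /negPf ->.
exists m.
  move: em; have -> : #|A| = (10 - crossing G x - crossing G (far x))%N.
    rewrite (card_set_pair (fun b (i : 'I_5) => (val i != 4%N) || ~~ crossing G (fl b))).
    rewrite big_bool /= ![X in (X + _)%N]big_mkcond ![X in (_ + X)%N]big_mkcond /=.
    rewrite !big_ord_recl !big_ord0 /=.
    by case: (crossing G x); case: (crossing G (far x)).
  by case: (crossing G x); case: (crossing G (far x)) => /=; clear; lia.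
apply: eq_is_dim hm => z; split=> [[hz l0]|[hz t0 t1]]; last first.
  split=> // -[b i] _; rewrite /lam /td /=.
  by case: b; rewrite ?t0 ?t1 /co /=; case: i => -[|[|[|[|[|//]]]]].
split=> //.
  apply: (zero_glue false); first exact: espace_corner_glue hz.
  by move=> i iA; apply: (l0 (false, i)).
apply: (zero_glue true).
  exact: (espace_corner_glue (mate_far xy) (espace_far xy hz)).
by move=> i iA; apply: (l0 (true, i)).
Qed.

End EdgeDimensions.

(** * Taylor data at the vertices *)

Section VertexSpace.
Variables (R : realType) (M : surface R) (G : gluing M).
Implicit Types (x y : flag M) (c : corner M) (s : seq (flag M)).

Lemma mate_neq x : mate x <> Some x.
Proof. by move/mate_not_self => []. Qed.

Definition xmate x : option (flag M) := if crossing G x then mate x else None.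

Lemma xmateP x y : xmate x = Some y <-> mate x = Some y /\ ga G x 0 = 0.
Proof.
rewrite /xmate /crossing; case: (mate x) => [z|] /=; last by split=> [|[]].
by case: eqP => a0; split=> // -[].
Qed.

Lemma xmate_sym x y : xmate x = Some y -> xmate y = Some x.
Proof.
case/xmateP=> xy a0; apply/xmateP; split; first exact: mate_sym.
by apply/eqP; rewrite (ga_mate0 G xy) a0.
Qed.

Lemma xmate_neq x : xmate x <> Some x.
Proof. by case/xmateP=> /mate_neq. Qed.

Lemma xmate_None x : (xmate x == None) = ~~ crossing G x.
Proof. by rewrite /xmate; case: ifP => //; rewrite /crossing => /andP[/negPf ->]. Qed.

Definition first3 := (R * R * R)%type.
Definition orient (b : bool) (t : first3) : first3 := if b then t else (t.1.1, t.2, t.1.2).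

Lemma orientK b : involutive (orient b).
Proof. by case: b => -[[v s] g]. Qed.

Definition grad_step x (t : first3) : first3 :=
  if mate x is Some y then
    orient y.2 (let: (v, s, g) := orient x.2 t in (v, s, (g - ga G x 0 * s) / gb G x 0))
  else t.

Lemma grad_stepK x y : mate x = Some y -> cancel (grad_step x) (grad_step y).
Proof.
move=> xy t; have b0 := gb_neq0 G xy (zero01 R); have [a b] := gluing_mate G xy (zero01 R).
rewrite /grad_step xy (mate_sym xy) orientK -[RHS](orientK x.2).
case: (orient x.2 t) => -[v u] g; congr (orient _ (_, _, _)).
by rewrite /ga /gb a b -/(ga G x 0) -/(gb G x 0); field.
Qed.

Definition gcol x (t : first3) : 'cV[R]_2 :=
  \col_i (if i == ord0 then (orient x.2 t).1.2 else (orient x.2 t).2).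

Lemma gcol_inj x t t' : t.1.1 = t'.1.1 -> gcol x t = gcol x t' -> t = t'.
Proof.
move=> e /colP h; have := h ord0; have := h ord_max; rewrite !mxE /=.
case: t t' e {h} => [[v u] g] [[v' u'] g'] /= ->; rewrite /orient.
by case: x.2 => /= -> ->.
Qed.

Lemma gcol_step x z t : turn_rel (@mate _ M) x z ->
  gcol x t = transition G x *m gcol z (grad_step x t) /\ (grad_step x t).1.1 = t.1.1.
Proof.
move/(turn_relP (@mate _ M)) => xz; have b0 := gb_neq0 G xz (zero01 R).
rewrite /grad_step xz; split; last first.
  by case: t => [[v u] g]; rewrite /orient; case: x.2; case: (other z).2.
apply/colP => i; rewrite !mxE big_ord_recl big_ord1 !mxE /=.
have -> : orient z.2 (orient (~~ z.2) (let: (v, u, g) := orient x.2 t in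
    (v, u, (g - ga G x 0 * u) / gb G x 0))) =
    let: (v, u, g) := orient x.2 t in (v, (g - ga G x 0 * u) / gb G x 0, u).
  by case: (orient x.2 t) => -[v u] g; case: z.2.
case: (orient x.2 t) => -[v u] g /=.
case: (unliftP ord0 i) => [j|] -> /=; last by rewrite mul0r mul1r add0r.
by rewrite mulrC divfK // subrK.
Qed.

Lemma gcol_path x p z t : path (turn_rel (@mate _ M)) x (rcons p z) ->
  gcol x t = (\prod_(a <- x :: p) transition G a) *m
    gcol z (foldl (fun v a => grad_step a v) t (x :: p)) /\
  (foldl (fun v a => grad_step a v) t (x :: p)).1.1 = t.1.1.
Proof.
elim: p x t => [|y p IH] x t /=.
  by rewrite andbT big_seq1 => /(gcol_step t).
case/andP=> /(gcol_step t)[e1 e2] /(IH y (grad_step x t))[e3 e4].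
rewrite big_cons -e2 -e4; split=> //.
by rewrite e1 {1}e3 mulmxA.
Qed.

Lemma grad_holonomy s : compatibility1 G -> s != [::] -> uniq s -> cycle (turn_rel (@mate _ M)) s ->
  forall t, foldl (fun v a => grad_step a v) t s = t.
Proof.
case: s => // x p compat _ u cyc t.
have ic : interior_cycle (x :: p) by rewrite /interior_cycle u.
have [e1 e2] := gcol_path t cyc; rewrite (compat _ ic) mul1mx in e1.
by apply: (@gcol_inj x) => //; rewrite -e1.
Qed.

Lemma crossing_cycleP s : crossing_cycle G s <->
  [/\ s != [::], uniq s & cycle (turn_rel xmate) s].
Proof.
split=> [/andP[/and3P[s0 us cyc] cr]|[s0 us cyc]].
  split=> //; apply: (sub_in_cycle (P := crossing G)) cr cyc => x y xs _ xy.
  rewrite /turn_rel /xmate; rewrite (xs : crossing G x); exact: xy.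
have sub x y : turn_rel xmate x y -> turn_rel (@mate _ M) x y /\ crossing G x.
  move/(turn_relP xmate) => /[dup] xz /xmateP[xy a0]; split; first exact/turn_relP.
  by rewrite /crossing xy a0 eqxx.
apply/andP; split.
  apply/and3P; split=> //; apply: sub_cycle cyc => x y /sub[]; exact.
by apply/allP => x xs; have /sub[] := next_cycle cyc xs.
Qed.

Section MixedTransport.
Variable J : corner M -> first3.
Hypothesis JP : forall x y, mate x = Some y -> J y.1 = grad_step x (J x.1).

Definition Jx x := orient x.2 (J x.1).

Lemma Jx_glue x y : mate x = Some y -> [/\ (Jx x).1.1 = (Jx y).1.1, (Jx x).1.2 = (Jx y).1.2 &
  (Jx x).2 = gb G x 0 * (Jx y).2 + ga G x 0 * (Jx y).1.2].
Proof.
move=> xy; have b0 := gb_neq0 G xy (zero01 R).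
rewrite /Jx (JP xy) /grad_step xy orientK; case: (orient x.2 _) => -[v u] g /=.
by split=> //; rewrite mulrC divfK // subrK.
Qed.

Definition mixed_step x (w : R) : R := if mate x is Some y then
  (w - gb' G x 0 * (Jx y).2 - ga' G x 0 * (Jx y).1.2) / gb G x 0 else w.

Lemma mixed_step_glue x y w : mate x = Some y ->
  w = gb' G x 0 * (Jx y).2 + gb G x 0 * mixed_step x w + ga' G x 0 * (Jx y).1.2.
Proof.
by move=> xy; have b0 := gb_neq0 G xy (zero01 R); rewrite /mixed_step xy; field.
Qed.

Lemma mixed_corner_glue x y w : mate x = Some y ->
  corner_glue G x ((Jx x).1.1, (Jx x).1.2, (Jx x).2, w)
    ((Jx y).1.1, (Jx y).1.2, (Jx y).2, mixed_step x w).
Proof. by move=> xy; have [-> -> e] := Jx_glue xy; split=> // _; apply: mixed_step_glue. Qed.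

Lemma mixed_stepK x y : xmate x = Some y -> cancel (mixed_step x) (mixed_step y).
Proof.
move=> xmy w; case/xmateP: (xmate_sym xmy) => yx a0; case/xmateP: xmy => xy _.
have [e1 e2 _ /(_ a0) e] := corner_glue_mate xy (mixed_corner_glue w xy).
have f := mixed_step_glue (mixed_step x w) yx.
apply: (mulfI (gb_neq0 G yx (zero01 R))); apply: (addrI (gb' G y 0 * (Jx x).2)).
by apply: (addIr (ga' G y 0 * (Jx x).1.2)); rewrite -f e.
Qed.

Lemma mixed_holonomy s : compatibility1 G -> compatibility2 G -> crossing_vertices_have_4_edges G ->
  s != [::] -> uniq s -> cycle (turn_rel xmate) s ->
  forall t, foldl (fun v a => mixed_step a v) t s = t.
Proof.
move=> compat1 compat2 four s0 us cyc t.
have cc : crossing_cycle G s by apply/crossing_cycleP.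
have ic := cc; case/andP: ic => ic _; have cyc' := ic; case/and3P: cyc' => _ _ cyc'.
have := four _ cc; case: s s0 us cyc cyc' ic cc => [|x1 [|x2 [|x3 [|x4 [|]]]]] // _ us _ cyc' ic cc _.
have [c1 c2] := compat2 _ _ _ _ cc.
have c0 := compat1 _ ic.
have cr x : x \in [:: x1; x2; x3; x4] -> ga G x 0 = 0.
  by move=> xs; have /andP[_ /allP/(_ _ xs)/andP[_ /eqP]] := cc.
have a1 : ga G x1 0 = 0 by apply: cr; rewrite !inE eqxx.
have a2 : ga G x2 0 = 0 by apply: cr; rewrite !inE eqxx ?orbT.
have a3 : ga G x3 0 = 0 by apply: cr; rewrite !inE eqxx ?orbT.
have a4 : ga G x4 0 = 0 by apply: cr; rewrite !inE eqxx ?orbT.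
have tr x : ga G x 0 = 0 -> transition G x =
    \matrix_(i, j) (if i == ord0 then (j != ord0)%:R else if j == ord0 then gb G x 0 else 0).
  by move=> ax; apply/matrixP => i j; rewrite !mxE ax; case: ifP => //; case: (j == _).
have [b13 b24] : gb G x1 0 * gb G x3 0 = 1 /\ gb G x2 0 * gb G x4 0 = 1.
  move: c0; rewrite !big_cons big_nil mulr1 !tr // => /matrixP c0.
  have := c0 ord0 ord0; have := c0 ord_max ord_max.
  rewrite !(mxE, big_ord_recl, big_ord0) /= !(mul0r, mulr0, add0r, addr0, mul1r, mulr1) => e1 e2.
  by split.
have step x z : turn_rel (@mate _ M) x z -> ga G x 0 = 0 ->
    [/\ (Jx x).1.2 = (Jx z).2, (Jx x).2 = gb G x 0 * (Jx z).1.2 & forall w,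
     mixed_step x w = (w - gb' G x 0 * (Jx z).1.2 - ga' G x 0 * (Jx z).2) / gb G x 0].
  move/(turn_relP (@mate _ M)) => xz ax; have [_ e1 e2] := Jx_glue xz.
  have [f1 f2] : (Jx (other z)).1.2 = (Jx z).2 /\ (Jx (other z)).2 = (Jx z).1.2.
    by rewrite /Jx /other /orient /=; case: (z.2).
  by rewrite e1 e2 ax mul0r addr0 f1 f2; split=> // w; rewrite /mixed_step xz f1 f2.
move: cyc'; rewrite /= andbT => /and4P[/step/(_ a1)[p1 q1 s1] /step/(_ a2)[p2 q2 s2] /step/(_ a3)[p3 q3 s3] /step/(_ a4)[p4 q4 s4]].
rewrite s4 s3 s2 s1.
have b1 : gb G x1 0 != 0.
  by apply/eqP => h; move/eqP: b13; rewrite h mul0r eq_sym oner_eq0.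
have b2 : gb G x2 0 != 0.
  by apply/eqP => h; move/eqP: b24; rewrite h mul0r eq_sym oner_eq0.
have e3 : gb G x3 0 = (gb G x1 0)^-1 by apply: (mulfI b1); rewrite b13 divff.
have e4 : gb G x4 0 = (gb G x2 0)^-1 by apply: (mulfI b2); rewrite b24 divff.
rewrite e4 invrK in c1; rewrite e3 invrK in c2.
have f1 : ga' G x1 0 = - gb G x1 0 * (ga' G x3 0 + gb' G x2 0 / gb G x2 0) - gb' G x4 0 * gb G x2 0.
  by rewrite -c1 addrK.
have f2 : ga' G x2 0 = - gb G x2 0 * (ga' G x4 0 + gb' G x3 0 * gb G x1 0) - gb' G x1 0 / gb G x1 0.
  by rewrite -c2 addrK.
have g3 : (Jx x3).1.2 = (Jx x1).1.2 / gb G x2 0 by rewrite p1 q2 mulrC mulKf.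
rewrite p4 -p3 -p2 -p1 q1 g3 f1 f2 e3 e4.
move: b1 b2; move: (gb G x1 0) (gb G x2 0) => B1 B2 b1 b2.
move: (gb' G x1 0) (gb' G x2 0) (gb' G x3 0) (gb' G x4 0) => d1 d2 d3 d4.
move: (ga' G x3 0) (ga' G x4 0) => a3' a4'.
move: (Jx x1).1.2 (Jx x2).1.2 => P1 P2.
by field; rewrite b1 b2.
Qed.

End MixedTransport.

End VertexSpace.

Section VertexDimension.
Variables (R : realType) (M : surface R) (G : gluing M).
Implicit Types (x y : flag M) (c : corner M) (s : seq (flag M)).

Notation o0 := (@Ordinal 4 0 isT).
Notation o1 := (@Ordinal 4 1 isT).
Notation o2 := (@Ordinal 4 2 isT).
Notation o3 := (@Ordinal 4 3 isT).

Definition cdata := {ffun corner M * 'I_4 -> R^o}.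
Implicit Types (D E : cdata).

Definition dat D x : jet R :=
  let d := (D (x.1, o0) : R, D (x.1, o1) : R, D (x.1, o2) : R, D (x.1, o3) : R) in
  if x.2 then d else perm4 d.

Definition mkdat (d : corner M -> jet R) : cdata := [ffun p =>
  match val p.2 with 0%N => (d p.1).1.1.1 | 1%N => (d p.1).1.1.2 | 2%N => (d p.1).1.2 | _ => (d p.1).2 end].

Lemma dat_mkdat d c : dat (mkdat d) (c, true) = d c.
Proof. by rewrite /dat /mkdat /= !ffunE /=; case: (d c) => -[[]]. Qed.

Lemma dat_swap D x : dat D (swap x) = perm4 (dat D x).
Proof. by rewrite /dat /=; case: x => c [] //=; rewrite perm4K. Qed.

Definition lin4 (a : R) (d e : jet R) : jet R :=
  (a * d.1.1.1 + e.1.1.1, a * d.1.1.2 + e.1.1.2, a * d.1.2 + e.1.2, a * d.2 + e.2).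

Lemma dat_lin a D E x : dat (a *: D + E) x = lin4 a (dat D x) (dat E x).
Proof. by rewrite /dat !ffunE; case: x => c []. Qed.

Lemma glue_lin a x d1 d2 e1 e2 : corner_glue G x d1 d2 -> corner_glue G x e1 e2 ->
  corner_glue G x (lin4 a d1 e1) (lin4 a d2 e2).
Proof.
case: d1 d2 e1 e2 => [[[v1 s1] g1] w1] [[[v2 s2] g2] w2] [[[v3 s3] g3] w3] [[[v4 s4] g4] w4].
move=> [-> -> -> h1] [-> -> -> h2]; split=> //=; first by ring.
by move=> a0; rewrite h1 // h2 //; ring.
Qed.

Definition hset : set cdata := [set D | forall x y, mate x = Some y ->
  corner_glue G x (dat D x) (dat D y)]%classic.

Lemma hset_subspace : subspace hset.
Proof.
split=> [x y xy|a D E hD hE x y xy]; last by rewrite !dat_lin; apply: glue_lin; [apply: hD|apply: hE].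
have e z : dat 0 z = zero4 by rewrite /dat !ffunE; case: z.2.
by rewrite !e; split=> // *; rewrite !mulr0 !addr0.
Qed.

Definition hcoords : {set corner M * 'I_4} :=
  [set p : corner M * 'I_4 | if (p.2 < 3)%N then p.1 \in vertices M else roots (corner_rel (xmate G)) p.1].

Lemma card_hcoords : #|hcoords| =
  (3 * #|vertices M| + #|[set c | roots (corner_rel (xmate G)) c]|)%N.
Proof.
rewrite (card_set_pair (fun c (i : 'I_4) => if (i < 3)%N then c \in vertices M
  else roots (corner_rel (xmate G)) c)).
rewrite (eq_bigr (fun c => 3 * (c \in vertices M) + roots (corner_rel (xmate G)) c)%N); last first.
  move=> c _; rewrite big_mkcond !big_ord_recl big_ord0 /=.
  by case: (c \in _); case: (roots _ _).
rewrite big_split /= -big_distrr /= -!sum1_card [in RHS]big_mkcond [X in (_ + X)%N = _]/=.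
congr (_ * _ + _)%N; rewrite [in RHS]big_mkcond /=.
by apply: eq_bigr => c _; rewrite inE; case: (roots _ _).
Qed.

Lemma grad_zero D x : [/\ D (x.1, o0) = 0, D (x.1, o1) = 0 & D (x.1, o2) = 0] <->
  [/\ (dat D x).1.1.1 = 0, (dat D x).1.1.2 = 0 & (dat D x).1.2 = 0].
Proof. by rewrite /dat; case: x => c [] /=; split=> -[-> -> ->]. Qed.

Lemma dat_mixed D x : (dat D x).2 = D (x.1, o3).
Proof. by rewrite /dat; case: x => c []. Qed.

Lemma hset_inj D : hset D -> (forall p, p \in hcoords -> D p = 0) -> D = 0.
Proof.
move=> hD D0.
have symm : connect_sym (corner_rel (@mate _ M)) := connect_corner_sym (@mate_sym _ M).
have symx : connect_sym (corner_rel (xmate G)) := connect_corner_sym (@xmate_sym _ _ G).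
have grad c : [/\ D (c, o0) = 0, D (c, o1) = 0 & D (c, o2) = 0].
  pose Q c := [/\ D (c, o0) = 0, D (c, o1) = 0 & D (c, o2) = 0].
  apply: (@corner_ind _ (@mate _ M) Q (fingraph.root (corner_rel (@mate _ M)) c)).
  - move=> a b ab /(grad_zero D a).1[v0 s0 g0]; apply/grad_zero.
    have := hD _ _ (mate_sym ab); move: v0 s0 g0.
    case: (dat D a) => -[[v u] g] w; case: (dat D b) => -[[v' u'] g'] w' /= -> -> -> [-> -> -> _].
    by rewrite !mulr0 addr0.
  - by rewrite symm connect_root.
  have rv : fingraph.root (corner_rel (@mate _ M)) c \in vertices M by rewrite inE; apply: roots_root.
  by split; apply: D0; rewrite inE.
have mixed c : D (c, o3) = 0.
  pose Q c := D (c, o3) = 0.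
  apply: (@corner_ind _ (xmate G) Q (fingraph.root (corner_rel (xmate G)) c)).
  - move=> a b /(@xmate_sym _ _ G)/xmateP[ba b0]; rewrite /Q -(dat_mixed D a) -(dat_mixed D b).
    have := hD _ _ ba; have := (grad_zero D a).1 (grad a.1).
    case: (dat D a) => -[[v u] g] w; case: (dat D b) => -[[v' u'] g'] w' /= [-> -> ->] [_ _ _ /(_ b0)->] ->.
    by rewrite !mulr0 !addr0.
  - by rewrite symx connect_root.
  by apply: D0; rewrite inE /=; apply: roots_root.
apply/ffunP => -[c i]; rewrite ffunE; have [g0 g1 g2] := grad c; have g3 := mixed c.
by case: i => -[|[|[|[|//]]]] hi; [rewrite -[RHS]g0|rewrite -[RHS]g1|rewrite -[RHS]g2|rewrite -[RHS]g3];
   congr (D (_, _)); apply: val_inj.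
Qed.

Hypotheses (compat1 : compatibility1 G) (compat2 : compatibility2 G).
Hypothesis four_edges : crossing_vertices_have_4_edges G.

Lemma hset_surj (g : corner M * 'I_4 -> R) : exists2 D, hset D & forall p, p \in hcoords -> D p = g p.
Proof.
have [J [Jr JP]] := transport (@mate_sym _ M) (@mate_neq _ M) (@grad_stepK _ _ G)
  (fun s => grad_holonomy (s := s) compat1) (fun c => (g (c, o0), g (c, o1), g (c, o2))).
have [W [Wr WP]] := transport (@xmate_sym _ _ G) (@xmate_neq _ _ G) (mixed_stepK JP)
  (fun s => mixed_holonomy (s := s) JP compat1 compat2 four_edges) (fun c => g (c, o3)).
have datE x : dat (mkdat (fun c => (J c, W c))) x =
    ((Jx J x).1.1, (Jx J x).1.2, (Jx J x).2, W x.1).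
  case: x => c [|]; first by rewrite dat_mkdat /Jx /=; case: (J c) => -[].
  by rewrite -[(c, false)]/(swap (c, true)) dat_swap dat_mkdat /Jx /=; case: (J c) => -[].
exists (mkdat (fun c => (J c, W c))).
  move=> x y xy; rewrite !datE.
  have [a0|a0] := eqVneq (ga G x 0) 0.
    by rewrite (WP x y) ?xmateP //; apply: mixed_corner_glue.
  by have [-> -> ->] := Jx_glue JP xy; split=> // /eqP; rewrite (negPf a0).
case=> c i; rewrite inE /= ffunE /=.
case: i => -[|[|[|[|//]]]] hi /= hc; rewrite (bool_irrelevance hi isT); last by rewrite Wr.
all: by move: hc; rewrite inE => hc; rewrite (Jr c hc).
Qed.

Lemma hset_dim : is_dim hset (3 * #|vertices M| + #|[set c | roots (corner_rel (xmate G)) c]|).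
Proof.
rewrite -card_hcoords; apply: (is_dim_coord (lam := fun p D => D p)).
- by move=> p a D E; rewrite !ffunE.
- exact: hset_subspace.
- exact: hset_inj.
exact: hset_surj.
Qed.

Lemma crossing_verticesE : crossing_vertices G =
  [set c | roots (corner_rel (xmate G)) c && saturated (xmate G) c].
Proof.
have rootE s c : crossing_cycle G s -> c \in [seq x.1 | x <- s] ->
    roots (corner_rel (xmate G)) c = roots (corner_rel (@mate _ M)) c.
  move=> cs cin; rewrite /roots /= /fingraph.root.
  have /(crossing_cycleP G)[_ _ cyc] := cs.
  have cyc' : cycle (turn_rel (@mate _ M)) s by have /andP[/and3P[_ _ h] _] := cs; exact: h.
  congr (odflt _ _ == _); apply: eq_pick => c'.
  rewrite (cycle_class (@xmate_sym _ _ G) cyc cin).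
  by rewrite (cycle_class (@mate_sym _ M) cyc' cin).
apply/setP => c; rewrite !inE; apply/andP/andP => [[rc /asboolP[s [cs cin]]]|[rc]].
  split; first by rewrite (rootE s).
  apply/(saturatedP (@xmate_sym _ _ G) (@xmate_neq _ _ G)).
  by have /(crossing_cycleP G)[s0 us cyc] := cs; exists s.
move/(saturatedP (@xmate_sym _ _ G) (@xmate_neq _ _ G)) => [s [s0 us cyc cin]].
have cs : crossing_cycle G s by apply/(crossing_cycleP G).
split; first by move: rc; rewrite (rootE s) //.
by apply/asboolP; exists s.
Qed.

Lemma count_crossing : (2 * #|[set c | roots (corner_rel (xmate G)) c]| + #|[set x | crossing G x]| =
  2 * #|crossing_vertices G| + 2 * #|corner M|)%N.
Proof.
have un := card_unmatched (@xmate_sym _ _ G) (@xmate_neq _ _ G).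
have e1 : (#|[set c | roots (corner_rel (xmate G)) c]| = #|crossing_vertices G| +
    #|[set c | roots (corner_rel (xmate G)) c && ~~ saturated (xmate G) c]|)%N.
  rewrite crossing_verticesE -(cardsID [set c | saturated (xmate G) c]); congr (_ + _)%N;
  by apply: eq_card => c; rewrite !inE // andbC.
have e2 : (#|[set x | crossing G x]| + #|[set x : flag M | xmate G x == None]| = 2 * #|corner M|)%N.
  have -> : [set x : flag M | xmate G x == None] = ~: [set x | crossing G x].
    by apply/setP => x; rewrite !inE xmate_None.
  by rewrite cardsC card_prod card_bool mulnC.
by rewrite e1 mulnDr -un -e2 -addnA; congr (_ + _)%N; apply: addnC.
Qed.

End VertexDimension.

(** * Assembly of splines *)

Section Assembly.
Variables (R : realType) (M : surface R) (G : gluing M).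
Implicit Types (x y w r : flag M) (c : corner M) (D : cdata M).

Notation eroot := (fingraph.root (@edge_rel _ M)).
Lemma edge_rel_sym : connect_sym (@edge_rel _ M).
Proof.
apply: sym_connect_sym => x y; rewrite /edge_rel.
by apply/orP/orP => -[/eqP h|/eqP h]; [left; rewrite h farK|right; apply/eqP/mate_sym|
   left; rewrite h farK|right; apply/eqP/mate_sym].
Qed.

Lemma eroot_far x : eroot (far x) = eroot x.
Proof.
apply/eqP; rewrite root_connect; last exact: edge_rel_sym.
by rewrite edge_rel_sym; apply: connect1; rewrite /edge_rel eqxx.
Qed.

Lemma eroot_mate x y : mate x = Some y -> eroot y = eroot x.
Proof.
move=> xy; apply/eqP; rewrite root_connect; last exact: edge_rel_sym.
by rewrite edge_rel_sym; apply: connect1; rewrite /edge_rel xy eqxx orbT.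
Qed.

Lemma eroot_edges x : eroot x \in edges M.
Proof. by rewrite inE; apply/roots_root/edge_rel_sym. Qed.

Lemma eroot_id r : r \in edges M -> eroot r = r.
Proof. by rewrite inE => /eqP. Qed.

Definition edge_class r x := [\/ x = r, x = far r,
  mate r = Some x | mate r = Some (far x)].

Lemma edge_class_eroot x : edge_class (eroot x) x.
Proof.
have : connect (@edge_rel _ M) (eroot x) x by rewrite edge_rel_sym connect_root.
move: (eroot x) => r /connectP[p pp ->].
suff gen q : path (@edge_rel _ M) q p -> edge_class r q -> edge_class r (last q p).
  by apply: gen pp _; apply: Or41.
elim: p q {pp} => //= z p IH q /andP[qz pz] hq; apply: IH pz _.
move: qz; rewrite /edge_rel => /orP[/eqP->|/eqP qz].
  by case: hq => [->|->|h|h]; [apply: Or42|rewrite farK; apply: Or41|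
     apply: Or44; rewrite farK|apply: Or43].
case: hq => [e|e|h|h].
- by apply: Or43; rewrite -e.
- by apply: Or44; move/mate_far: qz; rewrite e farK.
- by apply: Or41; move/mate_sym: h; rewrite qz => -[].
- by apply: Or42; move/mate_sym/mate_far: h; rewrite farK qz => -[].
Qed.

Lemma edge_cases x : exists2 r, r \in edges M & edge_class r x.
Proof. by exists (eroot x); [apply: eroot_edges|apply: edge_class_eroot]. Qed.

Lemma far_neq x : far x != x.
Proof. by apply/eqP => /(congr1 snd) /=; case: (x.2). Qed.

Lemma edge_distinct r y : mate r = Some y ->
  [/\ y != r, far y != r, y != far r & far y != far r].
Proof.
move=> ry; have [n1 n2] := mate_not_self ry.
split; apply/eqP => e; [exact: n1|apply: n2|exact: n2|apply: n1].
  by rewrite -e farK.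
exact: (can_inj (@farK _ _)) e.
Qed.

(* Extends data given at one representative flag of each edge to all its flags. *)
Definition spread (z : flag M -> etriple R) x : {poly R} * {poly R} :=
  let r := eroot x in let t := z r in
  if x == r then (t.1.1, t.2) else if x == far r then flip (FD r) (t.1.1, t.2)
  else if mate r is Some y then
    if x == y then (t.1.1, t.1.2) else flip (FD y) (t.1.1, t.1.2)
  else 0.

Section Spread.
Variables (z : flag M -> etriple R) (r : flag M).
Hypothesis rE : r \in edges M.

Lemma spread_root : spread z r = ((z r).1.1, (z r).2).
Proof. by rewrite /spread eroot_id // eqxx. Qed.

Lemma spread_far : spread z (far r) = flip (FD r) ((z r).1.1, (z r).2).
Proof. by rewrite /spread eroot_far eroot_id // (negPf (far_neq r)) eqxx. Qed.

Lemma spread_mate y : mate r = Some y -> spread z y = ((z r).1.1, (z r).1.2).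
Proof.
move=> ry; have [n1 _ n2 _] := edge_distinct ry.
by rewrite /spread (eroot_mate ry) eroot_id // (negPf n1) (negPf n2) ry eqxx.
Qed.

Lemma spread_mate_far y : mate r = Some y -> spread z (far y) = flip (FD y) ((z r).1.1, (z r).1.2).
Proof.
move=> ry; have [_ n1 _ n2] := edge_distinct ry.
rewrite /spread eroot_far (eroot_mate ry) eroot_id // (negPf n1) (negPf n2) ry.
by rewrite (negPf (far_neq y)).
Qed.

End Spread.

Lemma spreadP z x : spread z (far x) = flip (FD x) (spread z x).
Proof.
have [r rE [->|->|h|h]] := edge_cases x.
- by rewrite (spread_far _ rE) (spread_root _ rE).
- by rewrite farK (spread_far _ rE) (spread_root _ rE) FD_far flipK.
- by rewrite (spread_mate_far _ rE h) (spread_mate _ rE h).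
- by rewrite -{2 3}[x]farK (spread_mate_far _ rE h) (spread_mate _ rE h) FD_far flipK.
Qed.

Definition prescribed k D r (t : etriple R) : Prop := if mate r is Some y
  then [/\ espace G r y k t, etay t = (dat D r, dat D y) &
           etay (eflip r y t) = (dat D (far r), dat D (far y))]
  else [/\ t.1.2 = 0, (size t.1.1 <= k.+1)%N, (size t.2 <= k.+1 - FD r)%N,
           tay t.1.1 t.2 = dat D r & tay2 (flip (FD r) (t.1.1, t.2)) = dat D (far r)].

Definition ez (f : {ffun face M -> {mpoly R[2]}}) r : etriple R :=
  (e0 r (f (fface r)), if mate r is Some y then e1 y (f (fface y)) else 0, e1 r (f (fface r))).

Section Assemble.
Variables (k : nat) (D : cdata M) (z : flag M -> etriple R).
Hypothesis zP : forall r, r \in edges M -> prescribed k D r (z r).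

Lemma spread_size x : (size (spread z x).1 <= k.+1)%N /\ (size (spread z x).2 <= k.+1 - FD x)%N.
Proof.
have [r rE] := edge_cases x; have := zP rE; rewrite /prescribed.
move=> + [->|->|h|h].
- by rewrite spread_root //; case: (mate r) => [y [[]]|[_ sh sC _ _]].
- rewrite spread_far // FD_far; case: (mate r) => [y [[sh _ sC _] _ _]|[_ sh sC _ _]];
  by apply: size_flip => //; apply: FD_le1.
- by rewrite (spread_mate _ rE h) h => -[[]].
rewrite -[x]farK (spread_mate_far _ rE h) farK h => -[[sh sB _ _] _ _].
by rewrite -(FD_far x) FD_far -(FD_far x); apply: size_flip => //; apply: FD_le1.
Qed.

Lemma spread_tay x : tay2 (spread z x) = dat D x.
Proof.
have [r rE] := edge_cases x; have := zP rE; rewrite /prescribed.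
move=> + [->|->|h|h].
- rewrite spread_root //; case: (mate r) => [y [_ e _]|[_ _ _ e _]]; last exact: e.
  exact: (congr1 fst e).
- rewrite spread_far //; case: (mate r) => [y [_ _ e]|[_ _ _ _ e]]; last exact: e.
  exact: (congr1 fst e).
- by rewrite (spread_mate _ rE h) h => -[_ e _]; exact: (congr1 snd e).
rewrite -[x]farK (spread_mate_far _ rE h) h => -[_ _ e].
exact: (congr1 snd e).
Qed.

Lemma spread_glue x y : mate x = Some y -> (spread z x).1 = (spread z y).1 /\
  syz G x (spread z x).1^`() (spread z y).2 (spread z x).2.
Proof.
have [r rE] := edge_cases x; have := zP rE; rewrite /prescribed.
move=> + [->|->|h|h].
- move=> + ry; rewrite ry => -[[_ _ _ H] _ _].
  by rewrite (spread_root _ rE) (spread_mate _ rE ry).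
- move=> + fy; have := mate_far fy; rewrite farK => ry; rewrite ry => -[[_ _ _ H] _ _].
  rewrite -[y]farK (spread_far _ rE) (spread_mate_far _ rE ry); split=> //.
  exact: syz_far ry H.
- rewrite h => -[[_ _ _ H] _ _]; rewrite (mate_sym h) => -[<-].
  rewrite (spread_root _ rE) (spread_mate _ rE h); split=> //.
  exact: syz_mate h H.
rewrite h => -[[_ _ _ H] _ _] xy.
have fr : y = far r by have := mate_far (mate_sym h); rewrite farK xy => -[].
rewrite fr -[x]farK (spread_far _ rE) (spread_mate_far _ rE h); split=> //.
exact: syz_far (mate_sym h) (syz_mate h H).
Qed.

Lemma assemble : (forall x, (3 + FD x <= k)%N) -> exists f, [/\ splines G k f,
  forall x, tay2 (edat x (f (fface x))) = dat D x &
  forall r, r \in edges M -> ez f r = z r].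
Proof.
move=> hk; have [] := face_interpolation hk (spreadP z) _ spread_size.
  by move=> x; rewrite !spread_tay dat_swap.
move=> f [fR fE]; exists f; split.
- split=> // x y xy; apply/(G1_syz _ _ _ xy); have [e H] := spread_glue xy.
  have [ex1 ex2] : e0 x (f (fface x)) = (spread z x).1 /\ e1 x (f (fface x)) = (spread z x).2.
    by rewrite -fE.
  have [ey1 ey2] : e0 y (f (fface y)) = (spread z y).1 /\ e1 y (f (fface y)) = (spread z y).2.
    by rewrite -fE.
  by rewrite ex1 ex2 ey1 ey2.
- by move=> x; rewrite fE spread_tay.
move=> r rE; have := fE r; rewrite (spread_root _ rE) /edat /ez => /pair_equal_spec[-> ->].
have := zP rE; rewrite /prescribed; case E: (mate r) => [y|].
  have := fE y; rewrite (spread_mate _ rE E) => /pair_equal_spec[_ ->] _.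
  by case: (z r) => [[]].
by case: (z r) => [[h B] C] [/= -> _ _ _ _].
Qed.

End Assemble.
End Assembly.

Section SplineDimension.
Variables (R : realType) (M : surface R) (G : gluing M).
Implicit Types (x y w r : flag M) (c : corner M).

Lemma edge_class_root r x : r \in edges M -> edge_class r x -> fingraph.root (@edge_rel _ M) x = r.
Proof.
move=> rE [->|->|h|h]; first exact: eroot_id.
- by rewrite eroot_far eroot_id.
- by rewrite (eroot_mate h) eroot_id.
by rewrite -eroot_far (eroot_mate h) eroot_id.
Qed.

Lemma mate_far_None x : mate x = None -> mate (far x) = None.
Proof. by case E: (mate (far x)) => [y|//]; have := mate_far E; rewrite farK => ->. Qed.

Lemma crossing_edges : (2 * \sum_(r in edges M) (crossing G r + crossing G (far r)) =
  #|[set x | crossing G x]|)%N.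
Proof.
have -> : #|[set x | crossing G x]| = (\sum_(x : flag M) crossing G x)%N.
  by rewrite -sum1_card big_mkcond; apply: eq_bigr => x _; rewrite inE; case: (crossing G x).
rewrite [RHS](partition_big (fun x => fingraph.root (@edge_rel _ M) x) (fun r => r \in edges M)) /=; last first.
  by move=> x _; apply: eroot_edges.
rewrite big_distrr /=; apply: eq_bigr => r rE.
case E: (mate r) => [y|]; last first.
  have nfr := mate_far_None E.
  rewrite {1 2}/crossing E nfr /= muln0 big1 // => x /eqP xr.
  have := edge_class_eroot x; rewrite xr /crossing => -[->|->|h|h]; rewrite ?E ?nfr //.
    by rewrite E in h.
  by rewrite E in h.
rewrite (eq_bigl (fun x => x \in [:: r; far r; y; far y])); last first.
  move=> x; rewrite !inE; apply/eqP/or4P => [xr|h].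
    have := edge_class_eroot x; rewrite xr => -[->|->|h|h].
    - by rewrite eqxx; apply: Or41.
    - by rewrite eqxx; apply: Or42.
    - by move: h; rewrite E => -[->]; rewrite eqxx; apply: Or43.
    - by move: h; rewrite E => -[->]; rewrite farK eqxx; apply: Or44.
  apply: edge_class_root => //; case: h => /eqP->.
  - exact: Or41.
  - exact: Or42.
  - exact: Or43.
  - by apply: Or44; rewrite farK.
have [n1 n2 n3 n4] := edge_distinct E.
have u : uniq [:: r; far r; y; far y].
  rewrite /= !inE !negb_or !andbT; apply/and3P; split; last by rewrite eq_sym far_neq.
    by rewrite ![r == _]eq_sym far_neq n1 n2.
  by rewrite ![far r == _]eq_sym n3 n4.
rewrite -big_uniq //= !big_cons big_nil (crossing_mate G E) (crossing_mate G (mate_far E)).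
by move: (crossing G r : nat) (crossing G (far r) : nat) => a b; clear; lia.
Qed.

Lemma sum_faces (a b : nat) : (\sum_(s : face M) (if is_tri s then a else b) =
  a * #|[set s : face M | is_tri s]| + b * #|[set s : face M | ~~ is_tri s]|)%N.
Proof.
rewrite (eq_bigr (fun s => a * is_tri s + b * ~~ is_tri s)%N); last first.
  by move=> s _; case: is_tri; rewrite ?muln1 ?muln0 ?addn0.
rewrite big_split /= -!big_distrr /= -!sum1_card.
by congr (_ * _ + _ * _)%N; rewrite [RHS]big_mkcond; apply: eq_bigr => s _; rewrite inE; case: is_tri.
Qed.

Lemma card_corners : #|corner M| =
  (3 * #|[set s : face M | is_tri s]| + 4 * #|[set s : face M | ~~ is_tri s]|)%N.
Proof.
rewrite card_tagged sumnE big_map big_enum -sum_faces.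
by apply: eq_bigr => s _; rewrite card_ord.
Qed.

Hypotheses (compat1 : compatibility1 G) (compat2 : compatibility2 G).
Hypothesis four_edges : crossing_vertices_have_4_edges G.
Variable k : nat.
Hypothesis hk : (max_separability G <= k)%N.

Lemma separability_edge r : r \in edges M -> (separability G r <= k)%N.
Proof. by move=> rE; apply: leq_trans hk; apply: leq_bigmax_cond. Qed.

Lemma separated_edge r y : r \in edges M -> mate r = Some y -> separated_from G r y k.
Proof. by move=> rE ry; apply: separabilityP => //; apply: separability_edge. Qed.

Lemma degree_bound x : (3 + FD x <= k)%N.
Proof.
have [r rE xr] := edge_cases x; have sr := separability_edge rE.
case E: (mate r) => [y|].
  have [h1 h2] := separated_ge E (separated_edge rE E (leqnn k)).
  case: xr => [->|->|h|h]; rewrite ?FD_far //.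
    by move: h; rewrite E => -[<-].
  by rewrite -FD_far; move: h; rewrite E => -[<-].
move: sr; rewrite /separability E => sr.
by case: xr => [->|->|h|h]; rewrite ?FD_far //; rewrite E in h.
Qed.

Lemma kernel_dim r : r \in edges M -> exists2 e,
  (e + 9 = d_ G r k + crossing G r + crossing G (far r))%N & is_dim (ekernel G r k) e.
Proof.
move=> rE; case E: (mate r) => [y|].
  exact: interior_kernel_dim E (separated_edge rE E).
have [e he dime] := boundary_kernel_dim G E (degree_bound r).
exists e => //; rewrite he /d_ E.
have nfr := mate_far_None E.
by rewrite {1 2}/crossing E nfr /= !addn0.
Qed.

Lemma inner_dim (s : face M) :
  is_dim (inner k s) (if is_tri s then 'C((k - 5).+1, 2) else ((k - 3) * (k - 3))%N).
Proof.
have [x <-] := face_flag s; have := degree_bound x; rewrite /FD.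
case: ifPn => [tx h|rx h]; first exact: tri_inner.
by apply: rect_inner => //; move: h; rewrite addn0.
Qed.

Implicit Types (f g : {ffun face M -> {mpoly R[2]}}).

Definition corner_data f : cdata M := mkdat (fun c => tay2 (edat (c, true) (f (tag c)))).

Lemma dat_corner_data f x : dat (corner_data f) x = tay2 (edat x (f (fface x))).
Proof.
case: x => c [|]; first by rewrite dat_mkdat.
by rewrite -[(c, false)]/(swap (c, true)) dat_swap dat_mkdat tay_swap.
Qed.

Lemma corner_data_eq f (D : cdata M) :
  (forall x, tay2 (edat x (f (fface x))) = dat D x) -> corner_data f = D.
Proof.
move=> h; apply/ffunP => -[c i]; have := h (c, true); rewrite -dat_corner_data.
rewrite /dat /= => -[e0 e1 e2 e3].
by case: i => -[|[|[|[|//]]]] hi; rewrite (bool_irrelevance hi isT).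
Qed.

Lemma corner_data_lin : linmap corner_data.
Proof.
move=> a f g; apply/ffunP => -[c i]; rewrite !ffunE /= e0_lin e1_lin !(derivD, derivZ) !(hornerD, hornerZ).
by case: i => -[|[|[|[|//]]]].
Qed.

Definition edge_data f : {ffun flag M -> etriple R} :=
  [ffun r => if r \in edges M then ez f r else 0].

Lemma edge_data_lin : linmap edge_data.
Proof.
move=> a f g; apply/ffunP => r; rewrite !ffunE; case: ifP => _; last by rewrite scaler0 addr0.
rewrite /ez !ffunE !e0_lin !e1_lin; case: (mate r) => [y|]; first by rewrite !ffunE e1_lin.
by congr (_, _, _); rewrite /= scaler0 addr0.
Qed.

Lemma splines_subspace : subspace (splines G k).
Proof.
split.
  split=> [s|x y xy]; first by rewrite ffunE; apply: Rk0.
  apply/(G1_syz _ _ _ xy); rewrite !ffunE /e0 /e1 !rmorph0 !coef0 /syz deriv0 !mulr0.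
  by rewrite addr0.
move=> a f g [fR fG] [gR gG]; split=> [s|x y xy].
  by rewrite !ffunE; apply: (Rk_subspace k s).2.
have /(G1_syz _ _ _ xy)[h1 h2] := fG _ _ xy; have /(G1_syz _ _ _ xy)[h3 h4] := gG _ _ xy.
apply/(G1_syz _ _ _ xy); rewrite !ffunE !e0_lin !e1_lin h1 h3; split=> //.
move: h2 h4; rewrite /syz h1 h3 derivD derivZ => h2 h4.
rewrite !mulrDr -!scalerAr -h2 -h4 scalerDr -!addrA; congr (_ + _).
by rewrite addrCA.
Qed.

Lemma splines_prescribed f r : splines G k f -> r \in edges M ->
  prescribed G k (corner_data f) r (ez f r).
Proof.
case=> fR fG rE; rewrite /prescribed /ez; case E: (mate r) => [y|]; last first.
  split=> //=; first exact: size_e0.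
  - exact: size_e1.
  - by rewrite dat_corner_data.
  by rewrite dat_corner_data edat_far fface_far.
have /(G1_syz _ _ _ E)[h1 h2] := fG _ _ E.
split.
- by split=> //=; [apply: size_e0|apply: size_e1|apply: size_e1].
- by rewrite /etay !dat_corner_data /tay2 /= -h1.
rewrite /etay !dat_corner_data !edat_far !fface_far; congr (_, _).
by rewrite /tay2 /eflip /edat /= -h1.
Qed.

Lemma corner_data_image : (corner_data @` splines G k = hset G)%classic.
Proof.
apply/seteqP; split=> [_ [f [fR fG] <-] x y xy|D hD].
  rewrite !dat_corner_data; have /(G1_syz _ _ _ xy)[h1 h2] := fG _ _ xy.
  by rewrite {2}/tay2 /= -h1; apply: syz_corner_glue xy h2.
have /choice [z zP] : forall r, exists t, r \in edges M -> prescribed G k D r t.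
  move=> r; have [rE|] := boolP (r \in edges M); last by exists 0.
  rewrite /prescribed; case E: (mate r) => [y|].
    have [t ht] := ends_realized E (separated_edge rE E) (hD _ _ E) (hD _ _ (mate_far E)).
    by exists t.
  have [h [C [sh sC t0 t1]]] := boundary_realized (dat D r) (dat D (far r)) (FD_le1 r) (degree_bound r).
  by exists (h, 0, C).
have [f [fS fD _]] := assemble zP (degree_bound).
by exists f => //; apply: corner_data_eq.
Qed.

Lemma dat0 x : dat (0 : cdata M) x = zero4.
Proof. by rewrite /dat !ffunE; case: x.2. Qed.

Lemma prescribed0 r (t : etriple R) : prescribed G k 0 r t <-> ekernel G r k t.
Proof.
rewrite /prescribed /ekernel; case: (mate r) => [y|]; rewrite !dat0; split; case=> *; split=> //.
Qed.

Definition flat_splines := [set f | splines G k f /\ corner_data f = 0]%classic.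

Lemma flat_splines_subspace : subspace flat_splines.
Proof.
have [s0 s1] := splines_subspace.
split; first by split=> //; apply: linmap0 corner_data_lin.
move=> a f g [fS f0] [gS g0]; split; first exact: s1.
by rewrite corner_data_lin f0 g0 scaler0 addr0.
Qed.

Lemma edge_data_image : (edge_data @` flat_splines =
  [set g : {ffun flag M -> etriple R} | forall r,
    (if r \in edges M then ekernel G r k else [set 0]%classic) (g r)])%classic.
Proof.
apply/seteqP; split=> [_ [f [fS f0] <-] r|z hz].
  rewrite ffunE; case: ifP => [rE|] //.
  by apply/prescribed0; rewrite -f0; apply: splines_prescribed.
have zP r : r \in edges M -> prescribed G k 0 r (z r).
  by move=> rE; apply/prescribed0; have := hz r; rewrite rE.
have [f [fS fD fz]] := assemble zP (degree_bound).
exists f.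
  by split=> //; apply: corner_data_eq.
apply/ffunP => r; rewrite ffunE; case: ifPn => [/fz//|rE].
by have := hz r; rewrite (negPf rE).
Qed.

Lemma inner_splines f : (flat_splines f /\ edge_data f = 0) <-> forall s, inner k s (f s).
Proof.
split=> [[[[fR fG] _] f0] s|fi].
  have ed x : edat x (f (fface x)) = 0.
    have [r rE] := edge_cases x; have /ffunP/(_ r) := f0; rewrite !ffunE rE /ez.
    case E: (mate r) => [y|] /pair_equal_spec[/pair_equal_spec[h0 h1] h2]; last first.
      have r0 : edat r (f (fface r)) = 0 by rewrite /edat h0 h2.
      by case=> [->|->|h|h]; [|rewrite fface_far; apply: edat_far0|rewrite E in h|rewrite E in h].
    have r0 : edat r (f (fface r)) = 0 by rewrite /edat h0 h2.
    have y0 : edat y (f (fface y)) = 0.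
      by have /(G1_syz _ _ _ E)[e _] := fG _ _ E; rewrite /edat h1 -e h0.
    case=> [->|->|h|h] //.
    - by rewrite fface_far; apply: edat_far0.
    - by move: h; rewrite E => -[<-].
    by rewrite -[x]farK; move: h; rewrite E => -[<-]; rewrite fface_far; apply: edat_far0.
  by split=> // c <-; apply: ed (c, true).
have ed x : edat x (f (fface x)) = 0.
  case: x => c [|]; first by have [_] := fi (tag c); apply.
  have -> : (c, false) = far (prev_corner c, true) by rewrite /far /= next_prevK.
  rewrite fface_far; apply: edat_far0; have [_] := fi (tag (prev_corner c)); exact.
have e00 x : e0 x (f (fface x)) = 0 by have := ed x => /pair_equal_spec[].
have e10 x : e1 x (f (fface x)) = 0 by have := ed x => /pair_equal_spec[].
split; last first.
  apply/ffunP => r; rewrite !ffunE /ez e00 e10; case: ifP => // _.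
  by case: (mate r) => [y|]; rewrite ?e10.
split.
  split=> [s|x y xy]; first by have [] := fi s.
  apply/(G1_syz _ _ _ xy); rewrite !e00 !e10; split=> //.
  by rewrite /syz deriv0 !mulr0 addr0.
by apply: corner_data_eq => x; rewrite ed tay2_0 dat0.
Qed.

Lemma splines_dim (e : flag M -> nat) :
  (forall r, is_dim (if r \in edges M then ekernel G r k else [set 0]%classic) (e r)) ->
  is_dim (splines G k) (\sum_(s : face M) (if is_tri s then 'C((k - 5).+1, 2) else (k - 3) * (k - 3))
    + \sum_r e r + (3 * #|vertices M| + #|[set c | roots (corner_rel (xmate G)) c]|))%N.
Proof.
move=> he; apply: (is_dim_ker_im corner_data_lin (splines_subspace)); last first.
  by rewrite corner_data_image //; apply: hset_dim.
apply: (is_dim_ker_im edge_data_lin flat_splines_subspace); last first.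
  by rewrite edge_data_image; exact: is_dim_prod he.
have hi := is_dim_prod (inner_dim); apply: eq_is_dim hi => f.
exact: iff_sym (inner_splines f).
Qed.

End SplineDimension.

Lemma dimS_splines (R : realType) (M : surface R) (G : gluing M) (k : nat) :
  compatibility1 G -> compatibility2 G -> crossing_vertices_have_4_edges G ->
  (max_separability G <= k)%N ->
  (dimS (splines G k) + 9 * #|edges M| =
    'C((k - 5).+1, 2) * #|[set s : face M | is_tri s]|
    + (k - 3) * (k - 3) * #|[set s : face M | ~~ is_tri s]|
    + \sum_(x in edges M) d_ G x k
    + 4 * #|[set s : face M | ~~ is_tri s]| + 3 * #|[set s : face M | is_tri s]|
    + 3 * #|vertices M| + #|crossing_vertices G|)%N.
Proof.
move=> compat1 compat2 four_edges hk.
have /choice [e eP] : forall r, exists e,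
    is_dim (if r \in edges M then ekernel G r k else [set 0]%classic) e /\
    (e + 9 * (r \in edges M) = (r \in edges M) * (d_ G r k + (crossing G r + crossing G (far r))))%N.
  move=> r; case: ifP => rE; last by exists 0%N; split=> //; apply: is_dim0.
  have [e he de] := kernel_dim hk rE; exists e; split=> //.
  by rewrite muln1 he mul1n addnA.
rewrite (dimSE (splines_dim compat1 compat2 four_edges hk (fun r => (eP r).1))).
have ee : (\sum_r e r + 9 * #|edges M| = \sum_(x in edges M) d_ G x k +
    \sum_(r in edges M) (crossing G r + crossing G (far r)))%N.
  have -> : (9 * #|edges M| = \sum_(r : flag M) 9 * (r \in edges M))%N.
    by rewrite -big_distrr -sum1_card big_mkcond.
  rewrite -!big_split [RHS]big_mkcond; apply: eq_bigr => r _ /=.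
  by have [_ ->] := eP r; case: ifP; rewrite ?mul1n.
rewrite sum_faces; move: ee (crossing_edges G) (count_crossing G) (card_corners M).
by clear; lia.
Qed.

Theorem theorem6p3 (R : realType) (M : surface R) (G : gluing M)
    (compat1 : compatibility1 G)
    (compat2 : compatibility2 G)
    (four_edges : crossing_vertices_have_4_edges G)
    (k : nat) (hk : (max_separability G <= k)%N) :
  let F_box := #|[set sigma : face M | ~~ is_tri sigma]|%:R : rat in
  let F_tri := #|[set sigma : face M | is_tri sigma]|%:R : rat in
  let F1 := #|edges M|%:R : rat in
  let F0 := #|vertices M|%:R : rat in
  let F_plus := #|crossing_vertices G|%:R : rat in
  (dimS (splines G k))%:R =
    (k%:R - 3) ^+ 2 * F_box + 2^-1 * (k%:R - 5) * (k%:R - 4) * F_tri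
    + (\sum_(x in edges M) d_ G x k)%:R
    + 4 * F_box + 3 * F_tri - 9 * F1 + 3 * F0 + F_plus :> rat.
Proof.
move=> F_box F_tri F1 F0 F_plus.
have rect : ((k - 3) * (k - 3) * #|[set s : face M | ~~ is_tri s]|)%:R = (k%:R - 3) ^+ 2 * F_box :> rat.
  rewrite natrM /F_box; case: (posnP #|[set s : face M | ~~ is_tri s]|) => [->|/card_gt0P[s _]].
    by rewrite !mulr0.
  have [x _] := face_flag s; have := degree_bound hk x => hx.
  by rewrite natrM natrB ?expr2 //; apply: leq_trans hx; apply: leq_addr.
have tri : ('C((k - 5).+1, 2) * #|[set s : face M | is_tri s]|)%:R
    = 2^-1 * (k%:R - 5) * (k%:R - 4) * F_tri :> rat.
  rewrite natrM /F_tri; case: (posnP #|[set s : face M | is_tri s]|) => [->|/card_gt0P[s]].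
    by rewrite !mulr0.
  rewrite inE => ts; have [x xs] := face_flag s; have := degree_bound hk x; rewrite /FD xs ts => k4.
  congr (_ * _); have := mul_bin_left (k - 5).+1 1; rewrite bin1 subSS subn0.
  move/(congr1 (fun n => n%:R : rat)); rewrite !natrM => e.
  apply: (@mulfI _ 2%:R) => //; rewrite e.
  have [k5|k5] := leqP 5 k; first by rewrite -natr1 natrB //; field.
  have -> : k = 4%N by move: k4 k5; clear; lia.
  by rewrite !mul0r subrr !mulr0.
have /(congr1 (fun n => n%:R : rat)) := dimS_splines compat1 compat2 four_edges hk.
rewrite /= !natrD rect tri -/F_box -/F_tri -/F1 -/F0 -/F_plus => e.
apply: (addIr (9 * F1)); apply: etrans (_ : _ = _) (etrans e _); first by ring.
by ring.
Qed.
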